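(* Fix $r\ge0$ and $n\ge0$. There is a bijection $\mathbf w\mapsto(P(\mathbf w),Q(\mathbf w))$ between colored biwords $\mathbf w$ of length $n$ and pairs $(P,Q)$ of semistandard domino tableaux of the same shape $\lambda\in\mathcal P_r(n)$ such that: (1) $tc(\mathbf w)=sp(P(\mathbf w))+sp(Q(\mathbf w))$; (2) the weight of $P(\mathbf w)$ equals the weight of the lower row of $\mathbf w$ and the weight of $Q(\mathbf w)$ equals the weight of the upper row of $\mathbf w$; (3) $P(\mathbf w)^{st}=P_d^r(\mathbf w^{st})$ and $Q(\mathbf w)^{st}=Q_d^r(\mathbf w^{st})$, where $\mathbf w^{st}$ is regarded as a signed permutation in $B_n$.
   Context: Partitions are identified with Young diagrams in English notation: cell $(k,l)$ lies in row $k$ (from the top) and column $l$ (from the left). A domino is a set of two cells sharing an edge (vertical if in one column). $\delta_r=(r,r-1,\dots,1)$; $\mathcal P_r(n)$ is the set of partitions with 2-core $\delta_r$ and size $|\delta_r|+2n$. A semistandard domino tableau of shape $\lambda\in\mathcal P_r(n)$ is a tiling of $\lambda/\delta_r$ by $n$ dominoes, each containing a positive integer, such that giving each cell the number of its domino, entries weakly increase along rows and strictly increase down columns; its weight is $(\mu_1,\mu_2,\dots)$ with $\mu_i$ the number of dominoes labelled $i$, and its spin $sp$ is half the number of vertical dominoes. It is standard (SDT) if its labels are exactly $1,\dots,n$ (equivalently a chain $\delta_r=\lambda^0\subset\cdots\subset\lambda^n$ with $\lambda^k/\lambda^{k-1}$ the domino labelled $k$). Its standardisation $D^{st}$ replaces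 the dominoes labelled $1$ by $1,\dots,\mu_1$ from left to right, those labelled $2$ by $\mu_1+1,\dots,\mu_1+\mu_2$ from left to right, etc. Letters are positive integers, possibly barred; for a letter $y$, $y^{neg}$ is $y$ if unbarred and $-m$ if $y=\bar m$; $|y|$ is the underlying integer. A biletter is a pair $\binom{x}{y}$ of letters. A doubly colored biword is a finite sequence of biletters in canonical order: $\binom{x}{y}$ precedes $\binom{k}{l}$ iff $|x|<|k|$, or $|x|=|k|$ with $x$ barred and $k$ unbarred, or $x=k$ both unbarred and $y^{neg}<l^{neg}$, or $x=k$ both barred and $l^{neg}<y^{neg}$. A colored biword is a doubly colored biword whose top letters are all unbarred; its length is the number of biletters, $tc(\mathbf w)$ is the number of barred letters, and the weights of its rows are the multiplicities of each integer (bars ignored). Operations: $\mathbf w^{\overline{st}}$ replaces the top letters, read left to right, by $1,2,\dots$ keeping their bars; $\mathbf w^{inv}$ swaps the two letters of each biletter (bars travel with letters) and reorders canonically. The standardisation is $\mathbf w^{st}=(((\mathbf w^{\overline{st}})^{inv})^{\overline{st}})^{inv}$; it has top row $1,2,\dots,n$ and bottom row a word in $B_n$. $B_n$ is the set of words $\pi=\pi_1\cdots\pi_n$ in letters $\{1,\dots,n,\bar1,\dots,\bar n\}$ using each $k\in[n]$ exactly once. For $\pi\in B_n$, growth diagram: $M(i,j)=1$ if $\pi_i=j$, $-1$ if $\pi_i=\bar j$, $0$ otherwise; partitions $\lambda_{(i,j)}$, $1\le i,j\le n+1$, with $\lambda_{(1,j)}=\lambda_{(i,1)}=\delta_r$;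 for $i,j\in[n]$, with $\lambda=\lambda_{(i,j)},\mu=\lambda_{(i+1,j)},\nu=\lambda_{(i,j+1)}$, $\rho=\lambda_{(i+1,j+1)}$ is: (1) if $M(i,j)=1$ (then $\lambda=\mu=\nu$), $\lambda$ with two cells appended to its first row; (2) if $M(i,j)=-1$, $\lambda$ with two cells appended to its first column; (3) if $M(i,j)=0$ and $\lambda=\mu$ or $\lambda=\nu$, the largest of $\lambda,\mu,\nu$; (4) otherwise, with dominoes $\gamma=\nu/\lambda$, $\gamma'=\mu/\lambda$: if disjoint, $\lambda\cup\gamma\cup\gamma'$; if they share exactly the cell $(k,l)$, $\lambda\cup\gamma\cup\gamma'\cup\{(k+1,l+1)\}$; if $\gamma=\gamma'$ vertical in column $l$, $\lambda\cup\gamma$ with two cells appended at the bottom of column $l+1$; if $\gamma=\gamma'$ horizontal in row $k$, $\lambda\cup\gamma$ with two cells appended at the end of row $k+1$. $P_d^r(\pi)$ is the SDT given by $\lambda_{(n+1,1)}\subset\cdots\subset\lambda_{(n+1,n+1)}$ and $Q_d^r(\pi)$ the SDT given by $\lambda_{(1,n+1)}\subset\cdots\subset\lambda_{(n+1,n+1)}$. *)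

(* Defs.v *)
From mathcomp Require Import all_boot all_algebra.
From mathcomp Require Import finmap.
Set Implicit Arguments. Unset Strict Implicit. Unset Printing Implicit Defensive.
Import GRing.Theory Num.Theory.


(* A partition is a weakly decreasing seq of positive row lengths.
   Cells are 1-indexed pairs (k,l): row k, column l (English notation). *)
Definition part := seq nat.
Definition cell := (nat * nat)%type.

Definition is_part (lam : part) : bool := sorted geq lam && all (fun x => 0 < x) lam.

Definition delta (r : nat) : part := rev (iota 1 r).

Definition in_cells (lam : part) (c : cell) : bool :=
  (0 < c.1) && (0 < c.2) && (c.2 <= nth 0 lam c.1.-1).

Definition in_skew (lam mu : part) (c : cell) : bool := in_cells lam c && ~~ in_cells mu c.

(* the cells of lam / mu (for mu contained in lam), listed in row-major order *)
Definition skew_cells (lam mu : part) : seq cell :=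
  flatten [seq [seq (i.+1, j) | j <- iota (nth 0 mu i).+1 (nth 0 lam i - nth 0 mu i)]
          | i <- iota 0 (size lam)].

Definition adjacent (c d : cell) : bool :=
  ((c.1 == d.1) && ((c.2.+1 == d.2) || (d.2.+1 == c.2))) ||
  ((c.2 == d.2) && ((c.1.+1 == d.1) || (d.1.+1 == c.1))).

Definition dom_step (lam mu : part) : Prop :=
  [/\ is_part lam, is_part mu, (forall i, nth 0 mu i <= nth 0 lam i) &
      exists c1 c2, skew_cells lam mu = [:: c1; c2] /\ adjacent c1 c2].

Inductive rem_star : part -> part -> Prop :=
| rem_refl lam : rem_star lam lam
| rem_step lam mu kap : dom_step lam mu -> rem_star mu kap -> rem_star lam kap.

Definition has_2core (lam kap : part) : Prop :=
  rem_star lam kap /\ ~ (exists mu, dom_step kap mu).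

Definition in_Pr (r n : nat) (lam : part) : Prop :=
  [/\ is_part lam, has_2core lam (delta r) & sumn lam = sumn (delta r) + 2 * n].

Local Open Scope fset_scope.
(* A labelled domino ((c, vert), a): c = its top-left cell, vert = vertical,
   a = its label.  A domino tableau is a finite set of labelled dominoes. *)
Definition ldom := ((cell * bool) * nat)%type.
Definition tableau := {fset ldom}.

Definition dcells (d : ldom) : seq cell :=
  let: (k, l) := d.1.1 in [:: (k, l); if d.1.2 then (k.+1, l) else (k, l.+1)].

Definition ssdt (r : nat) (lam : part) (T : tableau) : Prop :=
  is_part lam /\
  [/\ (forall d, d \in T -> 0 < d.2),
      (forall c, in_skew lam (delta r) c <-> exists2 d, d \in T & c \in dcells d),
      (forall d e, d \in T -> e \in T -> d != e ->
          forall c, c \in dcells d -> c \notin dcells e),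
      (forall d e, d \in T -> e \in T ->
          forall k l, (k, l) \in dcells d -> (k, l.+1) \in dcells e -> d.2 <= e.2) &
      (forall d e, d \in T -> e \in T -> d != e ->
          forall k l, (k, l) \in dcells d -> (k.+1, l) \in dcells e -> d.2 < e.2)].

Definition wt (T : tableau) (i : nat) : nat := #|` [fset d in T | d.2 == i]|.

Definition sp (T : tableau) : rat := (#|` [fset d in T | d.1.2]|)%:R / 2%:R.

Definition std_label (T : tableau) (d : ldom) : nat :=
  (addn #|` [fset e in T | e.2 < d.2]|
        #|` [fset e in T | (e.2 == d.2) && (e.1.1.2 < d.1.1.2)]|).+1.
Definition std_tab (T : tableau) : tableau := [fset (d.1, std_label T d) | d in T].

Definition domino_of (lam mu : part) : cell * bool :=
  match skew_cells lam mu with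
  | c1 :: c2 :: _ => (c1, c1.1 != c2.1)
  | _ => ((0, 0), false)
  end.
Definition chain_tab (ch : seq part) : tableau :=
  [fset (domino_of (nth [::] ch k.+1) (nth [::] ch k), k.+1) | k in iota 0 (size ch).-1].

Local Close Scope fset_scope.
(* letter (m, b): the integer m, barred iff b *)
Definition letter := (nat * bool)%type.
Definition biletter := (letter * letter)%type.
Definition biword := seq biletter.

Definition lneg (y : letter) : int := if y.2 then (- (Posz y.1))%R else Posz y.1.

Definition canon_lt (a b : biletter) : bool :=
  let: (x, y) := a in let: (k, l) := b in
  [|| x.1 < k.1,
      [&& x.1 == k.1, x.2 & ~~ k.2],
      [&& x == k, ~~ x.2, ~~ k.2 & (lneg y < lneg l)%R] |
      [&& x == k, x.2, k.2 & (lneg l < lneg y)%R]].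
Definition canon_le (a b : biletter) : bool := (a == b) || canon_lt a b.

Definition doubly_colored (w : biword) : bool :=
  all (fun b => (0 < b.1.1) && (0 < b.2.1)) w && sorted canon_le w.

Definition colored_biword (n : nat) (w : biword) : bool :=
  [&& size w == n, doubly_colored w & all (fun b => ~~ b.1.2) w].

Definition tc (w : biword) : nat := count (fun b => b.1.2) w + count (fun b => b.2.2) w.
Definition upper_wt (w : biword) (i : nat) : nat := count (fun b => b.1.1 == i) w.
Definition lower_wt (w : biword) (i : nat) : nat := count (fun b => b.2.1 == i) w.

Definition ost (w : biword) : biword :=
  map (fun p => ((p.1.+1, p.2.1.2), p.2.2)) (zip (iota 0 (size w)) w).
Definition binv (w : biword) : biword := sort canon_le [seq (b.2, b.1) | b <- w].
Definition bst (w : biword) : biword := binv (ost (binv (ost w))).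

(* matrix entry M(i,j): Some false = 1, Some true = -1, None = 0 *)
Definition Mentry (pi : seq letter) (i j : nat) : option bool :=
  let y := nth (0, false) pi i.-1 in if y.1 == j then Some y.2 else None.

Definition row_len (lam : part) (k : nat) : nat := nth 0 lam k.-1.
Definition set_row (lam : part) (k v : nat) : part := set_nth 0 lam k.-1 v.
Definition punion (lam mu : part) : part :=
  mkseq (fun i => maxn (nth 0 lam i) (nth 0 mu i)) (maxn (size lam) (size mu)).
Definition col_height (lam : part) (l : nat) : nat := count (fun x => l <= x) lam.

(* local rule: lam = lambda_(i,j), mu = lambda_(i+1,j), nu = lambda_(i,j+1) *)
Definition local_rule (lam mu nu : part) (m : option bool) : part :=
  match m with
  | Some false => set_row lam 1 (row_len lam 1 + 2)
  | Some true => lam ++ [:: 1; 1]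
  | None =>
    if lam == mu then nu else if lam == nu then mu else
    let g := skew_cells nu lam in
    let g' := skew_cells mu lam in
    let u := punion mu nu in
    match [seq c <- g | c \in g'] with
    | [::] => u
    | [:: (k, l)] => set_row u k.+1 (maxn (row_len u k.+1) l.+1)
    | [:: (k, l); (k', l')] =>
        if l == l' then
          let h := col_height u l.+1 in set_row (set_row u h.+1 l.+1) h.+2 l.+1
        else
          set_row u k.+1 (row_len u k.+1 + 2)
    | _ => u
    end
  end.

Fixpoint grow_row (prev : seq part) (mu : part) (ms : seq (option bool)) : seq part :=
  match prev, ms with
  | lam :: prev', m :: ms' =>
      match prev' with
      | nu :: _ => let rho := local_rule lam mu nu m in rho :: grow_row prev' rho ms'
      | [::] => [::]
      end
  | _, _ => [::]
  end.

(* row i+1 (lambda_(i+1, 1..n+1)) from row i *)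
Definition next_row (r n : nat) (pi : seq letter) (i : nat) (row : seq part) : seq part :=
  delta r :: grow_row row (delta r) [seq Mentry pi i j | j <- iota 1 n].

Fixpoint rows_from (r n : nat) (pi : seq letter) (i : nat) (row : seq part) (k : nat)
  : seq (seq part) :=
  match k with
  | 0 => [:: row]
  | k'.+1 => row :: rows_from r n pi i.+1 (next_row r n pi i row) k'
  end.

Definition growth (r : nat) (pi : seq letter) : seq (seq part) :=
  rows_from r (size pi) pi 1 (nseq (size pi).+1 (delta r)) (size pi).

(* P_d^r(pi): chain lambda_(n+1,1) ⊂ ... ⊂ lambda_(n+1,n+1) *)
Definition Pd (r : nat) (pi : seq letter) : tableau := chain_tab (last [::] (growth r pi)).
(* Q_d^r(pi): chain lambda_(1,n+1) ⊂ ... ⊂ lambda_(n+1,n+1) *)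
Definition Qd (r : nat) (pi : seq letter) : tableau :=
  chain_tab [seq last [::] row | row <- growth r pi].

Definition bottom (w : biword) : seq letter := [seq b.2 | b <- w].

(* Main.v *)
(* A partition lambda is read through its Maya diagram, the set of beads lambda_i - i
   (i >= 0).  Adding a domino moves a bead from p to p+2 over a hole, and the domino is
   vertical exactly when p+1 carries a bead.  On labels p of such moves the local rule is
   short: distinct labels p, q are kept, while p = q is replaced by the next bead below p
   (p+1 a hole) or by h-2 for the next hole h above p+2 (p+1 a bead); the rules for M = 1
   and M = -1 are the limits p = +oo and p = -oo of these two cases.  Hence the rule can be
   reversed, so a growth diagram is determined by its last row and column, and any pair of
   chains from delta_r to the same shape occurs because delta_r admits no removable domino.

   Of two successive dominoes with labels p then q, the second lies strictly to the right
   of the first exactly when p < q, and the local rule preserves this comparison.  So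
   ascents of pi (resp. of its inverse) are the ascents of the recording (resp. insertion)
   chain, which says which successive labels of a standard tableau may be made equal.  As a
   colored biword amounts to its standardisation together with its two weights, subject to
   the same ascent conditions, the standard bijection extends to semistandard tableaux. *)

Require Import Defs.
From mathcomp Require Import all_boot all_order all_algebra.
From mathcomp Require Import finmap zify.
Set Implicit Arguments. Unset Strict Implicit. Unset Printing Implicit Defensive.
Import Order.TTheory GRing.Theory Num.Theory.

(** * Partitions and Maya diagrams *)

(** The spin identity is a conservation law: in every square the two outer edges carry as many
    vertical dominoes as the two inner ones, plus two when M = -1. Summed over the grid, whose edges
    on the [delta r] boundary are degenerate, this leaves twice the number of bars on the last row
    and column, and the one half in [sp] absorbs the two. The local rule is recast as a relation
    [square], usable forwards and backwards. Backwards, neither the entry nor the boundary is given: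
    a repeated outer label p comes from M = 1, from M = -1 or from an earlier repeated move,
    according as p is the top bead, p+2 the lowest hole, or neither. That the recovered entries form
    a signed permutation matrix is then read off the last row and column, where every edge is a
    genuine domino. The comparison of two successive labels starts when the later of their entries
    is met: its label is extremal, so its sign alone decides, exactly as [lneg] compares letters of
    different absolute value. *)

Lemma sorted_nth_le (s : seq nat) i j :
  sorted leq s -> i <= j -> j < size s -> nth 0 s i <= nth 0 s j.
Proof.
move=> srt ij lt_j; apply: (sorted_leq_nth leq_trans leqnn 0 srt) => //.
by rewrite inE (leq_ltn_trans ij).
Qed.

Lemma part_nth_le lam i j : is_part lam -> i <= j -> nth 0%N lam j <= nth 0%N lam i.
Proof.
move=> /andP[srt _] le_ij.
have [lt_js|] := ltnP j (size lam); last by move=> ?; rewrite nth_default.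
have geq_trans : transitive geq by move=> ? ? ?; rewrite /geq /=; lia.
have := sorted_leq_nth geq_trans leqnn 0 srt; apply => //.
by rewrite inE (leq_ltn_trans le_ij).
Qed.

Lemma part_nth_gt0 lam i : is_part lam -> i < size lam -> 0 < nth 0%N lam i.
Proof. by move=> /andP[_ /allP pos] lt_i; apply/pos/mem_nth. Qed.

Lemma last_part lam : is_part lam -> last 1 lam != 0.
Proof.
case: (lastP lam) => // s x /andP[_]; rewrite last_rcons all_rcons.
by case/andP; lia.
Qed.

(** The hypotheses ask for no final zero instead of [is_part], so that results of [set_row],
    [punion] and [++], not yet known to be partitions, can be compared row by row. The default 1
    lets the empty sequence pass. *)
Lemma eq_from_nth_last (s t : seq nat) :
  last 1 s != 0 -> last 1 t != 0 -> nth 0%N s =1 nth 0%N t -> s = t.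
Proof.
have aux u v : last 1 u != 0 -> nth 0%N u =1 nth 0%N v -> size u <= size v.
  case: (lastP u) => // u' x; rewrite last_rcons size_rcons => x0 uv.
  rewrite leqNgt; apply/negP => lt_v; have := uv (size u').
  by rewrite nth_rcons ltnn eqxx (nth_default 0 (s := v)) //; lia.
move=> s1 t1 st; apply: (eq_from_nth (x0 := 0)) => [|i _]; last exact: st.
by apply/eqP; rewrite eqn_leq !aux // => i; rewrite st.
Qed.

Lemma part_eq lam mu : is_part lam -> is_part mu -> nth 0%N lam =1 nth 0%N mu -> lam = mu.
Proof. by move=> /last_part ? /last_part ?; apply: eq_from_nth_last. Qed.

(** Domino moves are built by prescribing row lengths; this turns such a function back into a list,
    cut at its first zero [h]. *)
Lemma part_of_rows (f : nat -> nat) N :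
  (forall i, f i.+1 <= f i) -> f N = 0 -> exists2 lam, is_part lam & nth 0%N lam =1 f.
Proof.
move=> fS fN.
have f_le i j : i <= j -> f j <= f i.
  by move=> /subnKC <-; elim: (j - i) => [|k IH]; rewrite ?addn0 ?addnS ?(leq_trans (fS _)).
pose h := find (fun i => f i == 0) (iota 0 N.+1).
have hasN : has (fun i => f i == 0) (iota 0 N.+1).
  by apply/hasP; exists N; rewrite ?mem_iota ?fN //=; lia.
have lt_h : h < N.+1 by rewrite -[X in _ < X](size_iota 0) -has_find.
have fh : f h = 0.
  by have /eqP := nth_find 0 hasN; rewrite nth_iota.
have f_pos i : i < h -> 0 < f i.
  move=> lt_i; have := before_find 0 lt_i.
  by rewrite nth_iota ?lt0n ?(ltn_trans lt_i) //= add0n => ->.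
exists (mkseq f h) => [|i].
  apply/andP; split; last first.
    by apply/allP => x /mapP[i]; rewrite mem_iota => ? ->; apply: f_pos; lia.
  by apply/(sortedP 0) => i; rewrite size_mkseq => lt_i; rewrite !nth_mkseq //= ?fS //; lia.
have [lt_i|ge_i] := ltnP i h; first by rewrite nth_mkseq.
by rewrite nth_default ?size_mkseq //; move: (f_le _ _ ge_i); lia.
Qed.

(* Maya diagram of lam; the infinitely many empty rows contribute the beads x <= - size lam. *)
Definition bead (lam : part) (x : int) : bool :=
  (x <= - (size lam)%:Z)%R ||
  has (fun i => (nth 0%N lam i)%:Z - i%:Z == x)%R (iota 0 (size lam)).

Lemma beadP (lam : part) x : reflect (exists i, x = ((nth 0%N lam i)%:Z - i%:Z)%R) (bead lam x).
Proof.
apply: (iffP orP) => [[le_x|/hasP[i _ /eqP <-]]|[i ->]]; last 1 first.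
- have [lt_i|ge_i] := ltnP i (size lam); [right | left].
    by apply/hasP; exists i; rewrite ?mem_iota.
  by rewrite nth_default //; lia.
- by exists `|x|%N; rewrite nth_default; lia.
- by exists i.
Qed.

Lemma bead_row lam i : bead lam ((nth 0%N lam i)%:Z - i%:Z)%R.
Proof. by apply/beadP; exists i. Qed.

Lemma bead_inj lam mu : is_part lam -> is_part mu -> bead lam =1 bead mu -> lam = mu.
Proof.
move=> plam pmu eq_b; apply: part_eq => // i.
have [m le_im] := ubnP i; elim: m i le_im => // m IH i le_im.
(* The bead of row [i] of [l1] is that of some row [j] of [l2]. A row [j < i] agrees in both
   partitions and has a strictly higher bead; hence [j >= i], and row [i] of [l2] is at least as
   long. *)
have aux (l1 l2 : part) : is_part l1 -> is_part l2 -> bead l1 =1 bead l2 ->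
    (forall j, j < i -> nth 0%N l1 j = nth 0%N l2 j) -> nth 0%N l1 i <= nth 0%N l2 i.
  move=> p1 p2 eq_l eq_lt; have := bead_row l1 i; rewrite eq_l => /beadP[j].
  have [lt_ji|le_ij] := ltnP j i; last by have := part_nth_le p2 le_ij; lia.
  by have := part_nth_le p1 (ltnW lt_ji); rewrite -eq_lt //; lia.
apply/eqP; rewrite eqn_leq !aux // => j lt_j; rewrite IH //; lia.
Qed.

Lemma bead_low lam : exists N : int, forall x, (x <= N)%R -> bead lam x.
Proof. by exists (- (size lam)%:Z)%R => x le_x; rewrite /bead le_x. Qed.

Lemma bead_high lam : is_part lam -> exists N : int, forall x, (N <= x)%R -> ~~ bead lam x.
Proof.
move=> plam; exists ((nth 0%N lam 0)%:Z + 1)%R => x le_x; apply/beadP => -[i def_x].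
by have := part_nth_le plam (leq0n i); lia.
Qed.

Definition step (lam : part) (p : int) (mu : part) : Prop :=
  [/\ is_part lam, is_part mu, bead lam p, ~~ bead lam (p + 2)%R &
      forall x, bead mu x = (x == p + 2)%R || (x != p) && bead lam x].

Definition stepH (lam : part) (i : nat) (mu : part) : Prop :=
  [/\ is_part lam, is_part mu, nth 0%N mu i = (nth 0%N lam i).+2 &
      forall j, j != i -> nth 0%N mu j = nth 0%N lam j].

Definition stepV (lam : part) (i : nat) (mu : part) : Prop :=
  [/\ is_part lam, is_part mu, nth 0%N lam i.+1 = nth 0%N lam i,
      nth 0%N mu i = (nth 0%N lam i).+1 /\ nth 0%N mu i.+1 = (nth 0%N lam i).+1 &
      forall j, j != i -> j != i.+1 -> nth 0%N mu j = nth 0%N lam j].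

Definition posH (lam : part) (i : nat) : int := ((nth 0%N lam i)%:Z - i%:Z)%R.
(** The bead that jumps belongs to row [i.+1], of the same length as row [i]: hence the extra 1. *)
Definition posV (lam : part) (i : nat) : int := ((nth 0%N lam i)%:Z - i%:Z - 1)%R.

Lemma step_fun lam p mu mu' : step lam p mu -> step lam p mu' -> mu = mu'.
Proof.
by move=> [_ pm _ _ bm] [_ pm' _ _ bm']; apply: bead_inj => // x; rewrite bm bm'.
Qed.

Lemma step_label_inj lam p q mu : step lam p mu -> step lam q mu -> p = q.
Proof.
move=> [_ _ lp lp2 bm] [_ _ lq lq2 bm'].
have := bm (p + 2)%R; rewrite bm' (negPf lp2) !andbF eqxx !orbF => /eqP; lia.
Qed.

Lemma step_inj lam lam' p mu : step lam p mu -> step lam' p mu -> lam = lam'.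
Proof.
move=> [pl _ lp lp2 bm] [pl' _ lp' lp2' bm']; apply: bead_inj => // x.
have [->|xp] := eqVneq x p; first by rewrite lp lp'.
have [->|xp2] := eqVneq x (p + 2)%R; first by rewrite (negPf lp2) (negPf lp2').
by have := bm x; rewrite bm' (negPf xp) (negPf xp2).
Qed.

Lemma stepH_step lam i mu : stepH lam i mu -> step lam (posH lam i) mu.
Proof.
rewrite /posH => -[pl pm mui muj]; split=> //; first exact: bead_row.
  apply/beadP => -[j def_j].
  have [ji|ji|ji] := ltngtP j i; last by rewrite ji in def_j; lia.
    by have := part_nth_le pm (ltnW ji); rewrite mui muj; lia.
  by have := part_nth_le pl (ltnW ji); lia.
move=> x; apply/beadP/orP.
  move=> [j ->]; have [->|ji] := eqVneq j i; first by left; rewrite mui; lia.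
  right; rewrite muj // bead_row andbT.
  by have [|] := ltnP i j => [/ltnW|] ij; have := part_nth_le pl ij; lia.
move=> [/eqP ->|/andP[nx /beadP[j def_x]]]; first by exists i; rewrite mui; lia.
exists j; rewrite muj //; apply: contraNneq nx => ji; rewrite def_x ji; lia.
Qed.

(** Two rows change, yet as a set only one bead moves: the new bead of row [i.+1] is the old bead of
    row [i]. *)
Lemma stepV_step lam i mu : stepV lam i mu -> step lam (posV lam i) mu.
Proof.
rewrite /posV => -[pl pm li [mui muSi] muj]; split=> //.
- by apply/beadP; exists i.+1; rewrite li; lia.
- apply/beadP => -[j def_j]; have [ji|ji] := ltnP j i.
    by have := part_nth_le pm (ltnW ji); rewrite mui muj; lia.
  by have := part_nth_le pl ji; lia.
move=> x; apply/beadP/orP.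
  move=> [j ->]; have [->|ji] := eqVneq j i; first by left; rewrite mui; lia.
  right; have [->|jSi] := eqVneq j i.+1.
    by rewrite muSi; apply/andP; split; [lia | apply/beadP; exists i; lia].
  rewrite muj // bead_row andbT.
  have [|] := ltnP j i => [/ltnW|] ij; have := part_nth_le pl ij; first lia.
  have : i.+1 <= j by lia.
  by move=> /(part_nth_le pl); rewrite li; lia.
move=> [/eqP ->|/andP[nx /beadP[j def_x]]]; first by exists i; rewrite mui; lia.
have [ji|ji] := eqVneq j i; first by exists i.+1; rewrite muSi def_x ji; lia.
have [jSi|jSi] := eqVneq j i.+1; first by move: nx; rewrite def_x jSi li; lia.
by exists j; rewrite muj.
Qed.

(** Bead positions drop by at least one per row, so a gap of exactly one leaves no row in between
    and no difference of length. This is why a bead at [p + 1] makes the domino vertical. *)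
Lemma row_above lam i j : is_part lam ->
  ((nth 0%N lam j)%:Z - j%:Z = (nth 0%N lam i)%:Z - i%:Z + 1 :> int)%R ->
  i = j.+1 /\ nth 0%N lam i = nth 0%N lam j.
Proof.
move=> pl e.
have ji : j < i.
  by rewrite ltnNge; apply/negP => le_ij; have := part_nth_le pl le_ij; lia.
have := part_nth_le pl ji; have := part_nth_le pl (leqnSn j).
by split; lia.
Qed.

Lemma stepH_exists lam i : is_part lam ->
  (forall j, i = j.+1 -> (nth 0%N lam i).+2 <= nth 0%N lam j) -> exists mu, stepH lam i mu.
Proof.
move=> pl hi; pose f j := if j == i then (nth 0%N lam i).+2 else nth 0%N lam j.
have [mu pm mu_f] : exists2 mu, is_part mu & nth 0%N mu =1 f.
  apply: (part_of_rows (N := (size lam + i).+2)) => [j|].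
    rewrite /f; have := part_nth_le pl (leqnSn j).
    have [->|ji] := eqVneq j i; first by case: ifP => /eqP; lia.
    by case: eqP => // Sji _; apply: hi.
  by rewrite /f; case: ifP => [|_]; [lia | rewrite nth_default //; lia].
exists mu; split; rewrite ?mu_f /f ?eqxx //.
by move=> j ji; rewrite mu_f /f (negPf ji).
Qed.

Lemma stepV_exists lam i : is_part lam -> nth 0%N lam i.+1 = nth 0%N lam i ->
  (forall j, i = j.+1 -> (nth 0%N lam i).+1 <= nth 0%N lam j) -> exists mu, stepV lam i mu.
Proof.
move=> pl li hi.
pose f j := if (j == i) || (j == i.+1) then (nth 0%N lam i).+1 else nth 0%N lam j.
have [mu pm mu_f] : exists2 mu, is_part mu & nth 0%N mu =1 f.
  apply: (part_of_rows (N := (size lam + i).+2)) => [j|].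
    rewrite /f; have := part_nth_le pl (leqnSn j).
    have [->|ji] := eqVneq j i; first by rewrite eqxx orbT.
    have [->|jSi] := eqVneq j i.+1; first by rewrite orbT li; case: ifP; lia.
    rewrite /= eqSS (negPf ji) orbF; case: eqP => // Sji _.
    exact: hi.
  by rewrite /f; case: ifP => [|_]; [lia | rewrite nth_default //; lia].
exists mu; split; rewrite ?mu_f /f ?eqxx ?orbT //.
by move=> j ji jSi; rewrite mu_f /f (negPf ji) (negPf jSi).
Qed.

(** Holes at [p + 1] and [p + 2] leave room for two cells in the row of the bead. A bead at [p + 1]
    gives two equal rows, and the hole at [p + 2] leaves room for one cell in each. *)
Lemma step_exists lam (p : int) : is_part lam -> bead lam p -> ~~ bead lam (p + 2)%R ->
  exists2 mu, step lam p mu &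
    exists i, (p = posH lam i /\ ~~ bead lam (p + 1)%R /\ stepH lam i mu) \/
              (p = posV lam i /\ bead lam (p + 1)%R /\ stepV lam i mu).
Proof.
move=> pl /beadP[k def_p] Np2.
have nz j : ((nth 0%N lam j)%:Z - j%:Z = (p + 2) :> int)%R -> False.
  by move=> e; case/beadP: Np2; exists j.
case: (boolP (bead lam (p + 1)%R)) => [/beadP[i def_i]|Np1].
- have [ki li] : k = i.+1 /\ nth 0%N lam k = nth 0%N lam i.
    by apply: row_above => //; rewrite -def_i def_p.
  have [||mu stV] := stepV_exists (i := i) pl; first by rewrite -ki.
    move=> j e; have := nz j; have := part_nth_le pl (leqnSn j).
    by move: def_i; rewrite -e; lia.
  have pV : p = posV lam i by rewrite /posV; lia.
  exists mu; first by rewrite pV; apply: stepV_step.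
  by exists i; right.
have [|mu stH] := stepH_exists (i := k) pl.
  move=> j e; have nz1 : ((nth 0%N lam j)%:Z - j%:Z = p + 1 :> int)%R -> False.
    by move=> e1; case/beadP: Np1; exists j.
  by have := nz j; have := part_nth_le pl (leqnSn j); rewrite -e; lia.
by exists mu; [rewrite def_p; apply: stepH_step | exists k; left].
Qed.

Lemma stepP lam p mu : step lam p mu ->
  exists i, (p = posH lam i /\ ~~ bead lam (p + 1)%R /\ stepH lam i mu) \/
            (p = posV lam i /\ bead lam (p + 1)%R /\ stepV lam i mu).
Proof.
move=> st; have [pl _ lp lp2 _] := st; have [mu' st'] := step_exists pl lp lp2.
by rewrite (step_fun st st').
Qed.

Lemma unstepH_exists mu i : is_part mu -> (nth 0%N mu i.+1).+2 <= nth 0%N mu i ->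
  exists lam, stepH lam i mu.
Proof.
move=> pm hi; pose f j := if j == i then (nth 0%N mu i).-2 else nth 0%N mu j.
have [lam pl lam_f] : exists2 lam, is_part lam & nth 0%N lam =1 f.
  apply: (part_of_rows (N := (size mu + i).+2)) => [j|].
    rewrite /f; have := part_nth_le pm (leqnSn j).
    have [->|ji] := eqVneq j i; first by case: ifP => /eqP; lia.
    by case: eqP => // Sji; rewrite -Sji; lia.
  by rewrite /f; case: ifP => [|_]; [lia | rewrite nth_default //; lia].
exists lam; split; rewrite ?lam_f /f ?eqxx //; first lia.
by move=> j ji; rewrite lam_f /f (negPf ji).
Qed.

Lemma unstepV_exists mu i : is_part mu -> nth 0%N mu i.+1 = nth 0%N mu i ->
  nth 0%N mu i.+2 < nth 0%N mu i -> exists lam, stepV lam i mu.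
Proof.
move=> pm mSi hi.
pose f j := if (j == i) || (j == i.+1) then (nth 0%N mu i).-1 else nth 0%N mu j.
have [lam pl lam_f] : exists2 lam, is_part lam & nth 0%N lam =1 f.
  apply: (part_of_rows (N := (size mu + i).+2)) => [j|].
    rewrite /f; have := part_nth_le pm (leqnSn j).
    have [->|ji] := eqVneq j i; first by rewrite eqxx orbT.
    have [->|jSi] := eqVneq j i.+1; first by rewrite orbT; case: ifP; lia.
    rewrite /= eqSS (negPf ji) orbF; case: ifP => // /eqP Sji.
    by rewrite -Sji; lia.
  by rewrite /f; case: ifP => [|_]; [lia | rewrite nth_default //; lia].
exists lam; split; rewrite ?lam_f /f ?eqxx ?orbT //=; first by rewrite mSi; lia.
by move=> j ji jSi; rewrite lam_f /f (negPf ji) (negPf jSi).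
Qed.

Lemma unstep_exists mu (p : int) : is_part mu -> bead mu (p + 2)%R -> ~~ bead mu p ->
  exists lam, step lam p mu.
Proof.
move=> pm /beadP[k def_p] Np.
have nz j : ((nth 0%N mu j)%:Z - j%:Z = p :> int)%R -> False.
  by move=> e; case/beadP: Np; exists j.
case: (boolP (bead mu (p + 1)%R)) => [/beadP[i def_i]|Np1].
- have [ik mk] : i = k.+1 /\ nth 0%N mu i = nth 0%N mu k.
    by apply: row_above => //; lia.
  have [||lam st] := @unstepV_exists mu k pm; first by rewrite -ik.
    by have := nz k.+2; have := part_nth_le pm (leqnSn i); rewrite mk ik; lia.
  exists lam; have := stepV_step st; rewrite (_ : posV lam k = p) //.
  by have [_ _ _ [mk' _] _] := st; rewrite /posV; lia.
have [|lam st] := @unstepH_exists mu k pm.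
  have nz1 j : ((nth 0%N mu j)%:Z - j%:Z = p + 1 :> int)%R -> False.
    by move=> e; case/beadP: Np1; exists j.
  by have := nz k.+1; have := nz1 k.+1; have := part_nth_le pm (leqnSn k); lia.
exists lam; have := stepH_step st; rewrite (_ : posH lam k = p) //.
by have [_ _ mk' _] := st; rewrite /posH; lia.
Qed.

(** * The local rule on bead moves *)

(** An edge of a growth diagram; [None] marks a degenerate edge. *)
Definition wstep (lam : part) (o : option int) (mu : part) : Prop :=
  if o is Some p then step lam p mu else is_part lam /\ mu = lam.

Lemma wstep_part lam o mu : wstep lam o mu -> is_part lam /\ is_part mu.
Proof. by case: o => [p [pl pm _ _ _]|[pl ->]]. Qed.

Lemma wstep_fun lam o mu mu' : wstep lam o mu -> wstep lam o mu' -> mu = mu'.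
Proof. by case: o => [p|[_ ->] [_ ->]] //=; apply: step_fun. Qed.

Lemma wstep_inj lam lam' o mu : wstep lam o mu -> wstep lam' o mu -> lam = lam'.
Proof. by case: o => [p|[_ <-] [_ <-]] //=; apply: step_inj. Qed.

Lemma step_neq lam p mu : step lam p mu -> mu <> lam.
Proof.
move=> [_ _ _ lp2 bm] ml; move: lp2; rewrite -ml bm eqxx; done.
Qed.

Lemma wstep_label_inj lam o o' mu : wstep lam o mu -> wstep lam o' mu -> o = o'.
Proof.
case: o o' => [p|] [q|] //=; first by move=> lp lq; rewrite (step_label_inj lp lq).
  by move=> /step_neq ml [_ /ml].
by move=> [_ ->] /step_neq.
Qed.

(** On a Maya diagram this is the bead of the first row; moving it by 2 appends a horizontal domino
    there. *)
Definition top_bead (S : int -> bool) (p : int) : Prop :=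
  S p /\ forall x : int, (p < x)%R -> ~~ S x.

(* p+2 is the lowest hole; moving the bead p there appends a vertical domino to the first column. *)
Definition low_hole (S : int -> bool) (p : int) : Prop :=
  ~~ S (p + 2)%R /\ forall x : int, (x < p + 2)%R -> S x.

Definition next_move (S : int -> bool) (p p' : int) : Prop :=
  if S (p + 1)%R
  then [/\ (p < p')%R, ~~ S (p' + 2)%R & forall x : int, (p + 2 < x)%R -> (x < p' + 2)%R -> S x]
  else [/\ (p' < p)%R, S p' & forall x : int, (p' < x)%R -> (x < p)%R -> ~~ S x].

(** Undoes [next_move] from what is visible afterwards: [S] is the diagram of mu = nu, [p'] the
    known outer label and [p] the label sought. *)
Definition prev_move (S : int -> bool) (p' p : int) : Prop :=
  if S (p' + 1)%R
  then [/\ (p < p')%R, ~~ S p & forall x : int, (p < x)%R -> (x < p' + 2)%R -> S x]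
  else [/\ (p' < p)%R, S (p + 2)%R & forall x : int, (p' < x)%R -> (x < p + 2)%R -> ~~ S x].

(* The local rule read on bead moves: S is the Maya diagram of lambda, the four labels
   are the moves lambda -> nu, lambda -> mu, mu -> rho and nu -> rho. *)
Inductive local_move (S : int -> bool) :
  option bool -> option int -> option int -> option int -> option int -> Prop :=
| LmPlus p : top_bead S p -> local_move S (Some false) None None (Some p) (Some p)
| LmMinus p : low_hole S p -> local_move S (Some true) None None (Some p) (Some p)
| LmLeft b : local_move S None None b None b
| LmTop a : local_move S None a None a None
| LmFree p q : p != q -> local_move S None (Some p) (Some q) (Some p) (Some q)
| LmNext p p' : next_move S p p' -> local_move S None (Some p) (Some p) (Some p') (Some p').

Lemma local_move_sym S m a b a' b' : local_move S m a b a' b' -> local_move S m b a b' a'.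
Proof. by case=> *; constructor=> //; rewrite eq_sym. Qed.

Lemma next_move_fun S p p1 p2 : next_move S p p1 -> next_move S p p2 -> p1 = p2.
Proof.
rewrite /next_move; case: ifP => _ [lt1 h1 b1] [lt2 h2 b2].
  have [lt|lt|//] := ltgtP p1 p2.
    by move: h1; rewrite b2 //; lia.
  by move: h2; rewrite b1 //; lia.
have [lt|lt|//] := ltgtP p1 p2.
  by move: (b1 p2 lt lt2); rewrite h2.
by move: (b2 p1 lt lt1); rewrite h1.
Qed.

Lemma prev_move_fun S p p1 p2 : prev_move S p p1 -> prev_move S p p2 -> p1 = p2.
Proof.
rewrite /prev_move; case: ifP => _ [lt1 h1 b1] [lt2 h2 b2].
  have [lt|lt|//] := ltgtP p1 p2.
    by move: h2; rewrite b1 //; lia.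
  by move: h1; rewrite b2 //; lia.
have [lt|lt|//] := ltgtP p1 p2.
  by have := b2 (p1 + 2)%R; rewrite h1 => /(_ _ _)/implyP; lia.
by have := b1 (p2 + 2)%R; rewrite h2 => /(_ _ _)/implyP; lia.
Qed.

Lemma top_bead_fun S p q : top_bead S p -> top_bead S q -> p = q.
Proof.
move=> [Sp hp] [Sq hq]; have [lt|lt|//] := ltgtP p q.
  by move: (hp _ lt); rewrite Sq.
by move: (hq _ lt); rewrite Sp.
Qed.

Lemma low_hole_fun S p q : low_hole S p -> low_hole S q -> p = q.
Proof.
move=> [Sp hp] [Sq hq]; have [lt|lt|//] := ltgtP p q.
  by move: Sp; rewrite hq //; lia.
by move: Sq; rewrite hp //; lia.
Qed.

Lemma local_move_inv S m a b a' b' : local_move S m a b a' b' ->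
  match m, a, b with
  | Some false, None, None => exists2 p, top_bead S p & a' = Some p /\ b' = Some p
  | Some true, None, None => exists2 p, low_hole S p & a' = Some p /\ b' = Some p
  | None, Some p, Some q =>
      if p == q then exists2 p', next_move S p p' & a' = Some p' /\ b' = Some p'
      else a' = a /\ b' = b
  | None, _, _ => a' = a /\ b' = b
  | _, _, _ => False
  end.
Proof.
case=> [p hp|p hp|[q|]|[q|]|p q /negPf->|p p' hp] //; rewrite ?eqxx; try by exists p.
by exists p'.
Qed.

Lemma local_move_fun S m a b a1 b1 a2 b2 :
  local_move S m a b a1 b1 -> local_move S m a b a2 b2 -> a1 = a2 /\ b1 = b2.
Proof.
move=> /local_move_inv L1 /local_move_inv L2.
case: m a b L1 L2 => [[]|] [p|] [q|] // => [[p hp [-> ->]]|[p hp [-> ->]]||||].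
- by case=> q /(low_hole_fun hp) <- [-> ->].
- by case=> q /(top_bead_fun hp) <- [-> ->].
- by case: ifP => _ [p' hp [-> ->]] // [q' /(next_move_fun hp) <- [-> ->]].
- by move=> [-> ->] [-> ->].
- by move=> [-> ->] [-> ->].
- by move=> [-> ->] [-> ->].
Qed.

(** Reads a square from its output labels, as the reconstruction does. Different outputs can only be
    copies of the inputs; equal ones leave three candidates. *)
Lemma local_move_inv_out S m a b a' b' : local_move S m a b a' b' ->
  if a' == b' then
    if a' is Some p then
      [\/ [/\ m = Some false, a = None, b = None & top_bead S p],
          [/\ m = Some true, a = None, b = None & low_hole S p] |
          exists2 p0, next_move S p0 p & [/\ m = None, a = Some p0 & b = Some p0]]
    else [/\ m = None, a = None & b = None]
  else [/\ m = None, a = a' & b = b'].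
Proof.
case=> [p hp|p hp|[q|]|[q|]|p q npq|p p' hp] //; rewrite ?eqxx //.
- by constructor 1.
- by constructor 2.
- by rewrite (inj_eq Some_inj) (negPf npq).
- by constructor 3; exists p.
Qed.

(** In [mu] the positions from [p + 1] to [p' + 1], in whichever direction, are all beads or all
    holes. So [p + 1] in [lam] and [p' + 1] in [mu] are in the same state, and both definitions take
    the same branch. *)
Lemma next_move_prev_move lam p mu p' :
  step lam p mu -> next_move (bead lam) p p' -> prev_move (bead mu) p' p.
Proof.
move=> [_ _ lp lp2 bm]; rewrite /next_move /prev_move; case: ifP => lp1 [lt hp' btw].
  have in_btw x : (p < x)%R -> (x < p' + 2)%R -> bead mu x.
    move=> px xp'; rewrite bm; case: eqVneq => //= xp2.
    have [xp1|xp1] := eqVneq x (p + 1)%R; first by rewrite xp1 lp1; lia.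
    by rewrite btw //; lia.
  rewrite in_btw; [split=> // | lia | lia].
  by rewrite bm (_ : (p == p + 2)%R = false) ?eqxx //; lia.
have in_btw x : (p' < x)%R -> (x < p + 2)%R -> ~~ bead mu x.
  move=> px xp'; rewrite bm (_ : (x == p + 2)%R = false) /=; last lia.
  have [//|xp1] := eqVneq x p.
  have [->|xp] := eqVneq x (p + 1)%R; first by rewrite lp1.
  by rewrite /= btw //; lia.
rewrite (negPf (in_btw _ _ _)); [split=> // | lia | lia].
by rewrite bm eqxx.
Qed.

Lemma prev_move_next_move lam p mu p' : bead mu p' -> ~~ bead mu (p' + 2)%R ->
  step lam p mu -> prev_move (bead mu) p' p -> next_move (bead lam) p p'.
Proof.
move=> mp' mp'2 [_ _ lp lp2 bm]; rewrite /next_move /prev_move.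
have bl x : (x != p)%R -> (x != p + 2)%R -> bead lam x = bead mu x.
  by move=> xp xp2; rewrite bm (negPf xp) (negPf xp2).
rewrite (bl (p + 1)%R); [| lia | lia].
case: ifP => mp'1 [lt hp btw].
  rewrite btw; [| lia | lia]; split=> [//||x lt1 lt2]; first by rewrite bl //; lia.
  by rewrite bl ?btw //; lia.
rewrite (negPf (btw _ _ _)); [| lia | lia]; split=> [//||x lt1 lt2].
  by rewrite bl //; lia.
by rewrite bl ?btw //; lia.
Qed.

Lemma next_true (S : int -> bool) (p N : int) : (forall x : int, (N <= x)%R -> ~~ S x) ->
  (forall x : int, (p < x)%R -> ~~ S x) \/
  exists z, [/\ (p < z)%R, S z & forall x : int, (p < x)%R -> (x < z)%R -> ~~ S x].
Proof.
move=> hN.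
case: (boolP (has (fun k : nat => S (p + 1 + k%:Z)%R) (iota 0 (absz (N - p)%R)))) => [/hasP[k0 _ Sk0]|].
  right; pose P (k : nat) := S (p + 1 + k%:Z)%R.
  have exP : exists k, P k by exists k0.
  have Pk := ex_minnP exP; case: Pk => k Pk minP.
  exists (p + 1 + k%:Z)%R; split=> // [|x px xk]; first lia.
  apply/negP => Sx; have := minP (absz (x - p - 1)%R); rewrite /P.
  by rewrite (_ : p + 1 + (absz (x - p - 1)%R)%:Z = x)%R; [move=> /(_ Sx); lia | lia].
move=> /hasPn nS; left => x px; have [/hN //|xN] := leP N x.
have := nS (absz (x - p - 1)%R); rewrite mem_iota.
by rewrite (_ : p + 1 + (absz (x - p - 1)%R)%:Z = x)%R; [apply; lia | lia].
Qed.

Lemma prev_true (S : int -> bool) (p N : int) : (forall x : int, (x <= N)%R -> ~~ S x) ->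
  (forall x : int, (x < p)%R -> ~~ S x) \/
  exists z, [/\ (z < p)%R, S z & forall x : int, (z < x)%R -> (x < p)%R -> ~~ S x].
Proof.
move=> hN; have [|h|[z [pz Sz btw]]] := @next_true (fun x => S (- x)%R) (- p)%R (- N)%R.
- by move=> x xN; apply: hN; lia.
- by left=> x xp; have := h (- x)%R; rewrite opprK; apply; lia.
- right; exists (- z)%R; split=> // [|x zx xp]; first lia.
  by have := btw (- x)%R; rewrite opprK; apply; lia.
Qed.

(** If [p + 1] is a bead, the search for a hole below [p] fails exactly when [p + 2] is the lowest
    hole; if it is a hole, the search for a bead above fails exactly when [p] is the top bead. The
    two failures correspond to the two nonzero matrix entries. *)
Lemma prev_move_exists mu p : is_part mu -> bead mu p -> ~~ bead mu (p + 2)%R ->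
  [\/ top_bead (bead mu) p, low_hole (bead mu) p | exists p0, prev_move (bead mu) p p0].
Proof.
move=> pm mp mp2; rewrite /prev_move; case mp1: (bead mu (p + 1)%R).
  have [N hN] := bead_low mu.
  have [|h|[z [zp mz btw]]] := @prev_true (fun x => ~~ bead mu x) p N.
  - by move=> x /hN ->.
  - constructor 2; split=> // x xp2; have [xp|px] := ltP x p.
      by have := h x xp; rewrite negbK.
    have [->//|xp] := eqVneq x p; rewrite (_ : x = p + 1)%R //; lia.
  - constructor 3; exists z; split=> // x zx xp2.
    have [xp|px] := ltP x p; first by have := btw x zx xp; rewrite negbK.
    have [->//|xp] := eqVneq x p; rewrite (_ : x = p + 1)%R //; lia.
have [N hN] := bead_high pm.
have [h|[z [zp mz btw]]] := @next_true (bead mu) p N hN.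
  by constructor 1.
constructor 3; exists (z - 2)%R; rewrite subrK; split=> //.
have zp1 : z <> (p + 1)%R by move=> e; rewrite -e mz in mp1.
have zp2 : z <> (p + 2)%R by move=> e; rewrite -e mz in mp2.
lia.
Qed.

(** This and the next two lemmas make the outcomes of [prev_move_exists] mutually exclusive, so that
    a matrix entry can be recovered from the outer corners. *)
Lemma top_low_excl S p : top_bead S p -> low_hole S p -> False.
Proof.
by move=> [_ hp] [_ hp']; move: (hp (p + 1)%R); rewrite hp' => [/(_ _)/implyP|]; lia.
Qed.

Lemma top_prev_move_excl S p p0 : top_bead S p -> prev_move S p p0 -> False.
Proof.
move=> [_ hp]; rewrite /prev_move (negPf (hp _ _)); last lia.
by case=> lt Sp _; move: (hp (p0 + 2)%R); rewrite Sp => /(_ _)/implyP; lia.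
Qed.

Lemma low_prev_move_excl S p p0 : low_hole S p -> prev_move S p p0 -> False.
Proof.
move=> [_ hp]; rewrite /prev_move hp; last lia.
by case=> lt Sp _; move: Sp; rewrite hp //; lia.
Qed.

(** Relational form of the local rule: unlike the function [local_rule], it is visibly symmetric in
    mu and nu and can be solved for [lam] and [m]. *)
Definition square (lam mu nu rho : part) (m : option bool) : Prop :=
  exists a b a' b', [/\ wstep lam a nu, wstep lam b mu, wstep mu a' rho, wstep nu b' rho &
                       local_move (bead lam) m a b a' b'].

Lemma square_sym lam mu nu rho m : square lam mu nu rho m -> square lam nu mu rho m.
Proof.
by case=> a [b [a' [b' [? ? ? ? /local_move_sym ?]]]]; exists b, a, b', a'.
Qed.

Lemma square_fun lam mu nu rho rho' m :
  square lam mu nu rho m -> square lam mu nu rho' m -> rho = rho'.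
Proof.
move=> [a [b [a' [b' [la lb ma nb L]]]]] [a1 [b1 [a1' [b1' [la1 lb1 ma1 nb1 L1]]]]].
move: L1; rewrite -(wstep_label_inj la la1) -(wstep_label_inj lb lb1) => L1.
have [ea eb] := local_move_fun L L1; move: ma1; rewrite -ea.
exact: wstep_fun.
Qed.

Lemma square_inj lam lam' mu nu rho m m' :
  square lam mu nu rho m -> square lam' mu nu rho m' -> lam = lam' /\ m = m'.
Proof.
move=> [a [b [a' [b' [la lb ma nb L]]]]] [a1 [b1 [a1' [b1' [la1 lb1 ma1 nb1 L1]]]]].
move: L1; rewrite -(wstep_label_inj ma ma1) -(wstep_label_inj nb nb1) => L1.
have [pm pr] := wstep_part ma; have [_ pn] := wstep_part nb.
have eq_lam o : a = o -> a1 = o -> lam = lam'.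
  by move=> ea ea1; move: la la1; rewrite ea ea1; apply: wstep_inj.
have := local_move_inv_out L; have := local_move_inv_out L1; clear L L1.
case: eqVneq => [e|_]; last first.
  by case=> em1 ea1 _ [em ea _]; split; [apply: eq_lam ea ea1 | rewrite em em1].
clear e; case: a' ma => [p|] ma; last first.
  by case=> em1 ea1 _ [em ea _]; split; [apply: eq_lam ea ea1 | rewrite em em1].
(* The three cases are rephrased on [mu], which both squares share, since [lam] and [lam'] are not
   yet known to agree. *)
pose on_mu mm aa := [\/ [/\ mm = Some false, aa = None & top_bead (bead mu) p],
  [/\ mm = Some true, aa = None & low_hole (bead mu) p] |
  exists2 p0, prev_move (bead mu) p p0 & mm = None /\ aa = Some p0].
have to_mu l mm aa bb : wstep l bb mu ->
    [\/ [/\ mm = Some false, aa = None, bb = None & top_bead (bead l) p],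
        [/\ mm = Some true, aa = None, bb = None & low_hole (bead l) p] |
        exists2 p0, next_move (bead l) p0 p & [/\ mm = None, aa = Some p0 & bb = Some p0]] ->
    on_mu mm aa.
  move=> lmu [[em ea eb hp]|[em ea eb hp]|[p0 hp [em ea eb]]]; rewrite eb in lmu.
  - by constructor 1; split=> //; case: lmu => _ ->.
  - by constructor 2; split=> //; case: lmu => _ ->.
  - by constructor 3; exists p0 => //; apply: next_move_prev_move lmu hp.
move=> /(to_mu _ _ _ _ lb1) h1 /(to_mu _ _ _ _ lb) h; move: h h1.
case=> [[em ea hp]|[em ea hp]|[p0 hp [em ea]]] [[em1 ea1 hp1]|[em1 ea1 hp1]|[p1 hp1 [em1 ea1]]].
- by split; [apply: eq_lam ea ea1 | rewrite em em1].
- by case: (top_low_excl hp hp1).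
- by case: (top_prev_move_excl hp hp1).
- by case: (top_low_excl hp1 hp).
- by split; [apply: eq_lam ea ea1 | rewrite em em1].
- by case: (low_prev_move_excl hp hp1).
- by case: (top_prev_move_excl hp1 hp).
- by case: (low_prev_move_excl hp1 hp).
- rewrite -(prev_move_fun hp hp1) in ea1.
  by split; [apply: eq_lam ea ea1 | rewrite em em1].
Qed.

Lemma unsquare mu nu rho a' b' : wstep mu a' rho -> wstep nu b' rho ->
  exists lam m, square lam mu nu rho m.
Proof.
case: a' b' => [p|] [q|] ma nb; last first.
- case: nb => pn e; subst rho; case: ma => pm e; subst mu.
  by exists nu, None, None, None, None, None; split=> //; constructor.
- case: ma => pm e; subst rho; have [pn _] := wstep_part nb.
  by exists nu, None, None, (Some q), None, (Some q); split=> //; constructor.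
- case: nb => pn e; subst rho; have [pm _] := wstep_part ma.
  by exists mu, None, (Some p), None, (Some p), None; split=> //; constructor.
have [pm pr mp mp2 br] := ma; have [pn _ nq nq2 br'] := nb.
have [e|npq] := eqVneq p q.
  subst q; have e := step_inj nb ma; subst nu.
  have [hp|hp|[p0 hp]] := prev_move_exists pm mp mp2.
  - by exists mu, (Some false), None, None, (Some p), (Some p); split=> //; constructor.
  - by exists mu, (Some true), None, None, (Some p), (Some p); split=> //; constructor.
  have [m2 m0] : bead mu (p0 + 2)%R /\ ~~ bead mu p0.
    move: hp; rewrite /prev_move; case: ifP => _ [lt hp btw]; split=> //; apply: btw => //; lia.
  have [lam lp0] := unstep_exists pm m2 m0.
  exists lam, None, (Some p0), (Some p0), (Some p), (Some p); split=> //.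
  by constructor; apply: prev_move_next_move lp0 hp.
(* In [rho] there is a bead at [q + 2] and a hole at [p]; the next line is the mirror image. *)
have np2 : (q + 2 != p)%R.
  by apply/eqP => e; have := br (q + 2)%R; rewrite br' eqxx e eqxx; case: eqP => //; lia.
have nq2' : (p + 2 != q)%R.
  by apply/eqP => e; have := br' (p + 2)%R; rewrite br eqxx e eqxx; case: eqP => //; lia.
have bmn x : (x == q + 2)%R || (x != q) && bead nu x = (x == p + 2)%R || (x != p) && bead mu x.
  by rewrite -br -br'.
have m2 : bead mu (q + 2)%R.
  by have := bmn (q + 2)%R; rewrite eqxx np2 /=; case: eqP => // ; lia.
have m0 : ~~ bead mu q.
  have := bmn q; have -> : (q == p + 2)%R = false by lia.
  have -> : (q == q + 2)%R = false by lia.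
  by rewrite eqxx eq_sym npq /= => <-.
have [lam lq] := unstep_exists pm m2 m0.
have [pl _ lq0 lq2 bm] := lq.
exists lam, None, (Some p), (Some q), (Some p), (Some q); split=> //; last by constructor.
have lx x : (x != q)%R -> (x != q + 2)%R -> bead lam x = bead mu x.
  by move=> xq xq2; rewrite bm (negPf xq) (negPf xq2).
split=> // [||x].
- by rewrite lx // eq_sym.
- by rewrite lx //; apply: contra_neq npq => /addIr.
have [->|xq] := eqVneq x q; first by rewrite lq0 nq andbT (eq_sym q p) npq orbT.
have [->|xq2] := eqVneq x (q + 2)%R.
  by rewrite (negPf nq2) (negPf lq2) andbF orbF (inj_eq (addIr _)) eq_sym (negPf npq).
by have := bmn x; rewrite (negPf xq) (negPf xq2) /= => ->; rewrite lx.
Qed.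

(** The incoming move may bump [p], [q], both or neither. If both, they move in the same direction,
    the first landing where the second starts. If only one, it jumps over a run of beads or a run of
    holes, and the other label cannot lie inside: in [be], [q] is a bead with hole [q + 2], and [p]
    a hole with bead [p + 2]. *)
Lemma asc_preserved al be ga al' a p q e p' f q' :
  step al p be -> step be q ga -> wstep al a al' ->
  local_move (bead al) None a (Some p) e (Some p') ->
  local_move (bead be) None e (Some q) f (Some q') ->
  (p < q)%R = (p' < q')%R.
Proof.
move=> [_ _ alp alp2 bbe] [_ _ beq beq2 _] sa /local_move_inv L1 /local_move_inv L2.
case: a sa L1 => [x|] sa L1; last first.
  by case: L1 L2 => -> [->] [_ [->]].
have [_ _ alx alx2 _] := sa.
have Nbep : ~~ bead be p by rewrite bbe eqxx orbF; lia.
have bep2 : bead be (p + 2)%R by rewrite bbe eqxx.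
have bex x0 : (x0 != p)%R -> (x0 != p + 2)%R -> bead be x0 = bead al x0.
  by move=> xp xp2; rewrite bbe (negPf xp) (negPf xp2).
have nqp : q != p by apply: contraTneq beq => ->.
have nqp2 : (q + 2)%R != (p + 2)%R by apply: contraTneq bep2 => <-.
move: L1; have [exp|nxp] := eqVneq x p.
  subst x => -[p'' hb [ee [ep']]]; subst e p'.
  move: L2; have [eq|npq] := eqVneq p'' q.
    subst q => -[q'' hb' [_ [eq']]]; subst q'; move: hb hb'; rewrite /next_move.
    case: ifP => alp1 [lt hp btw].
      rewrite (_ : bead be (p'' + 1)%R = true); first by case; lia.
      have [->//|np] := eqVneq (p'' + 1)%R (p + 2)%R.
      by rewrite bex ?btw //; lia.
    rewrite (_ : bead be (p'' + 1)%R = false); first by case; lia.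
    have [->|np] := eqVneq (p'' + 1)%R p; first exact: negPf.
    by apply: negbTE; rewrite bex ?btw //; lia.
  move=> [_ [eq']]; subst q'; move: hb; rewrite /next_move.
  case: ifP => alp1 [lt hp btw].
    have [qp|pq] := ltP q p; first lia.
    have : ~~ (p < q < p'')%R.
      by apply/negP => /andP[lt1 lt2]; move: beq2; rewrite bex ?btw //; lia.
    lia.
  have [pq|qp] := ltP p q; first lia.
  have : ~~ (p'' < q < p)%R.
    by apply/negP => /andP[lt1 lt2]; move: beq; rewrite bex ?(negPf (btw _ _ _)) //; lia.
  lia.
move=> [ee [ep']]; subst e p'; move: L2; have [eq|nxq] := eqVneq x q; last by move=> [_ [->]].
subst x => -[q'' hb [_ [->]]]; move: hb; rewrite /next_move.
have npq2 : (p != q + 2)%R by apply: contraTneq alp => ->.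
have npq2' : (q != p + 2)%R by apply: contraTneq alx => ->.
case: ifP => beq1 [lt hp btw].
  have npq1 : (p != q + 1)%R by apply: contraTneq beq1 => <-.
  have [pq|qp] := ltP p q; first lia.
  have : ~~ (q + 2 < p < q'' + 2)%R.
    by apply/negP => /andP[lt1 lt2]; move: Nbep; rewrite btw.
  lia.
have npq1 : (p + 2 != q + 1)%R by apply: contraFneq beq1 => <-.
have [qp|pq] := ltP q p; first lia.
have : ~~ (q'' < p + 2 < q)%R.
  by apply/negP => /andP[lt1 lt2]; move: bep2; rewrite (negPf (btw _ _ _)).
lia.
Qed.

Definition vert (lam : part) (o : option int) : bool :=
  if o is Some p then bead lam (p + 1)%R else false.

(** The conservation law behind the spin identity: a bumped domino keeps its orientation, and M = -1
    creates two vertical edges. *)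
Lemma square_vert lam mu nu m a b a' b' rho :
  wstep lam a nu -> wstep lam b mu -> wstep mu a' rho -> wstep nu b' rho ->
  local_move (bead lam) m a b a' b' ->
  vert mu a' + vert nu b' = vert lam a + vert lam b + (m == Some true).*2.
Proof.
move=> la lb ma nb L; case: L la lb ma nb => /=.
- by move=> p [_ hp] [pl ->] [_ ->] _ _; rewrite (negPf (hp _ _)) //; lia.
- by move=> p [_ hp] [pl ->] [_ ->] _ _; rewrite hp //; lia.
- by move=> [q|] [_ ->] //= _ _ _; rewrite addn0.
- by move=> [q|] _ [_ ->] //= _ _; rewrite !addn0.
- move=> p q npq [_ _ lp lp2 bn] [_ _ lq lq2 bm] _ _; rewrite bm bn !addn0.
  (* Labels differing by 1 are dominoes sharing one cell: they exchange orientations, so only the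
     sum is preserved. *)
  have [e|n1] := eqVneq p (q + 1)%R.
    subst p; have -> : (q + 1 + 1 == q + 2)%R by lia.
    have -> : (q + 1 == q + 1 + 2)%R = false by lia.
    rewrite (_ : q + 1 + 1 = q + 2)%R; last lia.
    by rewrite lp (negPf lq2).
  have [e|n2] := eqVneq q (p + 1)%R.
    subst q; have -> : (p + 1 + 1 == p + 2)%R by lia.
    have -> : (p + 1 == p + 1 + 2)%R = false by lia.
    rewrite (_ : p + 1 + 1 = p + 2)%R; last lia.
    by rewrite lq (negPf lp2); lia.
  have -> : (p + 1 == q + 2)%R = false by lia.
  have -> : (q + 1 == p + 2)%R = false by lia.
  by [].
move=> p p' hb lp lq mp np; rewrite addn0.
have mn := step_fun lp lq; subst nu; congr (_ + _);
  rewrite -(_ : bead mu (p' + 1)%R = bead lam (p + 1)%R) //.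
all: have := next_move_prev_move lp hb; move: hb; rewrite /next_move /prev_move;
  case: ifP => _ [? _ _]; case: ifP => _ [? _ _] //; lia.
Qed.

(** * The local rule on Young diagrams *)

Lemma mem_skew_cells lam mu c : (c \in skew_cells lam mu) = in_skew lam mu c.
Proof.
case: c => k l; rewrite /in_skew /in_cells /=; apply/flattenP/idP.
  move=> [_ /mapP[i + ->] /mapP[j + [-> ->]]] /=; rewrite !mem_iota; lia.
move=> h; have lt_k : k.-1 < size lam.
  rewrite ltnNge; apply/negP => ge; move: h; rewrite (nth_default 0 ge); lia.
exists [seq (k.-1.+1, j) | j <- iota (nth 0%N mu k.-1).+1 (nth 0%N lam k.-1 - nth 0%N mu k.-1)].
  by apply/mapP; exists k.-1; rewrite ?mem_iota.
by apply/mapP; exists l; rewrite ?mem_iota ?prednK //; lia.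
Qed.

(** A domino occupies one row or two consecutive rows; this lemma and the next evaluate [skew_cells]
    by discarding the other rows. *)
Lemma flatten_support1 (T : Type) (F : nat -> seq T) i N : i < N ->
  (forall j, j != i -> F j = [::]) -> flatten [seq F j | j <- iota 0 N] = F i.
Proof.
move=> lt_iN F0; have -> : N = i + (1 + (N - i.+1)) by lia.
have nilF m k : i \notin iota m k -> flatten [seq F j | j <- iota m k] = [::].
  elim: k m => //= k IH m; rewrite in_cons negb_or => /andP[mi /IH ->].
  by rewrite F0 // eq_sym.
rewrite !iotaD !map_cat !flatten_cat (nilF 0) ?(nilF (0 + (i + 1))) ?mem_iota; [|lia|lia].
by rewrite /= !cats0.
Qed.

Lemma flatten_support2 (T : Type) (F : nat -> seq T) i N : i.+1 < N ->
  (forall j, j != i -> j != i.+1 -> F j = [::]) ->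
  flatten [seq F j | j <- iota 0 N] = F i ++ F i.+1.
Proof.
move=> lt_iN F0; have -> : N = i.+1 + (N - i.+1) by lia.
rewrite iotaD map_cat flatten_cat add0n; congr (_ ++ _).
  have := @flatten_support1 T (fun j => if j == i.+1 then [::] else F j) i i.+1.
  rewrite (_ : (i == i.+1) = false); last lia.
  move=> <- //; last first.
    by move=> j ji; case: eqVneq => // jSi; apply: F0.
  congr flatten; apply/eq_in_map => j; rewrite mem_iota; case: eqP => //; lia.
have := @flatten_support1 T (fun j => if j == i then [::] else F j) i.+1 N lt_iN.
rewrite (_ : (i.+1 == i) = false); last lia.
move=> <-; last first.
  by move=> j jSi; case: eqVneq => // ji; apply: F0.
have -> : N = i.+1 + (N - i.+1) by lia.
rewrite iotaD map_cat flatten_cat add0n [X in _ = X ++ _](_ : _ = [::]); last first.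
  apply: size0nil; rewrite size_flatten /shape -map_comp.
  rewrite sumnE big_map big_seq big1 // => j; rewrite mem_iota /=.
  by case: eqVneq => // ji h; rewrite F0 //; lia.
congr flatten; rewrite addKn; apply/eq_in_map => j; rewrite mem_iota; case: eqP => //; lia.
Qed.

Lemma skew_cells_H lam i mu : stepH lam i mu ->
  skew_cells mu lam = [:: (i.+1, (nth 0%N lam i).+1); (i.+1, (nth 0%N lam i).+2)].
Proof.
move=> [_ _ mui muj]; rewrite /skew_cells.
rewrite (@flatten_support1 _ _ i).
- by rewrite mui (_ : _.+2 - _ = 2) //; lia.
- by rewrite ltnNge; apply/negP => /(nth_default 0); rewrite mui.
- by move=> j ji; rewrite muj // subnn.
Qed.

Lemma skew_cells_V lam i mu : stepV lam i mu ->
  skew_cells mu lam = [:: (i.+1, (nth 0%N lam i).+1); (i.+2, (nth 0%N lam i).+1)].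
Proof.
move=> [_ _ li [mui muSi] muj]; rewrite /skew_cells.
rewrite (@flatten_support2 _ _ i).
- by rewrite mui muSi li (_ : _.+1 - _ = 1) //; lia.
- by rewrite ltnNge; apply/negP => /(nth_default 0); rewrite muSi.
- by move=> j ji jSi; rewrite muj // subnn.
Qed.

Lemma last_set_nth (s : seq nat) n v : last 1 s != 0 -> v != 0 -> last 1 (set_nth 0 s n v) != 0.
Proof.
move=> s1 v0; rewrite -nth_last size_set_nth (set_nth_default 0) ?size_set_nth; last lia.
rewrite nth_set_nth /=; have [sz|sz] := leqP (size s) n.+1.
  by rewrite eqxx.
rewrite ifF; last lia.
by rewrite (set_nth_default 1) ?nth_last //; lia.
Qed.

Lemma nth_punion lam mu i : nth 0%N (punion lam mu) i = maxn (nth 0%N lam i) (nth 0%N mu i).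
Proof.
have [lt_i|ge_i] := ltnP i (maxn (size lam) (size mu)); first by rewrite nth_mkseq.
by rewrite !nth_default ?size_mkseq //; lia.
Qed.

Lemma last_punion lam mu : is_part lam -> is_part mu -> last 1 (punion lam mu) != 0.
Proof.
move=> pl pm; rewrite -nth_last size_mkseq.
have [m0|m0] := posnP (maxn (size lam) (size mu)).
  by rewrite /punion m0.
rewrite (set_nth_default 0) ?size_mkseq ?nth_punion; last lia.
have [le|lt] := leqP (size lam) (size mu).
  by have := part_nth_gt0 pm (i := (size mu).-1); move: m0; rewrite (maxn_idPr le); lia.
by have := part_nth_gt0 pl (i := (size lam).-1); move: m0; rewrite (maxn_idPl (ltnW lt)); lia.
Qed.

Lemma col_heightP lam l i : is_part lam -> 0 < l -> (i < col_height lam l) = (l <= nth 0%N lam i).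
Proof.
move=> pl l0; rewrite /col_height.
elim: lam pl i => [|x s IH] pl i; first by rewrite nth_nil /=; lia.
have ps : is_part s.
  by move: pl; rewrite /is_part /= => /andP[/path_sorted -> /andP[_ ->]].
have [lx|xl] := leqP l x.
  rewrite /= lx; case: i => [|i] /=; first by rewrite lx.
  by rewrite -IH.
have le_x j : nth 0%N (x :: s) j <= x by have := part_nth_le pl (leq0n j).
rewrite (eqP (_ : count _ _ == 0)).
  by rewrite ltn0; apply/esym/negbTE; rewrite -ltnNge (leq_ltn_trans (le_x i)).
rewrite -leqn0 leqNgt -has_count; apply/hasPn => y /(nthP 0)[j _ <-].
by rewrite -ltnNge (leq_ltn_trans (le_x j)).
Qed.

Lemma local_rule_diff lam mu nu : lam <> mu -> lam <> nu ->
  local_rule lam mu nu None =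
    (let u := punion mu nu in
     match [seq c <- skew_cells nu lam | c \in skew_cells mu lam] with
     | [::] => u
     | [:: (k, l)] => set_row u k.+1 (maxn (row_len u k.+1) l.+1)
     | [:: (k, l); (k', l')] =>
         if l == l' then
           let h := col_height u l.+1 in set_row (set_row u h.+1 l.+1) h.+2 l.+1
         else set_row u k.+1 (row_len u k.+1 + 2)
     | _ => u
     end).
Proof. by move=> /eqP/negPf lm /eqP/negPf ln; rewrite /local_rule lm ln. Qed.

Lemma local_rule_HH lam mu nu i j : i <> j -> stepH lam i nu -> stepH lam j mu ->
  exists rho, [/\ local_rule lam mu nu None = rho, stepH mu i rho & stepH nu j rho].
Proof.
move=> ij sn sm; have [pl pn ni nk] := sn; have [_ pm mj mk] := sm.
have [|rho sr] := stepH_exists (i := j) pn.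
  move=> k e; rewrite nk; last lia.
  by have := part_nth_le pm (leqnSn k); have := nk k; rewrite -e mj mk; last lia;
     case: (eqVneq k i) => [->|ki]; rewrite ?ni //; [lia | move=> -> //].
have [_ pr rj rk] := sr; exists rho; split=> //; last first.
  split=> //; first by rewrite rk ?ni ?mk //; lia.
  move=> k ki; have [->|kj] := eqVneq k j; first by rewrite rj mj nk //; lia.
  by rewrite rk // nk // mk.
rewrite local_rule_diff; [| by move=> e; rewrite -e in mj; lia | by move=> e; rewrite -e in ni; lia].
rewrite (skew_cells_H sn) (skew_cells_H sm) /= !inE !xpair_eqE !eqSS.
rewrite (_ : (i == j) = false) /=; last exact/eqP.
apply: eq_from_nth_last; [exact: last_punion | exact: last_part | move=> k].
rewrite nth_punion; have [->|kj] := eqVneq k j.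
  by rewrite rj mj nk; lia.
rewrite rk // mk //; have [->|ki] := eqVneq k i; first by rewrite ni; lia.
by rewrite nk // maxnn.
Qed.

(** Row [i.+1] has room for a second horizontal domino because row [i] has just grown by two. *)
Lemma local_rule_HH_eq lam nu i : stepH lam i nu ->
  exists rho, local_rule lam nu nu None = rho /\ stepH nu i.+1 rho.
Proof.
move=> sn; have [pl pn ni nk] := sn.
have [|rho sr] := stepH_exists (i := i.+1) pn.
  move=> k [<-]; rewrite ni nk; last lia.
  by have := part_nth_le pl (leqnSn i); lia.
have [_ pr ri rk] := sr; exists rho; split=> //.
have nl : lam <> nu by move=> e; rewrite -e in ni; lia.
rewrite local_rule_diff // (skew_cells_H sn) /= !inE !eqxx orbT /= eqn_leq ltnn andbF.
apply: eq_from_nth_last; last 1 first.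
- move=> k; rewrite nth_set_nth /= /row_len /= !nth_punion !maxnn.
  by case: eqVneq => [->|ki]; [rewrite ri; lia | rewrite rk].
- by apply: last_set_nth; [exact: last_punion | lia].
- exact: last_part.
Qed.

Lemma local_rule_VV lam mu nu i j : i <> j -> stepV lam i nu -> stepV lam j mu ->
  exists rho, [/\ local_rule lam mu nu None = rho, step mu (posV lam i) rho &
                  step nu (posV lam j) rho].
Proof.
move=> ij sn sm; have [pl pn li [ni nSi] nk] := sn; have [_ pm lj [mj mSj] mk] := sm.
(* Vertical dominoes overlapping in exactly one row would make a row of [mu] or [nu] longer than the
   row above it. *)
have jSi : j <> i.+1.
  move=> e; subst j; have := part_nth_le pm (leqnSn i); rewrite mj mk; lia.
have iSj : i <> j.+1.
  move=> e; subst i; have := part_nth_le pn (leqnSn j); rewrite ni nk; lia.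
have [||rho sr] := stepV_exists (i := j) pn.
- by rewrite !nk //; lia.
- move=> k e; have := part_nth_le pm (leqnSn k); rewrite -e mj mk; [|lia|lia].
  rewrite (nk j); [|lia|lia].
  have [->|ki] := eqVneq k i; first by rewrite ni; lia.
  have [->|kSi] := eqVneq k i.+1; first by rewrite nSi li; lia.
  by rewrite nk.
have [_ pr nj [rj rSj] rk] := sr; exists rho; split; last first.
- rewrite (_ : posV lam j = posV nu j); last by rewrite /posV nk //; lia.
  exact: stepV_step.
- rewrite (_ : posV lam i = posV mu i); last by rewrite /posV mk //; lia.
  apply: stepV_step; split=> //; first by rewrite !mk //; lia.
    by rewrite !rk ?mk ?ni ?nSi //; lia.
  move=> k ki kSi; have [->|kj] := eqVneq k j; first by rewrite rj mj nk //; lia.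
  have [->|kSj] := eqVneq k j.+1; first by rewrite rSj mSj nk //; lia.
  by rewrite rk // nk // mk.
rewrite local_rule_diff; [| by move=> e; rewrite -e in mj; lia | by move=> e; rewrite -e in ni; lia].
rewrite (skew_cells_V sn) (skew_cells_V sm) /= !inE !xpair_eqE !eqSS.
rewrite (_ : (i == j) = false) /=; last exact/eqP.
rewrite (_ : (i.+1 == j) = false) /=; last by apply/eqP=> e; rewrite e in jSi.
rewrite (_ : (i == j.+1) = false) /=; last exact/eqP.
apply: eq_from_nth_last; [exact: last_punion | exact: last_part | move=> k].
rewrite nth_punion; have [->|kj] := eqVneq k j.
  by rewrite rj mj nk; lia.
have [->|kSj] := eqVneq k j.+1.
  by rewrite rSj mSj !nk; lia.
rewrite rk // mk //; have [->|ki] := eqVneq k i; first by rewrite ni; lia.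
have [->|kSi] := eqVneq k i.+1; first by rewrite nSi; lia.
by rewrite nk // maxnn.
Qed.

(** Rows [h] to [i] of [nu] have equal length, so their beads form an unbroken run. The first hole
    above that run is where the bead lands when two cells are added at the bottom of the next
    column. *)
Lemma local_rule_VV_eq lam nu i : stepV lam i nu ->
  exists rho h, [/\ local_rule lam nu nu None = rho, stepV nu h rho &
                    next_move (bead lam) (posV lam i) (posV nu h)].
Proof.
move=> sn; have [pl pn li [ni nSi] nk] := sn.
(* The domino [nu / lam] lies in column [(nth 0 lam i).+1]; this is the height of the column to its
   right. *)
pose h := col_height nu (nth 0%N lam i).+2.
have hP k : (k < h) = ((nth 0%N lam i).+2 <= nth 0%N nu k) by apply: col_heightP.
have hi : h <= i by rewrite leqNgt hP ni; lia.
have mid k : h <= k -> k <= i -> nth 0%N nu k = (nth 0%N lam i).+1.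
  move=> hk ki; have := part_nth_le pn ki; have := hP k; rewrite ni; lia.
have nh := mid h (leqnn h) hi.
have nSh : nth 0%N nu h.+1 = (nth 0%N lam i).+1.
  have [e|ne] := eqVneq h i; first by rewrite e nSi.
  by apply: mid; lia.
have [||rho sr] := stepV_exists (i := h) pn; first by rewrite nh.
  by move=> k e; rewrite nh -hP e.
have [_ pr _ [rh rSh] rk] := sr; exists rho, h; split=> //.
  have nl : lam <> nu by move=> e; rewrite -e in ni; lia.
  rewrite local_rule_diff // (skew_cells_V sn) /= !inE !eqxx orbT /= eqxx.
  have ph : col_height (punion nu nu) (nth 0%N lam i).+2 = h.
    rewrite (_ : punion nu nu = nu) //; apply: eq_from_nth_last.
    - exact: last_punion.
    - exact: last_part.
    - by move=> k; rewrite nth_punion maxnn.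
  rewrite ph; apply: eq_from_nth_last; last 1 first.
  - move=> k; rewrite /set_row !nth_set_nth /= nth_set_nth /= nth_punion maxnn.
    have [->|kSh] := eqVneq k h.+1; first by rewrite rSh nh.
    by have [->|kh] := eqVneq k h; [rewrite rh nh | rewrite rk].
  - by do 2! apply: last_set_nth => //; exact: last_punion.
  - exact: last_part.
rewrite /next_move ifT; last by apply/beadP; exists i; rewrite /posV; lia.
split; first by rewrite /posV nh; lia.
  apply/beadP => -[k]; rewrite /posV nh; have [kh|hk] := ltnP k h.
    by move: (kh); rewrite hP nk; lia.
  have [ki|ik] := ltnP k i; first by have := mid k; rewrite nk; lia.
  by have := part_nth_le pl ik; lia.
move=> x; rewrite /posV nh => lt1 lt2; apply/beadP.
(* The row of the run whose bead is [x], all rows of the run having length [(nth 0 lam i).+1]. *)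
pose k := absz ((nth 0%N lam i)%:Z + 1 - x)%R.
have k_def : k = absz ((nth 0%N lam i)%:Z + 1 - x)%R by [].
by exists k; have := mid k; rewrite nk; lia.
Qed.

(** Both argument orders are treated because [local_rule] is not symmetric on its face. For [i = j]
    the dominoes share their first cell, and the extra cell (k+1,l+1) completes each to a domino of
    the other orientation with the same label. *)
Lemma local_rule_HV lam mu nu i j : stepH lam i nu -> stepV lam j mu ->
  exists rho, [/\ local_rule lam mu nu None = rho, local_rule lam nu mu None = rho,
                  step mu (posH lam i) rho & step nu (posV lam j) rho].
Proof.
move=> sn sm; have [pl pn ni nk] := sn; have [_ pm lj [mj mSj] mk] := sm.
have lm : lam <> mu by move=> e; rewrite -e in mj; lia.
have ln : lam <> nu by move=> e; rewrite -e in ni; lia.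
have iSj : i <> j.+1.
  by move=> e; subst i; have := part_nth_le pn (leqnSn j); rewrite ni nk; lia.
have [e|/eqP ij] := eqVneq i j.
  subst j; have nSi : nth 0%N nu i.+1 = nth 0%N lam i by rewrite nk ?lj //; lia.
  have [|rho sr] := stepH_exists (i := i.+1) pn.
    by move=> k [<-]; rewrite nSi ni.
  have [_ pr rSi rk] := sr.
  have res u : (forall k, nth 0%N u k = maxn (nth 0%N mu k) (nth 0%N nu k)) -> last 1 u != 0 ->
      set_row u i.+2 (maxn (row_len u i.+2) (nth 0%N lam i).+2) = rho.
    move=> u_nth u_last; apply: eq_from_nth_last; [| exact: last_part |].
      by apply: last_set_nth => //; lia.
    move=> k; rewrite nth_set_nth /= /row_len /= !u_nth mSj nSi.
    have [->|kSi] := eqVneq k i.+1; first by rewrite rSi nSi; lia.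
    rewrite rk //; have [->|ki] := eqVneq k i; first by rewrite mj ni; lia.
    by rewrite mk // nk // maxnn.
  exists rho; split.
  - rewrite local_rule_diff // (skew_cells_H sn) (skew_cells_V sm) /= !inE !xpair_eqE !eqxx.
    rewrite !eqSS (gtn_eqF (ltnSn (nth 0%N lam i))) (ltn_eqF (ltnSn i)) /=.
    by apply: res; [exact: nth_punion | exact: last_punion].
  - rewrite local_rule_diff // (skew_cells_H sn) (skew_cells_V sm) /= !inE !xpair_eqE !eqxx.
    rewrite !eqSS (gtn_eqF (ltnSn i)) /=.
    by apply: res; [move=> k; rewrite nth_punion maxnC | exact: last_punion].
  - rewrite (_ : posH lam i = posV mu i); last by rewrite /posV /posH mj; lia.
    apply: stepV_step; split=> //; [by rewrite mj mSj | by rewrite rk ?rSi ?ni ?nSi ?mj //; lia |].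
    by move=> k ki kSi; rewrite rk // nk // mk.
  rewrite (_ : posV lam i = posH nu i.+1); last by rewrite /posV /posH nSi; lia.
  exact: stepH_step.
have [||rho sr] := stepV_exists (i := j) pn.
- by rewrite !nk //; lia.
- move=> k e; have := part_nth_le pm (leqnSn k); rewrite -e mj mk; [|lia|lia].
  rewrite (nk j); last lia.
  by have [->|ki] := eqVneq k i; [rewrite ni; lia | rewrite nk].
have [_ pr nj [rj rSj] rk] := sr.
have res u : (forall k, nth 0%N u k = maxn (nth 0%N mu k) (nth 0%N nu k)) -> last 1 u != 0 -> u = rho.
  move=> u_nth u_last; apply: eq_from_nth_last => //; first exact: last_part.
  move=> k; rewrite u_nth; have [->|kj] := eqVneq k j; first by rewrite rj mj nk; lia.
  have [->|kSj] := eqVneq k j.+1; first by rewrite rSj mSj !nk; lia.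
  rewrite rk // mk //; have [->|ki] := eqVneq k i; first by rewrite ni; lia.
  by rewrite nk // maxnn.
exists rho; split.
- rewrite local_rule_diff // (skew_cells_H sn) (skew_cells_V sm) /= !inE !xpair_eqE !eqSS.
  rewrite (_ : (i == j) = false) /=; last exact/eqP.
  rewrite (_ : (i == j.+1) = false) /=; last exact/eqP.
  by apply: res; [exact: nth_punion | exact: last_punion].
- rewrite local_rule_diff // (skew_cells_H sn) (skew_cells_V sm) /= !inE !xpair_eqE !eqSS.
  rewrite (_ : (j == i) = false) /=; last by apply/eqP => e; case: ij.
  rewrite (_ : (j.+1 == i) = false) /=; last by apply/eqP => e; case: iSj.
  by apply: res; [move=> k; rewrite nth_punion maxnC | exact: last_punion].
- rewrite (_ : posH lam i = posH mu i); last by rewrite /posH mk //; lia.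
  apply: stepH_step; split=> //; first by rewrite rk ?ni ?mk //; lia.
  move=> k ki; have [->|kj] := eqVneq k j; first by rewrite rj mj nk //; lia.
  have [->|kSj] := eqVneq k j.+1; first by rewrite rSj mSj nk //; lia.
  by rewrite rk // nk // mk.
rewrite (_ : posV lam j = posV nu j); last by rewrite /posV nk //; lia.
exact: stepV_step.
Qed.

Lemma square_free lam mu nu rho p q : step lam p nu -> step lam q mu -> p != q ->
  step mu p rho -> step nu q rho -> square lam mu nu rho None.
Proof.
by move=> *; exists (Some p), (Some q), (Some p), (Some q); split=> //; constructor.
Qed.

Lemma square_next lam nu rho p p' : step lam p nu -> step nu p' rho ->
  next_move (bead lam) p p' -> square lam nu nu rho None.
Proof.
by move=> *; exists (Some p), (Some p), (Some p'), (Some p'); split=> //; constructor.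
Qed.

Lemma square_plus lam : is_part lam -> square lam lam lam (local_rule lam lam lam (Some false)) (Some false).
Proof.
move=> pl; have [//|rho sr] := stepH_exists (i := 0) pl.
have [_ pr r0 rk] := sr.
have -> : local_rule lam lam lam (Some false) = rho.
  apply: eq_from_nth_last; [| exact: last_part |].
    by apply: last_set_nth; [exact: last_part | rewrite addn2].
  by move=> k; rewrite nth_set_nth /= /row_len /=; case: eqVneq => [->|/rk ->] //; rewrite r0 addn2.
exists None, None, (Some (posH lam 0)), (Some (posH lam 0)); split=> //; try exact: stepH_step.
constructor; split; first exact: bead_row.
move=> x; rewrite /posH => lt; apply/beadP => -[i e].
by have := part_nth_le pl (leq0n i); lia.
Qed.

(** With [s] the first empty row, the bead of row [s.+1] moves to [1 - s], which is the lowest hole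
    because all rows above [s] are nonempty. *)
Lemma square_minus lam : is_part lam -> square lam lam lam (local_rule lam lam lam (Some true)) (Some true).
Proof.
move=> pl; pose s := size lam.
have [||rho sr] := stepV_exists (i := s) pl; first by rewrite !nth_default.
  move=> j e; have := part_nth_gt0 (i := j) pl; rewrite -/s (nth_default _ (leqnn s)); lia.
have [_ pr _ [rs rSs] rk] := sr.
have -> : local_rule lam lam lam (Some true) = rho.
  apply: eq_from_nth_last; [by rewrite last_cat | exact: last_part | move=> k].
  rewrite nth_cat; have [lt|ge] := ltnP k (size lam); first by rewrite rk //; lia.
  rewrite -/s; have [->|ks] := eqVneq k s; first by rewrite subnn rs (nth_default _ (leqnn s)).
  have [->|kSs] := eqVneq k s.+1; first by rewrite subSnn rSs (nth_default _ (leqnn s)).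
  by rewrite rk // !nth_default //=; lia.
exists None, None, (Some (posV lam s)), (Some (posV lam s)); split=> //; try exact: stepV_step.
constructor; rewrite /low_hole /posV (nth_default _ (leqnn _)); split.
  apply/beadP => -[i]; have [lt|ge] := ltnP i s; first by have := part_nth_gt0 pl lt; lia.
  by rewrite nth_default //; lia.
move=> x lt; rewrite /bead (_ : (x <= _)%R) //; rewrite -/s; lia.
Qed.

(** The condition on [m] is what a permutation matrix provides: at a nonzero entry nothing has yet
    been added from its row or its column, so lambda = mu = nu. *)
Lemma local_rule_square lam mu nu a b (m : option bool) : wstep lam a nu -> wstep lam b mu ->
  (m -> a = None /\ b = None) -> square lam mu nu (local_rule lam mu nu m) m.
Proof.
case: m => [s|] la lb hm.
  have [ea eb] := hm isT; rewrite ea eb in la lb.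
  case: la lb => pl -> [_ ->]; case: s {hm}; [exact: square_minus | exact: square_plus].
have [pl pn] := wstep_part la; have [_ pm] := wstep_part lb; clear hm.
have [e|/eqP nlm] := eqVneq lam mu.
  subst mu; rewrite /local_rule eqxx.
  have eb : b = None by apply: wstep_label_inj lb _.
  by subst b; exists a, None, a, None; split=> //; constructor.
have [e|/eqP nln] := eqVneq lam nu.
  subst nu; rewrite /local_rule (negPf (introN eqP nlm)) eqxx.
  have ea : a = None by apply: wstep_label_inj la _.
  by subst a; exists None, b, None, b; split=> //; constructor.
case: a la => [p|] la; last by case: la => _ e; case: nln.
case: b lb => [q|] lb; last by case: lb => _ e; case: nlm.
have [e|npq] := eqVneq p q.
  subst q; have e := step_fun la lb; subst mu.
  have [i [[-> [Np1 sH]]|[-> [_ sV]]]] := stepP la.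
    have [rho [-> sr]] := local_rule_HH_eq sH.
    apply: square_next (stepH_step sH) (stepH_step sr) _.
    have [_ _ _ nk] := sH; rewrite /next_move ifF; last exact: negbTE.
    have -> : posH nu i.+1 = posH lam i.+1 by rewrite /posH nk; lia.
    split; [by have := part_nth_le pl (leqnSn i); rewrite /posH; lia | exact: bead_row |].
    move=> x; rewrite /posH => lt1 lt2; apply/beadP => -[k].
    have [ki|ik] := ltnP k i.+1; last by have := part_nth_le pl ik; lia.
    have : k <= i by lia.
    by move=> /(part_nth_le pl); lia.
  have [rho [h [-> sr nx]]] := local_rule_VV_eq sV.
  exact: square_next (stepV_step sV) (stepV_step sr) nx.
have [i [[ep [_ sn]]|[ep [_ sn]]]] := stepP la; have [j [[eq [_ sm]]|[eq [_ sm]]]] := stepP lb.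
- have ij : i <> j by move=> e; move: npq; rewrite ep eq e eqxx.
  have [rho [-> s1 s2]] := local_rule_HH ij sn sm.
  apply: (square_free la lb npq).
  + rewrite ep (_ : posH lam i = posH mu i); first exact: stepH_step.
    by case: sm => _ _ _ mk; rewrite /posH mk //; apply/eqP.
  + rewrite eq (_ : posH lam j = posH nu j); first exact: stepH_step.
    by case: sn => _ _ _ mk; rewrite /posH mk //; apply/eqP => e; case: ij.
- have [rho [-> _ s1 s2]] := local_rule_HV sn sm.
  by apply: (square_free la lb npq); rewrite ?ep ?eq.
- have [rho [_ -> s1 s2]] := local_rule_HV sm sn.
  by apply: (square_free la lb npq); rewrite ?ep ?eq.
have ij : i <> j by move=> e; move: npq; rewrite ep eq e eqxx.
have [rho [-> s1 s2]] := local_rule_VV ij sn sm.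
by apply: (square_free la lb npq); rewrite ?ep ?eq.
Qed.

(** * Growth diagrams *)

Lemma local_move_some S m a b a' b' : local_move S m a b a' b' ->
  (isSome a' = isSome a || isSome m) /\ (isSome b' = isSome b || isSome m).
Proof. by case=> //= o; rewrite orbF. Qed.

(** Indices start at 0: [G i j] stands for lambda_(i+1,j+1) and [M i j] for M(i+1,j+1). *)
Definition grid (r n : nat) (G : nat -> nat -> part) (M : nat -> nat -> option bool) : Prop :=
  [/\ forall i, i <= n -> G i 0 = delta r, forall j, j <= n -> G 0 j = delta r &
      forall i j, i < n -> j < n -> square (G i j) (G i.+1 j) (G i j.+1) (G i.+1 j.+1) (M i j)].

Lemma grid_sym r n G M : grid r n G M -> grid r n (fun i j => G j i) (fun i j => M j i).
Proof. by case=> h1 h2 h3; split=> // i j hi hj; apply/square_sym/h3. Qed.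

Definition perm_entries (n : nat) (M : nat -> nat -> option bool) : Prop :=
  [/\ forall i, i < n -> exists2 j, j < n & M i j, forall j, j < n -> exists2 i, i < n & M i j,
      forall i j j', M i j -> M i j' -> j = j' & forall i i' j, M i j -> M i' j -> i = i'].

Lemma perm_entries_sym n M : perm_entries n M -> perm_entries n (fun i j => M j i).
Proof.
by case=> h1 h2 h3 h4; split=> // [i j j'|i i' j]; [apply: h4 | apply: h3].
Qed.

Lemma delta_nth r i : nth 0%N (delta r) i = r - i.
Proof.
have [lt|ge] := ltnP i r; last by rewrite nth_default ?size_rev ?size_iota //; lia.
by rewrite nth_rev size_iota // nth_iota; lia.
Qed.

Lemma delta_part r : is_part (delta r).
Proof.
apply/andP; split.
  by apply/(sortedP 0) => i _; rewrite !delta_nth /=; lia.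
by apply/allP => x; rewrite mem_rev mem_iota; lia.
Qed.

Lemma grid_asc r n G M i j1 j2 s1 s2 : grid r n G M -> perm_entries n M ->
  i.+1 < n -> j1 < n -> j2 < n -> M i j1 = Some s1 -> M i.+1 j2 = Some s2 ->
  exists p q, [/\ step (G i n) p (G i.+1 n), step (G i.+1 n) q (G i.+2 n) &
                  (p < q)%R = (lneg (j1.+1, s1) < lneg (j2.+1, s2))%R].
Proof.
move=> [G0 _ sq] [_ _ rowM colM] lt_i lt_j1 lt_j2 M1 M2.
have Mi j : isSome (M i j) = (j == j1).
  apply/idP/eqP => [h|->]; last by rewrite M1.
  by apply: rowM h _; rewrite M1.
have MSi j : isSome (M i.+1 j) = (j == j2).
  apply/idP/eqP => [h|->]; last by rewrite M2.
  by apply: rowM h _; rewrite M2.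
have j12 : j1 <> j2 by move=> e; subst j2; have := colM i i.+1 j1; rewrite M1 M2 => /(_ isT isT); lia.
(* Rows [i] and [i.+1] are followed column by column. A vertical edge is nondegenerate once the
   entry of its row is passed, so the comparison begins when both entries are. *)
suff inv j : j <= n -> exists o1 o2, [/\ wstep (G i j) o1 (G i.+1 j),
    wstep (G i.+1 j) o2 (G i.+2 j), isSome o1 = (j1 < j), isSome o2 = (j2 < j) &
    forall p q, o1 = Some p -> o2 = Some q ->
      (p < q)%R = (lneg (j1.+1, s1) < lneg (j2.+1, s2))%R].
  have [[p|] [[q|] [st1 st2 i1 i2 h]]] := inv n (leqnn n); try by rewrite ?lt_j1 ?lt_j2 in i1 i2.
  by exists p, q; split=> //; apply: h.
elim: j => [_|j IH lt_j].
  rewrite !G0; try lia.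
  by exists None, None; split=> //; split=> //; apply: delta_part.
have [o1 [o2 [st1 st2 i1 i2 h]]] := IH (ltnW lt_j); clear IH.
have [a [b [e [o1' [la lb le lo L1]]]]] := sq i j (ltnW lt_i) lt_j.
have [e2 [b2 [f [o2' [la2 lb2 le2 lo2 L2]]]]] := sq i.+1 j lt_i lt_j.
have eb := wstep_label_inj st1 lb; have eb2 := wstep_label_inj st2 lb2.
have ee := wstep_label_inj le la2; subst b b2 e2.
exists o1', o2'; split=> //.
- by rewrite (local_move_some L1).2 Mi i1; lia.
- by rewrite (local_move_some L2).2 MSi i2; lia.
move=> p' q' eo1 eo2; subst o1' o2'.
case m1: (M i j) (Mi j) => [s|] /= ej; move: L1; rewrite m1 => L1.
  have ej1 : j = j1 by apply/eqP; rewrite -ej.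
  subst j; move: m1; rewrite M1 => -[es]; subst s.
  have m2 : M i.+1 j1 = None by move: (MSi j1); case: (M i.+1 j1) => //= x /esym/eqP/j12.
  move: L2; rewrite m2 => L2.
  have [q eo2] : exists q, o2 = Some q.
    by have [_] := local_move_some L2; case: (o2) => // q _; exists q.
  subst o2; have lt21 : j2 < j1 by rewrite -i2.
  have [_ _ bq bq2 _] := lb2.
  (* The domino just created in row [i] either bumps the label of row [i.+1] or leaves it alone. *)
  have hq : (exists2 x, e = Some x & next_move (bead (G i.+1 j1)) x q' /\ q = x) \/
            ((forall x, e = Some x -> x <> q) /\ q' = q).
    move: (local_move_inv L2); case: (e) => [x|]; last by case=> _ [->]; right.
    case: eqP => [<-|ne] [].
      by move=> z nz [_ [->]]; left; exists x.
    by move=> _ [->]; right; split=> // y [<-].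
  move/local_move_inv: L1 => L1.
  have [ea eo] : a = None /\ o1 = None by move: L1; case: (s1); case: (a); case: (o1).
  subst a o1; have [_ eG] := st1; rewrite eG in bq bq2 hq.
  (* Since [j1 > j2], the sign [s1] alone decides the comparison of letters; the new label is the
     lowest or the highest possible accordingly. *)
  case: s1 M1 L1 h => M1 [x [hp1 hp2] [ee [ex]]] _; subst e x.
    rewrite (_ : lneg _ < lneg _ = true)%R; last by rewrite /lneg /=; case: (s2); lia.
    case: hq => [[x [<-]] [nm eq]|[ne ->]]; last first.
      have := ne _ erefl; have := hp2 (q + 2)%R; rewrite (negPf bq2); lia.
    by move: nm; rewrite /next_move hp2; [case; lia | lia].
  rewrite (_ : lneg _ < lneg _ = false)%R; last by rewrite /lneg /=; case: (s2); lia.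
  case: hq => [[x [<-]] [nm eq]|[ne ->]]; last first.
    have := ne _ erefl; have := hp2 q; rewrite bq; lia.
  by move: nm; rewrite /next_move (negPf (hp2 _ _)); [case; lia | lia].
have [p eo1] : exists p, o1 = Some p.
  by have [_] := local_move_some L1; case: (o1) => // p _; exists p.
subst o1.
case m2: (M i.+1 j) (MSi j) => [s|] /= ej2; move: L2; rewrite m2 => L2.
  have ej2' : j = j2 by apply/eqP; rewrite -ej2.
  subst j; move: m2; rewrite M2 => -[es]; subst s.
  have lt12 : j1 < j2 by rewrite -i1.
  have [_ _ bp bp2 bb] := st1.
  move/local_move_inv: L2 => L2.
  have [ee eo2] : e = None /\ o2 = None by move: L2; case: (s2); case: (e); case: (o2).
  subst e o2.
  have -> : p' = p.
    move/local_move_inv: L1; case: (a) => [x|]; last by case=> _ [].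
    by case: eqP => _ [] // ? _ [].
  (* Now [j2 > j1], and the sign [s2] decides. The position [p + 2] is a bead and [p] a hole of the
     diagram in which [x] is extremal. *)
  case: s2 M2 L2 h => M2 [x [hx1 hx2] [_ [ex]]] _; subst x.
    rewrite (_ : lneg _ < lneg _ = false)%R; last by rewrite /lneg /=; case: (s1); lia.
    by have := hx2 p; rewrite bb eqxx; lia.
  rewrite (_ : lneg _ < lneg _ = true)%R; last by rewrite /lneg /=; case: (s1); lia.
  by have := hx2 (p + 2)%R; rewrite bb eqxx; lia.
have [q eo2] : exists q, o2 = Some q.
  by have [_] := local_move_some L2; case: (o2) => // q _; exists q.
subst o2; rewrite -(h p q) //.
by rewrite (asc_preserved st1 st2 la L1 L2).
Qed.

Lemma has_iotaS (p : pred nat) k : has p (iota 0 k.+1) = has p (iota 0 k) || p k.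
Proof. by rewrite -addn1 iotaD has_cat /= orbF. Qed.

(** The induction records that an edge is nondegenerate exactly when a nonzero entry precedes it in
    its row or column. This yields the hypothesis of [local_rule_square] at every nonzero entry. *)
Lemma grid_of_rule r n G M :
  (forall i, i <= n -> G i 0 = delta r) -> (forall j, j <= n -> G 0 j = delta r) ->
  (forall i j, i < n -> j < n -> G i.+1 j.+1 = local_rule (G i j) (G i.+1 j) (G i j.+1) (M i j)) ->
  perm_entries n M -> grid r n G M.
Proof.
move=> G0 G0' GS [_ _ rowM colM].
pose top i := forall j, j < n ->
  exists2 a, wstep (G i j) a (G i j.+1) & isSome a = has (fun k => isSome (M k j)) (iota 0 i).
have row i : i < n -> top i ->
    (forall j, j < n -> square (G i j) (G i.+1 j) (G i j.+1) (G i.+1 j.+1) (M i j)) /\ top i.+1.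
  move=> lt_i topi.
  have sq j : j < n -> forall b, wstep (G i j) b (G i.+1 j) ->
      isSome b = has (fun k => isSome (M i k)) (iota 0 j) ->
      square (G i j) (G i.+1 j) (G i j.+1) (G i.+1 j.+1) (M i j).
    move=> lt_j b wb eb; have [a wa ea] := topi j lt_j; rewrite GS //.
    apply: (local_rule_square wa wb) => m; split.
      case: a ea {wa} => // x /esym/hasP[k]; rewrite mem_iota => lt_k Mk.
      by have := colM _ _ _ m Mk; lia.
    case: b eb {wb} => // x /esym/hasP[k]; rewrite mem_iota => lt_k Mk.
    by have := rowM _ _ _ m Mk; lia.
  have left j : j <= n ->
      exists2 b, wstep (G i j) b (G i.+1 j) & isSome b = has (fun k => isSome (M i k)) (iota 0 j).
    elim: j => [_|j IH lt_j].
      by exists None => //; rewrite !G0 //; [split=> //; apply: delta_part | lia].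
    have [b wb eb] := IH (ltnW lt_j).
    have [a1 [b1 [a' [b' [la lb ma nb L]]]]] := sq j lt_j b wb eb.
    exists b' => //; rewrite (local_move_some L).2 has_iotaS -eb.
    by rewrite (wstep_label_inj wb lb).
  have sqr j : j < n -> square (G i j) (G i.+1 j) (G i j.+1) (G i.+1 j.+1) (M i j).
    by move=> lt_j; have [b wb eb] := left j (ltnW lt_j); apply: sq wb eb.
  split=> // j lt_j; have [a1 [b1 [a' [b' [la lb ma nb L]]]]] := sqr j lt_j.
  have [a wa ea] := topi j lt_j; exists a' => //.
  by rewrite (local_move_some L).1 has_iotaS -ea (wstep_label_inj wa la).
have tops i : i <= n -> top i.
  elim: i => [_ j lt_j|i IH lt_i]; last exact: (row i lt_i (IH (ltnW lt_i))).2.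
  by exists None => //; rewrite !G0' //; [split=> //; apply: delta_part | lia].
by split=> // i j lt_i lt_j; apply: (row i lt_i (tops i (ltnW lt_i))).1.
Qed.

Lemma grid_row_step r n G M i j : grid r n G M -> i < n -> j <= n ->
  exists2 o, wstep (G i j) o (G i.+1 j) & isSome o = has (fun k => isSome (M i k)) (iota 0 j).
Proof.
move=> [G0 _ sq] lt_i; elim: j => [_|j IH lt_j].
  by exists None => //; rewrite !G0 //; [split=> //; apply: delta_part | lia].
have [b wb eb] := IH (ltnW lt_j).
have [a1 [b1 [a' [b' [la lb ma nb L]]]]] := sq i j lt_i lt_j.
exists b' => //; rewrite (local_move_some L).2 has_iotaS -eb.
by rewrite (wstep_label_inj wb lb).
Qed.

Lemma grid_right_step r n G M i : grid r n G M -> perm_entries n M -> i < n ->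
  exists p, step (G i n) p (G i.+1 n).
Proof.
move=> gG [rowE _ _ _] lt_i; have [[p|] st e] := grid_row_step gG lt_i (leqnn n).
  by exists p.
have [j lt_j Mj] := rowE i lt_i; move/esym/hasPn: e => /(_ j).
by rewrite mem_iota Mj => /(_ lt_j).
Qed.

(** A nonzero entry needs a degenerate edge on its left, but an earlier nonzero entry of the same
    row has made that edge a domino. *)
Lemma grid_row_uniq r n G M i j j' : grid r n G M -> i < n -> j < n -> j' < n ->
  M i j -> M i j' -> j = j'.
Proof.
move=> gG lt_i.
wlog lt_jj : j j' / j < j'.
  move=> W lt_j lt_j' Mj Mj'; have [lt|lt|//] := ltngtP j j'; first exact: W.
  by apply/esym; apply: W.
move=> _ lt_j' Mj Mj'; have [o wo eo] := grid_row_step gG lt_i (ltnW lt_j').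
have [_ _ sq] := gG; have [a [b [a' [b' [la lb ma nb L]]]]] := sq i j' lt_i lt_j'.
move: eo; rewrite (wstep_label_inj wo lb) => eb.
have : isSome b by rewrite eb; apply/hasP; exists j; rewrite ?mem_iota.
move/local_move_inv: L; case: (M i j') Mj' => // -[] _; case: (a) => //; case: (b) => //.
Qed.

(** For reconstructed diagrams: a genuine domino at the end of every row and column forces a nonzero
    entry in each, and uniqueness holds in any grid. *)
Lemma perm_entries_of_grid r n G M : grid r n G M ->
  (forall i j, M i j -> i < n /\ j < n) ->
  (forall i, i < n -> exists p, step (G i n) p (G i.+1 n)) ->
  (forall j, j < n -> exists p, step (G n j) p (G n j.+1)) ->
  perm_entries n M.
Proof.
have ex G' M' i : grid r n G' M' -> i < n -> (exists p, step (G' i n) p (G' i.+1 n)) ->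
    exists2 j, j < n & M' i j.
  move=> gG lt_i [p st]; have [o wo eo] := grid_row_step gG lt_i (leqnn n).
  have e : o = Some p by apply: wstep_label_inj wo _.
  by move: eo; rewrite e => /esym/hasP[j]; rewrite mem_iota => lt_j Mj; exists j.
move=> gG rng right bot; split=> [i lt_i|j lt_j|i j j' m m'|i i' j m m'].
- exact: ex gG lt_i (right i lt_i).
- exact: ex (grid_sym gG) lt_j (bot j lt_j).
- have [lt_i lt_j] := rng _ _ m; have [_ lt_j'] := rng _ _ m'.
  exact: grid_row_uniq gG lt_i lt_j lt_j' m m'.
have [lt_i lt_j] := rng _ _ m; have [lt_i' _] := rng _ _ m'.
exact: grid_row_uniq (grid_sym gG) lt_j lt_i lt_i' m m'.
Qed.

Lemma grid_fun r n G G' M M' : grid r n G M -> grid r n G' M' ->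
  (forall i j, i < n -> j < n -> M i j = M' i j) ->
  forall i j, i <= n -> j <= n -> G i j = G' i j.
Proof.
move=> [G0 G0' sq] [H0 H0' sq'] eM; elim=> [|i IHi] j lt_i; first by move=> lt_j; rewrite G0' ?H0'.
elim: j => [_|j IHj lt_j]; first by rewrite G0 ?H0.
have := sq i j lt_i lt_j; have := sq' i j lt_i lt_j.
rewrite -(IHi j) -1?(IHi j.+1) -1?IHj -?eM; try lia.
by move=> s1 s2; apply: square_fun s2 s1.
Qed.

Lemma grid_inj r n G G' M M' : grid r n G M -> grid r n G' M' ->
  (forall j, j <= n -> G n j = G' n j) -> (forall i, i <= n -> G i n = G' i n) ->
  forall i j, i < n -> j < n -> M i j = M' i j.
Proof.
move=> [_ _ sq] [_ _ sq'] bot right.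
(* The induction runs backwards from the corner [(n, n)], [k] and [l] being the distances to it. *)
have eG k l : k <= n -> l <= n -> G (n - k) (n - l) = G' (n - k) (n - l).
  elim: k l => [|k IHk] l lt_k; first by rewrite !subn0 => _; apply: bot; lia.
  elim: l => [_|l IHl lt_l]; first by rewrite !subn0; apply: right; lia.
  have := sq (n - k.+1) (n - l.+1); have := sq' (n - k.+1) (n - l.+1).
  rewrite !subnSK // -!IHk -?IHl; try lia.
  move=> s1 s2; suff [] : G (n - k.+1) (n - l.+1) = G' (n - k.+1) (n - l.+1) /\
    M (n - k.+1) (n - l.+1) = M' (n - k.+1) (n - l.+1) by [].
  by apply: square_inj (s2 _ _) (s1 _ _); lia.
have eG' i j : i <= n -> j <= n -> G i j = G' i j.
  by move=> le_i le_j; rewrite -(subKn le_i) -(subKn le_j); apply: eG; lia.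
move=> i j lt_i lt_j; have := sq i j lt_i lt_j; have := sq' i j lt_i lt_j.
rewrite -!eG'; try lia.
by move=> s1 s2; have [] := square_inj s2 s1.
Qed.

(** Fills one row of squares from right to left, given its lower side [R'] and its upper right
    corner [kap]. *)
Lemma unsquare_row n (R' : nat -> part) kap o :
  (forall j, j < n -> exists a, wstep (R' j) a (R' j.+1)) -> wstep kap o (R' n) ->
  exists (R : nat -> part) M, R n = kap /\
    forall j, j < n -> square (R j) (R' j) (R j.+1) (R' j.+1) (M j).
Proof.
elim: n kap o => [|n IH] kap o hR wk; first by exists (fun _ => kap), (fun _ => None).
have [a wa] := hR n (ltnSn n); have [lam [m sq]] := unsquare wa wk.
have [a1 [b1 [a' [b' [la lb ma nb L]]]]] := sq.
have [j lt_j|R [M [Rn sqR]]] := IH lam b1 _ lb; first by apply: hR; lia.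
exists (fun j => if j == n.+1 then kap else R j), (fun j => if j == n then m else M j).
split=> [|j]; first by rewrite eqxx.
rewrite ltnS leq_eqVlt => /orP[/eqP->|lt_j].
  by rewrite !eqxx (_ : (n == n.+1) = false) ?Rn //; lia.
rewrite eqSS !(ltn_eqF lt_j) (_ : (j == n.+1) = false); last lia.
exact: sqR.
Qed.

Lemma unsquare_grid k n (R' C : nat -> part) :
  (forall j, j < n -> exists a, wstep (R' j) a (R' j.+1)) ->
  (forall i, i < k -> exists a, wstep (C i) a (C i.+1)) -> C k = R' n ->
  exists (G : nat -> nat -> part) M, [/\ forall j, G k j = R' j, forall i, i <= k -> G i n = C i &
    forall i j, i < k -> j < n -> square (G i j) (G i.+1 j) (G i j.+1) (G i.+1 j.+1) (M i j)].
Proof.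
elim: k R' => [|k IH] R' hR hC eC.
  exists (fun _ => R'), (fun _ _ => None); split=> // i.
  by rewrite leqn0 => /eqP ->.
have [o] := hC k (ltnSn k); rewrite eC => wo.
have [R [M1 [Rn sqR]]] := unsquare_row hR wo.
have [||G [M [Gk GC sqG]]] := IH R _ _ (esym Rn).
- by move=> j /sqR[a [b [a' [b' [la _ _ _ _]]]]]; exists a.
- by move=> i lt_i; apply: hC; lia.
exists (fun i => if i == k.+1 then R' else G i), (fun i => if i == k then M1 else M i).
split=> [j|i|i j]; first by rewrite eqxx.
  by rewrite leq_eqVlt => /orP[/eqP ->|lt_i]; rewrite ?eqxx ?eC // ltn_eqF // GC.
rewrite ltnS leq_eqVlt => /orP[/eqP->|lt_i] lt_j.
  by rewrite !eqxx (_ : (k == k.+1) = false) ?Gk; [apply: sqR | lia].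
rewrite eqSS !(ltn_eqF lt_i) (_ : (i == k.+1) = false); last lia.
exact: sqG.
Qed.

(** Row [i] of the staircase gives the bead [r - 2i] for [i <= r]; from there on the rows are empty
    and every position is a bead. *)
Lemma bead_delta r x : bead (delta r) x = (x <= - r%:Z)%R || ((x <= r%:Z)%R && ~~ odd (absz (r%:Z - x)%R)).
Proof.
apply/beadP/idP => [[i ->]|h]; first by rewrite delta_nth; lia.
have [le|gt] := leP x (- r%:Z)%R; first by exists (absz x); rewrite delta_nth; lia.
by exists (absz (r%:Z - x)%R)./2; rewrite delta_nth; lia.
Qed.

Lemma delta_core r lam p : ~ step lam p (delta r).
Proof.
move=> [_ _ lp lp2 bd]; have := bd p; have := bd (p + 2)%R.
rewrite !bead_delta !eqxx; lia.
Qed.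

(** * Zero-based access to the computed growth diagram *)

Lemma size_grow_row prev mu ms : size prev = (size ms).+1 -> size (grow_row prev mu ms) = size ms.
Proof.
elim: prev mu ms => [|lam prev IH] mu [|m ms] //= [sz].
by case: prev sz IH => //= nu prev sz IH; rewrite IH.
Qed.

Lemma nth_grow_row prev mu ms j : size prev = (size ms).+1 -> j < size ms ->
  nth [::] (grow_row prev mu ms) j =
  local_rule (nth [::] prev j) (nth [::] (mu :: grow_row prev mu ms) j)
             (nth [::] prev j.+1) (nth None ms j).
Proof.
elim: prev mu ms j => [|lam prev IH] mu [|m ms] //= j [sz].
case: prev sz IH => //= nu prev sz IH; case: j => //= j lt_j.
by rewrite IH.
Qed.

Lemma size_rows_from r n pi i row k : size (rows_from r n pi i row k) = k.+1.
Proof. by elim: k i row => //= k IH i row; rewrite IH. Qed.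

Lemma nth_rows_from r n pi i row k m : m < k ->
  nth [::] (rows_from r n pi i row k) m.+1 =
  next_row r n pi (i + m) (nth [::] (rows_from r n pi i row k) m).
Proof.
elim: k i row m => //= k IH i row [|m] lt_m /=; first by rewrite addn0; case: k {IH lt_m}.
by rewrite IH // addSnnS.
Qed.

Definition growth_at (r : nat) (pi : seq letter) (i j : nat) : part :=
  nth [::] (nth [::] (growth r pi) i) j.

Definition entry (pi : seq letter) (i j : nat) : option bool := Mentry pi i.+1 j.+1.

Definition signed_perm (n : nat) (pi : seq letter) : Prop :=
  size pi = n /\ perm_eq [seq y.1 | y <- pi] (iota 1 n).

Lemma size_growth_row r pi i : i <= size pi -> size (nth [::] (growth r pi) i) = (size pi).+1.
Proof.
elim: i => [_|i IH lt_i]; first by rewrite /growth; case: (size pi) => //= n; rewrite size_nseq.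
rewrite nth_rows_from //= size_grow_row // size_map size_iota //.
exact: IH (ltnW lt_i).
Qed.

Lemma growth_at0 r pi i : i <= size pi -> growth_at r pi i 0 = delta r.
Proof.
case: i => [_|i lt_i]; first by rewrite /growth_at /growth; case: (size pi).
by rewrite /growth_at /growth nth_rows_from.
Qed.

Lemma growth_at0l r pi j : j <= size pi -> growth_at r pi 0 j = delta r.
Proof.
move=> le_j; rewrite /growth_at /growth.
rewrite (_ : nth [::] _ 0 = nseq (size pi).+1 (delta r)); last by case: (size pi).
by rewrite nth_nseq ltnS le_j.
Qed.

Lemma growth_atS r pi i j : i < size pi -> j < size pi ->
  growth_at r pi i.+1 j.+1 =
  local_rule (growth_at r pi i j) (growth_at r pi i.+1 j) (growth_at r pi i j.+1) (entry pi i j).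
Proof.
move=> lt_i lt_j; rewrite /growth_at; have szr := size_growth_row r (ltnW lt_i).
have -> : nth [::] (growth r pi) i.+1 =
    next_row r (size pi) pi i.+1 (nth [::] (growth r pi) i) by apply: nth_rows_from.
rewrite /next_row [LHS]/= nth_grow_row ?size_map ?size_iota //.
by rewrite (nth_map 0) ?size_iota // nth_iota.
Qed.

(** The default letter [(0, false)] never has value [j.+1], so this also covers [i] out of range. *)
Lemma entryP pi i j s :
  (entry pi i j = Some s) <-> (nth (0, false) pi i = (j.+1, s)).
Proof.
rewrite /entry /Mentry /=; case: (nth _ pi i) => y b /=.
by case: eqP => [->|ne]; split=> //; [case=> -> | case=> -> | case=> /ne].
Qed.

Lemma isSome_entry pi i j : isSome (entry pi i j) = ((nth (0, false) pi i).1 == j.+1).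
Proof. by rewrite /entry /Mentry; case: ifP. Qed.

Lemma perm_entries_signed n pi : signed_perm n pi -> perm_entries n (entry pi).
Proof.
move=> [sz pe]; have un : uniq [seq y.1 | y <- pi] by rewrite (perm_uniq pe) iota_uniq.
have nth1 i : (nth (0, false) pi i).1 = nth 0 [seq y.1 | y <- pi] i.
  have [lt|ge] := ltnP i (size pi); first by rewrite (nth_map (0, false)).
  by rewrite !nth_default ?size_map.
split.
- move=> i lt_i; have : (nth (0, false) pi i).1 \in iota 1 n.
    by rewrite -(perm_mem pe) nth1 mem_nth ?size_map ?sz.
  rewrite mem_iota => h; exists (nth (0, false) pi i).1.-1; first lia.
  by rewrite isSome_entry prednK //; lia.
- move=> j lt_j; have : j.+1 \in [seq y.1 | y <- pi] by rewrite (perm_mem pe) mem_iota; lia.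
  move=> hj; exists (index j.+1 [seq y.1 | y <- pi]).
    by rewrite -sz -(size_map fst) index_mem.
  by rewrite isSome_entry nth1 nth_index.
- by move=> i j j'; rewrite !isSome_entry => /eqP -> /eqP [].
move=> i i' j; rewrite !isSome_entry !nth1 => /eqP e /eqP e'.
have lt k : nth 0 [seq y.1 | y <- pi] k = j.+1 -> k < size [seq y.1 | y <- pi].
  by move=> ek; rewrite ltnNge; apply/negP => ge; rewrite nth_default in ek.
by apply/eqP; rewrite -(nth_uniq 0 (lt _ e) (lt _ e') un) e e'.
Qed.

Lemma growth_grid r n pi : signed_perm n pi -> grid r n (growth_at r pi) (entry pi).
Proof.
move=> sp; have [sz _] := sp; apply: grid_of_rule; rewrite -?sz.
- exact: growth_at0.
- exact: growth_at0l.
- exact: growth_atS.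
- by rewrite sz; apply: perm_entries_signed.
Qed.

Lemma entry_inj n pi pi' : signed_perm n pi -> signed_perm n pi' ->
  (forall i j, i < n -> j < n -> entry pi i j = entry pi' i j) -> pi = pi'.
Proof.
move=> sp sp'; have [sz _] := sp; have [sz' _] := sp'.
have [rowE _ _ _] := perm_entries_signed sp.
move=> eqE; apply: (eq_from_nth (x0 := (0, false))); first by rewrite sz.
move=> i; rewrite sz => lt_i; have [j lt_j] := rowE i lt_i.
case e: (entry pi i j) => [s|] // _.
by rewrite (entryP pi i j s).1 // -(entryP pi' i j s).1 // -eqE.
Qed.

Lemma growth_inj r n pi pi' : signed_perm n pi -> signed_perm n pi' ->
  (forall j, j <= n -> growth_at r pi n j = growth_at r pi' n j) ->
  (forall i, i <= n -> growth_at r pi i n = growth_at r pi' i n) -> pi = pi'.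
Proof.
move=> sp sp' bot right; apply: (entry_inj sp sp').
exact: grid_inj (growth_grid r sp) (growth_grid r sp') bot right.
Qed.

Lemma signed_perm_of_entries n M : perm_entries n M -> (forall i j, M i j -> i < n /\ j < n) ->
  exists2 pi, signed_perm n pi & forall i j, entry pi i j = M i j.
Proof.
move=> [rowE colE rowM colM] rng.
pose J i := find (fun j => isSome (M i j)) (iota 0 n).
have JP i j : M i j -> J i = j.
  move=> Mij; have [lt_i lt_j] := rng _ _ Mij.
  have hs : has (fun j => isSome (M i j)) (iota 0 n) by apply/hasP; exists j; rewrite ?mem_iota.
  apply: rowM Mij; have := nth_find 0 hs; rewrite nth_iota //.
  by rewrite -[X in _ < X](size_iota 0 n) -has_find.
have JM i : i < n -> M i (J i) by move=> /rowE[j _ Mij]; rewrite (JP _ _ Mij).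
pose pi := mkseq (fun i => ((J i).+1, odflt false (M i (J i)))) n.
have pi_nth i : i < n -> nth (0, false) pi i = ((J i).+1, odflt false (M i (J i))).
  by move=> lt_i; rewrite nth_mkseq.
have eP i j : entry pi i j = M i j.
  have [lt_i|ge_i] := ltnP i n; last first.
    rewrite /entry /Mentry nth_default ?size_mkseq //=.
    by case e: (M i j) => //; have := rng i j; rewrite e => /(_ isT); lia.
  rewrite /entry /Mentry pi_nth //= eqSS; case: eqP => [<-|ne].
    by case: (M i (J i)) (JM _ lt_i).
  by case e: (M i j) => //; case: ne; apply: JP; rewrite e.
exists pi => //; split; first by rewrite size_mkseq.
rewrite /pi /mkseq -map_comp /=.
apply: uniq_perm; rewrite ?iota_uniq //.
  rewrite map_inj_in_uniq ?iota_uniq // => i i'; rewrite !mem_iota => lt_i lt_i' [e].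
  by apply: (colM _ _ (J i)); [apply: JM | rewrite e; apply: JM].
move=> k; apply/mapP/idP => [[i + ->]|].
  by rewrite !mem_iota => lt_i; have := rng _ _ (JM i lt_i) => /= -[]; lia.
rewrite mem_iota => lt_k; have [|i lt_i Mi] := colE k.-1; first lia.
by exists i; rewrite ?mem_iota //= (JP _ _ Mi); lia.
Qed.

(** The backward filling does not prescribe the left column and the top row. They start at
    [delta r], and any edge ending at [delta r] is degenerate by [delta_core], so they are
    constant. *)
Lemma growth_surj r n (C D : nat -> part) : C 0 = delta r -> D 0 = delta r -> C n = D n ->
  (forall j, j < n -> exists p, step (C j) p (C j.+1)) ->
  (forall i, i < n -> exists p, step (D i) p (D i.+1)) ->
  exists2 pi, signed_perm n pi &
    (forall j, j <= n -> growth_at r pi n j = C j) /\ (forall i, i <= n -> growth_at r pi i n = D i).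
Proof.
move=> C0 D0 CD hC hD.
have wC j : j < n -> exists a, wstep (C j) a (C j.+1) by move=> /hC[p st]; exists (Some p).
have wD j : j < n -> exists a, wstep (D j) a (D j.+1) by move=> /hD[p st]; exists (Some p).
have [G [M0 [Gb Gr sq]]] := unsquare_grid wC wD (esym CD).
have wdelta lam o : wstep lam o (delta r) -> lam = delta r.
  by case: o => [p /delta_core //|[_ ->]].
(* Cut off outside the square, where the reconstruction says nothing about the entries. *)
pose M i j := if (i < n) && (j < n) then M0 i j else None.
have down k : k <= n -> G (n - k) 0 = delta r.
  elim: k => [|k IH] lt_k; first by rewrite subn0 Gb.
  have [||a [b [a' [b' [_ lb _ _ _]]]]] := sq (n - k.+1) 0; [lia | lia |].
  by move: lb; rewrite subnSK // IH; [apply: wdelta | lia].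
have left k : k <= n -> G 0 (n - k) = delta r.
  elim: k => [|k IH] lt_k; first by rewrite subn0 Gr.
  have [||a [b [a' [b' [la _ _ _ _]]]]] := sq 0 (n - k.+1); [lia | lia |].
  by move: la; rewrite subnSK // IH; [apply: wdelta | lia].
have gG : grid r n G M.
  split=> [i le_i|j le_j|i j lt_i lt_j].
  - by rewrite -(subKn le_i) down //; lia.
  - by rewrite -(subKn le_j) left //; lia.
  - by rewrite /M lt_i lt_j; apply: sq.
have rng i j : M i j -> i < n /\ j < n by rewrite /M; case: ifP => // /andP[].
have pM : perm_entries n M.
  apply: perm_entries_of_grid gG rng _ _ => k lt_k.
    by rewrite !Gr //; [apply: hD | lia].
  by rewrite !Gb; apply: hC.
have [pi sp ePi] := signed_perm_of_entries pM rng.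
have eqG := grid_fun (growth_grid r sp) gG (fun i j _ _ => ePi i j).
exists pi => //; split=> [j le_j|i le_i]; first by rewrite eqG.
by rewrite eqG // Gr.
Qed.

(** * Domino tableaux and chains of partitions *)

Lemma domino_of_H lam i mu : stepH lam i mu ->
  domino_of mu lam = ((i.+1, (nth 0%N lam i).+1), false).
Proof. by move=> st; rewrite /domino_of (skew_cells_H st) /= eqxx. Qed.

Lemma domino_of_V lam i mu : stepV lam i mu ->
  domino_of mu lam = ((i.+1, (nth 0%N lam i).+1), true).
Proof.
by move=> st; rewrite /domino_of (skew_cells_V st) /= eqSS (ltn_eqF (ltnSn i)).
Qed.

Lemma wstep_vert lam o mu : wstep lam o mu -> vert lam o = (domino_of mu lam).2.
Proof.
case: o => [p|] /=.
  case/stepP => i [[-> [/negPf -> st]]|[-> [-> st]]]; first by rewrite (domino_of_H st).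
  by rewrite (domino_of_V st).
case=> _ ->; rewrite /domino_of; case e: (skew_cells lam lam) => [//|c s].
have : c \in skew_cells lam lam by rewrite e mem_head.
by rewrite mem_skew_cells /in_skew andbN.
Qed.

Lemma dcells_step lam p mu a : step lam p mu -> dcells (domino_of mu lam, a) = skew_cells mu lam.
Proof.
case/stepP => i [[_ [_ st]]|[_ [_ st]]].
  by rewrite (domino_of_H st) (skew_cells_H st).
by rewrite (domino_of_V st) (skew_cells_V st).
Qed.

Lemma mem_dcells_step lam p mu a c : step lam p mu ->
  (c \in dcells (domino_of mu lam, a)) = in_skew mu lam c.
Proof. by move=> st; rewrite (dcells_step a st) mem_skew_cells. Qed.

Lemma step_sub lam p mu i : step lam p mu -> nth 0%N lam i <= nth 0%N mu i.
Proof.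
case/stepP => j [[_ [_ [_ _ mj mk]]]|[_ [_ [_ _ lj [mj mSj] mk]]]].
  by have [->|ij] := eqVneq i j; [rewrite mj; lia | rewrite mk].
have [->|ij] := eqVneq i j; first by rewrite mj.
by have [->|iSj] := eqVneq i j.+1; [rewrite mSj lj | rewrite mk].
Qed.

Lemma step_in_cells lam p mu c : step lam p mu -> in_cells lam c -> in_cells mu c.
Proof.
by move=> st; rewrite /in_cells => /andP[-> h]; rewrite (leq_trans h) // (step_sub _ st).
Qed.

Lemma step_size lam p mu : step lam p mu -> sumn mu = sumn lam + 2.
Proof.
have bound (s : seq nat) N : size s <= N -> sumn s = \sum_(k < N) nth 0%N s k.
  elim: s N => [|x s IH] [|N] //=; first by rewrite big_ord0.
    by rewrite big1 // => k _; rewrite nth_nil.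
  by rewrite ltnS => /IH ->; rewrite big_ord_recl.
have one N i : i < N -> \sum_(k < N) (k == i :> nat) = 1.
  move=> lt_i; rewrite (bigD1 (Ordinal lt_i)) //= eqxx big1 // => k.
  by rewrite -val_eqE /= => /negPf ->.
move=> st; have [i st'] : exists i, stepH lam i mu \/ stepV lam i mu.
  by case/stepP: st => i [[_ [_ ?]]|[_ [_ ?]]]; exists i; [left | right].
pose N := size lam + size mu + i.+2.
rewrite !(bound _ N); try by rewrite /N; lia.
(* One cell goes to row [i]; the other goes to row [i.+1] if row [i] grew by one, and to row [i]
   again otherwise. *)
have eq_nth k : nth 0%N mu k = nth 0%N lam k + (k == i :> nat) +
    (k == (if nth 0%N mu i == (nth 0%N lam i).+1 then i.+1 else i) :> nat).
  case: st' => [[_ _ mi mk]|[_ _ li [mi mSi] mk]]; rewrite mi.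
    rewrite (gtn_eqF (ltnSn (nth 0%N lam i).+1)).
    by have [->|/mk ->] := eqVneq k i; lia.
  rewrite eqxx; have [->|ki] := eqVneq k i; first by rewrite mi (ltn_eqF (ltnSn i)); lia.
  by have [->|kSi] := eqVneq k i.+1; [rewrite mSi li; lia | rewrite mk //; lia].
under eq_bigr do rewrite eq_nth.
by rewrite !big_split /= !one; [lia | case: ifP; rewrite /N; lia | rewrite /N; lia].
Qed.

Definition lcol (d : cell * bool) : nat := d.1.2.
Definition rcol (d : cell * bool) : nat := d.1.2 + ~~ d.2.

Lemma mem_dcells_cols d a c : c \in dcells (d, a) -> lcol d <= c.2 <= rcol d.
Proof.
case: d => [[k l] v]; rewrite /dcells /lcol /rcol !inE /=.
by case/orP => /eqP->; case: v => /=; lia.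
Qed.

(** The top row [j] of the second domino decides both sides. Weakly above the last row of the first
    domino, monotonicity of [be] puts it strictly to the right with a larger label; below,
    monotonicity of [al] refutes both. *)
Lemma step_asc al p be q ga : step al p be -> step be q ga ->
  (p < q)%R = (rcol (domino_of be al) < lcol (domino_of ga be)).
Proof.
move=> st1 st2; have [_ pb _ _ _] := st1; rewrite /lcol /rcol.
have le i j : i <= j -> nth 0%N be j <= nth 0%N be i by apply: part_nth_le.
have [pa _ _ _ _] := st1.
have le_al i j : i <= j -> nth 0%N al j <= nth 0%N al i by apply: part_nth_le.
have [i [[-> [_ s1]]|[-> [_ s1]]]] := stepP st1; have [j [[-> [_ s2]]|[-> [_ s2]]]] := stepP st2.
- rewrite (domino_of_H s1) (domino_of_H s2) /= /posH; have [_ _ bi bk] := s1.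
  have [ji|ij] := leqP j i; first by have := le _ _ ji; rewrite bi; lia.
  by have := le_al _ _ (ltnW ij); rewrite bk; lia.
- rewrite (domino_of_H s1) (domino_of_V s2) /= /posH /posV; have [_ _ bi bk] := s1.
  have [ji|ij] := leqP j i; first by have := le _ _ ji; rewrite bi; lia.
  by have := le_al _ _ (ltnW ij); rewrite bk; lia.
- rewrite (domino_of_V s1) (domino_of_H s2) /= /posH /posV; have [_ _ ai [bi bSi] bk] := s1.
  have [ji|ij] := leqP j i.+1; first by have := le _ _ ji; rewrite bSi; lia.
  by have := le_al i j; rewrite bk; lia.
rewrite (domino_of_V s1) (domino_of_V s2) /= /posV; have [_ _ ai [bi bSi] bk] := s1.
(* Impossible: row [i.+1] of [be] has just become longer than row [i.+2], so no vertical domino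
   starts there. *)
have [jSi|nji] := eqVneq j i.+1.
  have [_ _ bj _ _] := s2; move: bj; rewrite jSi bSi bk; [|lia|lia].
  by have := le_al _ _ (leqnSn i.+1); lia.
have [ji|ij] := leqP j i.+1; first by have := le _ _ ji; rewrite bSi; lia.
by have := le_al i j; rewrite bk; lia.
Qed.

Definition chain (r n : nat) (C : nat -> part) : Prop :=
  C 0 = delta r /\ forall i, i < n -> exists p, step (C i) p (C i.+1).

Definition chain_dom (C : nat -> part) (k : nat) : cell * bool := domino_of (C k.+1) (C k).

Definition chain_label (C : nat -> part) (s : seq nat) (n : nat) : tableau :=
  [fset (chain_dom C k, nth 0%N s k) | k in iota 0 n]%fset.

(** The label sequences that turn the chain [C] into a semistandard tableau; the last clause allows
    a repeated label only at an ascent of the chain. *)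
Definition labelling (C : nat -> part) (n : nat) (s : seq nat) : Prop :=
  [/\ size s = n, sorted leq s, all (fun x => 0 < x) s &
      forall k, k.+1 < n -> nth 0%N s k = nth 0%N s k.+1 ->
        rcol (chain_dom C k) < lcol (chain_dom C k.+1)].

Lemma chain_labelP C s n d :
  reflect (exists2 k, k < n & d = (chain_dom C k, nth 0%N s k)) (d \in chain_label C s n).
Proof.
apply: (iffP (imfsetP _ _ _ _)) => [[k /=]|[k lt_k ->]].
  by rewrite mem_iota => lt_k ->; exists k.
by exists k; rewrite //= mem_iota.
Qed.

Lemma chain_dcells r n C k a c : chain r n C -> k < n ->
  (c \in dcells (chain_dom C k, a)) = in_cells (C k.+1) c && ~~ in_cells (C k) c.
Proof. by move=> [_ st] /st[p stk]; rewrite (mem_dcells_step _ _ stk). Qed.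

Lemma chain_mono r n C i j c : chain r n C -> i <= j -> j <= n ->
  in_cells (C i) c -> in_cells (C j) c.
Proof.
move=> [_ st]; elim: j => [|j IH]; first by rewrite leqn0 => /eqP ->.
rewrite leq_eqVlt => /orP[/eqP -> //|lt_ij] lt_jn hc.
have [p stj] := st j lt_jn.
by apply: step_in_cells stj _; apply: IH => //; lia.
Qed.

Lemma chain_part r n C i : chain r n C -> i <= n -> is_part (C i).
Proof.
move=> [C0 st]; case: i => [_|i lt_i]; first by rewrite C0 delta_part.
by have [p [_ ]] := st i lt_i.
Qed.

(** The hypothesis on all partitions expresses that [c] is weakly above and to the left of [c']; one
    lemma thus serves rows, columns and, with [c = c'], disjointness. *)
Lemma chain_cell_order r n C i j a b c c' : chain r n C -> i < n -> j < n ->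
  c \in dcells (chain_dom C i, a) -> c' \in dcells (chain_dom C j, b) ->
  (forall lam, is_part lam -> in_cells lam c' -> in_cells lam c) -> i <= j.
Proof.
move=> ch lt_i lt_j; rewrite (chain_dcells _ _ ch lt_i) (chain_dcells _ _ ch lt_j).
move=> /andP[_ Nc] /andP[c'j _] le_cc'; rewrite leqNgt; apply/negP => lt_ji.
case/negP: Nc; apply: (chain_mono ch lt_ji (ltnW lt_i)).
by apply: le_cc' c'j; apply: chain_part ch lt_j.
Qed.

Lemma in_cells_left lam k l : 0 < l -> in_cells lam (k, l.+1) -> in_cells lam (k, l).
Proof. by rewrite /in_cells /=; lia. Qed.

Lemma in_cells_up lam k l : is_part lam -> 0 < k -> in_cells lam (k.+1, l) -> in_cells lam (k, l).
Proof.
rewrite /in_cells /= => pl k0; have := part_nth_le pl (leq_pred k); lia.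
Qed.

Lemma chain_dcells_gt0 r n C i a c : chain r n C -> i < n ->
  c \in dcells (chain_dom C i, a) -> 0 < c.1 /\ 0 < c.2.
Proof.
by move=> ch lt_i; rewrite (chain_dcells _ _ ch lt_i) /in_cells => /andP[/andP[/andP[-> ->]]].
Qed.

Lemma chain_dom_inj r n C i j : chain r n C -> i < n -> j < n ->
  chain_dom C i = chain_dom C j -> i = j.
Proof.
move=> ch lt_i lt_j e; pose c := (chain_dom C i).1.
have ci : c \in dcells (chain_dom C i, 0).
  by rewrite /dcells /c /=; case: (chain_dom C i).1 => k l; rewrite mem_head.
have cj : c \in dcells (chain_dom C j, 0) by rewrite -e.
apply/eqP; rewrite eqn_leq (chain_cell_order ch lt_i lt_j ci cj) //.
by rewrite (chain_cell_order ch lt_j lt_i cj ci).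
Qed.

Lemma lcol_le_rcol d : lcol d <= rcol d.
Proof. exact: leq_addr. Qed.

(** Sortedness squeezes all labels between two equal ones, so the ascents of consecutive dominoes
    can be chained. *)
Lemma labelling_block C n s i j : labelling C n s -> i < j -> j < n ->
  nth 0%N s i = nth 0%N s j -> rcol (chain_dom C i) < lcol (chain_dom C j).
Proof.
move=> [sz srt _ asc]; have s_le k l : k <= l -> l < n -> nth 0%N s k <= nth 0%N s l.
  by rewrite -sz; apply: sorted_nth_le.
elim: j => // j IH; rewrite ltnS leq_eqVlt => /orP[/eqP -> //|ij] lt_j e; first exact: asc.
have e1 : nth 0%N s i = nth 0%N s j.
  by have := s_le i j; have := s_le j j.+1; lia.
apply: leq_trans (IH ij (ltnW lt_j) e1) _.
by have := asc j lt_j; have := lcol_le_rcol (chain_dom C j); rewrite -e -e1; lia.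
Qed.

Lemma chain_in_skew r n C c : chain r n C ->
  in_skew (C n) (delta r) c <-> exists2 k, k < n & c \in dcells (chain_dom C k, 0).
Proof.
move=> ch; have [C0 st] := ch; rewrite /in_skew -C0; split=> [/andP[]|[k lt_k]].
  suff ex m : m <= n -> in_cells (C m) c -> ~~ in_cells (C 0) c ->
      exists2 k, k < n & c \in dcells (chain_dom C k, 0) by apply: ex.
  elim: m => [_ -> //|m IH] lt_m cSm Nc0.
  case cm: (in_cells (C m) c); first by apply: IH => //; apply: ltnW.
  by exists m => //; rewrite (chain_dcells _ _ ch lt_m) cSm cm.
rewrite (chain_dcells _ _ ch lt_k) => /andP[ck Nck].
rewrite (chain_mono ch lt_k (leqnn n) ck); apply: contra Nck.
by apply: chain_mono ch _ (ltnW lt_k).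
Qed.

Lemma ssdt_chain_label r n C s : chain r n C -> labelling C n s ->
  ssdt r (C n) (chain_label C s n).
Proof.
move=> ch lab; have [sz srt pos _] := lab.
have s_le k l : k <= l -> l < n -> nth 0%N s k <= nth 0%N s l.
  by rewrite -sz; apply: sorted_nth_le.
split; first exact: chain_part ch (leqnn n).
split.
- by move=> _ /chain_labelP[k lt_k ->]; apply: (allP pos); rewrite mem_nth ?sz.
- move=> c; rewrite (chain_in_skew c ch); split.
    by case=> k lt_k ck; exists (chain_dom C k, nth 0%N s k) => //; apply/chain_labelP; exists k.
  by case=> _ /chain_labelP[k lt_k ->] ck; exists k.
- move=> _ _ /chain_labelP[i lt_i ->] /chain_labelP[j lt_j ->] ne c ci; apply/negP => cj.
  case/eqP: ne; suff -> : i = j by [].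
  apply/eqP; rewrite eqn_leq (chain_cell_order ch lt_i lt_j ci cj) //.
  by rewrite (chain_cell_order ch lt_j lt_i cj ci).
- move=> _ _ /chain_labelP[i lt_i ->] /chain_labelP[j lt_j ->] k l ci cj.
  apply: s_le => //; apply: (chain_cell_order ch lt_i lt_j ci cj) => lam _.
  by apply: in_cells_left; have [] := chain_dcells_gt0 ch lt_i ci.
move=> _ _ /chain_labelP[i lt_i ->] /chain_labelP[j lt_j ->] ne k l ci cj.
have le_ij : i <= j.
  apply: (chain_cell_order ch lt_i lt_j ci cj) => lam pl.
  by apply: in_cells_up => //; have [] := chain_dcells_gt0 ch lt_i ci.
have lt_ij : i < j by rewrite ltn_neqAle le_ij andbT; apply: contraNneq ne => ->.
(* Equal labels would put the two dominoes in disjoint ranges of columns, but both meet column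
   [l]. *)
rewrite ltn_neqAle s_le // andbT; apply/eqP => e.
have := labelling_block lab lt_ij lt_j e.
have := mem_dcells_cols ci; have := mem_dcells_cols cj; rewrite /=; lia.
Qed.

Lemma card_chain_label r n C s P : chain r n C ->
  #|` [fset e in chain_label C s n | P e]%fset| =
  count (fun k => P (chain_dom C k, nth 0%N s k)) (iota 0 n).
Proof.
move=> ch; rewrite -size_filter.
rewrite -(size_map (fun k => (chain_dom C k, nth 0%N s k))).
apply: perm_size; apply: uniq_perm; first exact: fset_uniq.
  rewrite map_inj_in_uniq ?filter_uniq ?iota_uniq // => i j.
  by rewrite !mem_filter !mem_iota => /andP[_ lt_i] /andP[_ lt_j] [/(chain_dom_inj ch lt_i lt_j)].
move=> d; rewrite !inE /=; apply/andP/mapP => [[/chain_labelP[k lt_k ->] Pd]|[k]].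
  by exists k => //; rewrite mem_filter mem_iota lt_k Pd.
rewrite mem_filter mem_iota => /andP[Pk lt_k] ->; split=> //.
by apply/chain_labelP; exists k.
Qed.

Lemma count_iota_lt n k : k <= n -> count (fun i => i < k) (iota 0 n) = k.
Proof.
move=> le_k; rewrite -(subnKC le_k) iotaD count_cat.
rewrite (eq_in_count (a2 := predT)) ?count_predT ?size_iota; last first.
  by move=> i; rewrite mem_iota.
rewrite (eq_in_count (a2 := pred0)) ?count_pred0 ?addn0 //.
by move=> i; rewrite mem_iota /=; lia.
Qed.

Lemma std_label_chain r n C s k : chain r n C -> labelling C n s -> k < n ->
  std_label (chain_label C s n) (chain_dom C k, nth 0%N s k) = k.+1.
Proof.
move=> ch lab lt_k; rewrite /std_label !(card_chain_label _ _ ch) /=; congr _.+1.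
have [sz srt _ _] := lab.
have s_le i l : i <= l -> l < n -> nth 0%N s i <= nth 0%N s l.
  by rewrite -sz; apply: sorted_nth_le.
(* The two counts in [std_label] concern disjoint sets, whose union is the set of dominoes preceding
   [k] in the chain. *)
rewrite -count_predUI [X in _ + X](eq_in_count (a2 := pred0)); last first.
  by move=> i _ /=; lia.
rewrite count_pred0 addn0 -[RHS](count_iota_lt (ltnW lt_k)).
apply: eq_in_count => i; rewrite mem_iota /= => lt_i.
have [ik|ki|->] := ltngtP i k; last by rewrite !ltnn andbF.
  have := s_le i k (ltnW ik) lt_k; rewrite leq_eqVlt => /orP[/eqP e|-> //].
  by rewrite e ltnn eqxx (leq_ltn_trans (lcol_le_rcol _) (labelling_block lab ik lt_k e)).
have := s_le k i (ltnW ki) lt_i; rewrite leq_eqVlt => /orP[/eqP e|]; last lia.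
rewrite e ltnn eqxx /=; apply/negbTE; rewrite -leqNgt ltnW //.
exact: leq_ltn_trans (lcol_le_rcol _) (labelling_block lab ki lt_i e).
Qed.

Lemma std_tab_chain r n C s : chain r n C -> labelling C n s ->
  std_tab (chain_label C s n) = chain_label C (iota 1 n) n.
Proof.
move=> ch lab; apply/fsetP => d; apply/imfsetP/chain_labelP => /=.
  case=> _ /chain_labelP[k lt_k ->] ->; exists k => //.
  by rewrite (std_label_chain ch lab lt_k) nth_iota.
case=> k lt_k ->; exists (chain_dom C k, nth 0%N s k); first by apply/chain_labelP; exists k.
by rewrite (std_label_chain ch lab lt_k) nth_iota.
Qed.

Lemma wt_chain r n C s i : chain r n C -> size s = n -> wt (chain_label C s n) i = count_mem i s.
Proof.
move=> ch sz; rewrite /wt (card_chain_label _ _ ch) /= -sz.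
rewrite -[in RHS](mkseq_nth 0%N s) /mkseq count_map.
by apply: eq_count => k /=.
Qed.

Lemma sp_chain r n C s : chain r n C ->
  sp (chain_label C s n) = ((\sum_(k < n) (chain_dom C k).2 : nat)%:R / 2%:R)%R.
Proof.
move=> ch; rewrite /sp (card_chain_label _ _ ch) /= -sum1_count big_mkcond /=.
have -> : iota 0 n = index_iota 0 n by rewrite /index_iota subn0.
by rewrite big_mkord; congr (_%:R / _)%R; apply: eq_bigr => k _; case: (_.2).
Qed.

Lemma chain_tab_label (ch : seq part) n : size ch = n.+1 ->
  chain_tab ch = chain_label (nth [::] ch) (iota 1 n) n.
Proof.
move=> sz; apply/fsetP => d; rewrite /chain_tab sz; apply/imfsetP/chain_labelP => /=.
  by case=> k; rewrite mem_iota => lt_k ->; exists k => //; rewrite nth_iota.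
by case=> k lt_k ->; exists k; rewrite ?mem_iota // nth_iota.
Qed.

Lemma eq_chain_label C C' s n : (forall k, k <= n -> C k = C' k) ->
  chain_label C s n = chain_label C' s n.
Proof.
move=> e; apply/fsetP => d; apply/chain_labelP/chain_labelP => -[k lt_k ->]; exists k => //.
  by rewrite /chain_dom !e // ltnW.
by rewrite /chain_dom !e // ltnW.
Qed.

Lemma domino_of_inj lam p q mu mu' : step lam p mu -> step lam q mu' ->
  domino_of mu lam = domino_of mu' lam -> mu = mu'.
Proof.
move=> st st' e; have [_ pm _ _ _] := st; have [_ pm' _ _ _] := st'.
apply: part_eq => // i.
have aux p1 p2 m1 m2 : step lam p1 m1 -> step lam p2 m2 -> domino_of m1 lam = domino_of m2 lam ->
    nth 0%N m1 i <= nth 0%N m2 i.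
  move=> s1 s2 eq; have le2 := step_sub i s2.
  have [|lt] := leqP (nth 0%N m1 i) (nth 0%N m2 i); first by [].
  have : in_skew m1 lam (i.+1, nth 0%N m1 i) by rewrite /in_skew /in_cells /=; lia.
  rewrite -(mem_dcells_step 0 _ s1) eq (mem_dcells_step 0 _ s2) /in_skew /in_cells /=; lia.
by apply/eqP; rewrite eqn_leq (aux _ _ _ _ st st' e) (aux _ _ _ _ st' st (esym e)).
Qed.

Lemma chain_label_inj r n C C' : chain r n C -> chain r n C' ->
  chain_label C (iota 1 n) n = chain_label C' (iota 1 n) n -> forall k, k <= n -> C k = C' k.
Proof.
move=> ch ch' e; have [C0 st] := ch; have [C0' st'] := ch'.
elim=> [|k IH] lt_k; first by rewrite C0 C0'.
have : (chain_dom C k, k.+1) \in chain_label C' (iota 1 n) n.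
  by rewrite -e; apply/chain_labelP; exists k => //; rewrite nth_iota.
case/chain_labelP => l lt_l; rewrite nth_iota // => -[ed ek].
have {ek}? : l = k by lia.
subst l; move: ed; rewrite /chain_dom -(IH (ltnW lt_k)).
have [p sk] := st k lt_k; have [q sk'] := st' k lt_k.
by rewrite -(IH (ltnW lt_k)) in sk'; apply: domino_of_inj sk sk'.
Qed.

(** * The 2-core and the set P_r(n) *)

Lemma adjacent_cells c1 c2 : adjacent c1 c2 -> exists k l,
  (c1 = (k, l) /\ (c2 = (k, l.+1) \/ c2 = (k.+1, l))) \/
  (c2 = (k, l) /\ (c1 = (k, l.+1) \/ c1 = (k.+1, l))).
Proof.
case: c1 c2 => [k l] [k' l'] /orP[]/= /andP[/eqP -> /orP[]/eqP <-].
- by exists k', l; left; split=> //; left.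
- by exists k', l'; right; split=> //; left.
- by exists k, l'; left; split=> //; right.
- by exists k', l'; right; split=> //; right.
Qed.

(** [dom_step] speaks of cells, so the argument is made on cells too: if a domino were removed, the
    staircase would force a third cell, below or to the right of the first one, into the
    difference. *)
Lemma delta_no_dom_step r mu : ~ dom_step (delta r) mu.
Proof.
move=> [_ pm _ [c1 [c2 [eS adj]]]].
have inS c : in_skew (delta r) mu c = (c == c1) || (c == c2).
  by rewrite -mem_skew_cells eS !inE.
have [i1 i2] : in_skew (delta r) mu c1 /\ in_skew (delta r) mu c2.
  by rewrite !inS !eqxx orbT.
have no a b : in_skew (delta r) mu a -> in_skew (delta r) mu b ->
    (forall c, in_skew (delta r) mu c -> c = a \/ c = b) -> forall k l, a = (k, l) ->
    b = (k, l.+1) \/ b = (k.+1, l) -> False.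
  move=> ia ib only k l ea eb; subst a; have := ia; rewrite /in_skew /in_cells /= delta_nth => ha.
  have mk := part_nth_le pm (leq_pred k).
  case: eb => eb; subst b; have := ib; rewrite /in_skew /in_cells /= !delta_nth => hb.
    have : in_skew (delta r) mu (k.+1, l) by rewrite /in_skew /in_cells /= delta_nth; lia.
    by case/only => -[]; lia.
  have : in_skew (delta r) mu (k, l.+1) by rewrite /in_skew /in_cells /= delta_nth; lia.
  by case/only => -[]; lia.
have [k [l [[e1 e2]|[e1 e2]]]] := adjacent_cells adj.
  by apply: no i1 i2 _ _ _ e1 e2 => c; rewrite inS => /orP[]/eqP; [left | right].
by apply: no i2 i1 _ _ _ e1 e2 => c; rewrite inS => /orP[]/eqP; [right | left].
Qed.

Lemma step_dom_step lam p mu : step lam p mu -> dom_step mu lam.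
Proof.
move=> st; have [pl pm _ _ _] := st; split=> // [i|]; first exact: step_sub st.
have [i [[_ [_ s]]|[_ [_ s]]]] := stepP st.
  rewrite (skew_cells_H s); do 2!eexists; split; first by [].
  by rewrite /adjacent /= !eqxx.
rewrite (skew_cells_V s); do 2!eexists; split; first by [].
by rewrite /adjacent /= !eqxx orbT.
Qed.

Lemma in_Pr_chain r n C : chain r n C -> in_Pr r n (C n).
Proof.
move=> ch; have [C0 st] := ch; split; first exact: chain_part ch (leqnn n).
  split; last by case=> mu /delta_no_dom_step.
  elim: n {ch} st => [_|n IH st]; first by rewrite C0; constructor.
  have [p stn] := st n (ltnSn n); apply: rem_step (step_dom_step stn) _.
  by apply: IH => i lt_i; apply: st; lia.
elim: n {ch} st => [_|n IH st]; first by rewrite C0 muln0 addn0.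
have [p stn] := st n (ltnSn n); rewrite (step_size stn) IH; first lia.
by move=> i lt_i; apply: st; lia.
Qed.

(** * From semistandard tableaux to labelled chains *)

Lemma rem_star_sub lam kap i : rem_star lam kap -> nth 0%N kap i <= nth 0%N lam i.
Proof. by elim=> // l m k [_ _ le _] _ /leq_trans ->. Qed.

Lemma exists_max (T : eqType) (s : seq T) (P : pred T) (f : T -> nat) : has P s ->
  exists2 d, d \in s & P d /\ forall e, e \in s -> P e -> f e <= f d.
Proof.
elim: s => //= x s IH; case hs: (has P s).
  have [d ds [Pd max_d]] := IH hs => _.
  have [/andP[Px lt]|nPx] := boolP (P x && (f d < f x)).
    exists x; rewrite ?mem_head //; split=> // e; rewrite inE => /orP[/eqP -> //|es Pe].
    by have := max_d e es Pe; lia.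
  exists d; rewrite ?inE ?ds ?orbT //; split=> // e; rewrite inE => /orP[/eqP ->|]; last exact: max_d.
  by move=> Px; move: nPx; rewrite Px /=; lia.
rewrite orbF => Px; exists x; rewrite ?mem_head //; split=> // e; rewrite inE => /orP[/eqP -> //|es Pe].
by move: hs => /hasP[]; exists e.
Qed.

Lemma lcol_cell (d : ldom) : exists k, (k, lcol d.1) \in dcells d.
Proof. by case: d => [[[k l] v] a]; exists k; rewrite /dcells /lcol mem_head. Qed.

Lemma rcol_cell (d : ldom) : exists k, (k, rcol d.1) \in dcells d.
Proof.
case: d => [[[k l] []] a]; exists k; rewrite /dcells /rcol !inE /= ?addn0 ?addn1 eqxx ?orbT //.
Qed.


(** Columns of the skew shape have no gaps, so the condition on vertically adjacent cells propagates
    down a column. *)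
Lemma ssdt_column r lam T k l m d e : ssdt r lam T -> d \in T -> e \in T ->
  (k, l) \in dcells d -> (k + m, l) \in dcells e -> d.2 <= e.2 /\ (d.2 = e.2 -> d = e).
Proof.
move=> [pl [_ cells disj _ col]] dT eT dc; elim: m e eT => [|m IH] e eT.
  rewrite addn0 => ec; have [->|ne] := eqVneq d e; first by [].
  by have := disj d e dT eT ne _ dc; rewrite ec.
rewrite addnS => ec.
have skd : in_skew lam (delta r) (k, l) by apply/cells; exists d.
have ske : in_skew lam (delta r) ((k + m).+1, l) by apply/cells; exists e.
have /cells[f fT fc] : in_skew lam (delta r) (k + m, l).
  move: skd ske; rewrite /in_skew /in_cells /=.
  have := part_nth_le pl (leq_pred (k + m)).
  have km : k.-1 <= (k + m).-1 by lia.
  by have := part_nth_le (delta_part r) km; lia.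
have [le_df eq_df] := IH f fT fc.
have [efe|nfe] := eqVneq f e; first by subst f.
by have := col f e fT eT nfe _ _ fc ec; lia.
Qed.

(** By [ssdt_column] distinct dominoes with equal labels share no column, and a domino meets at most
    two columns. This makes the left-to-right order of standardisation strict. *)
Lemma ssdt_same_label r lam T d e : ssdt r lam T -> d \in T -> e \in T -> d != e ->
  d.2 = e.2 -> lcol d.1 <= lcol e.1 -> rcol d.1 < lcol e.1.
Proof.
move=> tT dT eT ne eq_l le_c; rewrite ltnNge; apply/negP => ge_c.
have noc l k k' : (k, l) \in dcells d -> (k', l) \in dcells e -> False.
  move=> dc ec; have [le|/ltnW le] := leqP k k'.
    have := ssdt_column tT dT eT dc (m := k' - k) (e := e); rewrite subnKC // => /(_ ec)[_ /(_ eq_l) h].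
    by rewrite h eqxx in ne.
  have := ssdt_column tT eT dT ec (m := k - k') (e := d); rewrite subnKC // => /(_ dc)[_ /(_ (esym eq_l)) h].
  by rewrite h eqxx in ne.
have [k dl] := lcol_cell d; have [k' dr] := rcol_cell d; have [k2 el] := lcol_cell e.
have : lcol e.1 = lcol d.1 \/ lcol e.1 = rcol d.1.
  by move: ge_c le_c; rewrite /rcol /lcol; case: (d.1.2) => /=; lia.
by case=> h; rewrite h in el; [apply: noc dl el | apply: noc dr el].
Qed.

(** [d] is the last domino of the standardisation; it is removable because nothing lies directly
    below it or to its right. *)
Lemma ssdt_remove_max r lam T d : ssdt r lam T -> d \in T ->
  (forall e, e \in T -> e.2 <= d.2) ->
  (forall e, e \in T -> e.2 = d.2 -> lcol e.1 <= lcol d.1) ->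
  exists lam' p, step lam' p lam /\ domino_of lam lam' = d.1.
Proof.
move=> tT dT max_lab max_col; have [pl [_ cells disj rows cols]] := tT.
have in_sk c : c \in dcells d -> in_skew lam (delta r) c by move=> cd; apply/cells; exists d.
(* A domino to the right of [d] would also carry the maximal label; starting no further right than
   [d], it would end strictly left of [d]. *)
have noR (k l : nat) : (k, l) \in dcells d -> (k, l.+1) \notin dcells d -> lcol d.1 <= l ->
    l.+1 = (rcol d.1).+1 -> ~~ in_cells lam (k, l.+1).
  move=> cd Ncd le_l el; apply/negP => cl.
  have /cells[e eT ec] : in_skew lam (delta r) (k, l.+1).
    by move: (in_sk _ cd) cl; rewrite /in_skew /in_cells /=; lia.
  have le := rows d e dT eT k l cd ec; have ge := max_lab e eT.
  have ned : e != d by apply: contraNneq Ncd => <-.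
  have elab : e.2 = d.2 by lia.
  have := ssdt_same_label tT eT dT ned elab (max_col e eT elab).
  have /andP[_ le_e] : lcol e.1 <= l.+1 <= rcol e.1.
    by apply: (@mem_dcells_cols e.1 e.2 (k, l.+1)); rewrite -surjective_pairing.
  by rewrite ltnNge (leq_trans (leqW le_l) le_e).
(* A domino below [d] would carry a label above the maximum. *)
have noD (k l : nat) : (k, l) \in dcells d -> (k.+1, l) \notin dcells d -> ~~ in_cells lam (k.+1, l).
  move=> cd Ncd; apply/negP => cl.
  have /cells[e eT ec] : in_skew lam (delta r) (k.+1, l).
    move: (in_sk _ cd) cl; rewrite /in_skew /in_cells /=.
    by have := part_nth_le (delta_part r) (leq_pred k); lia.
  have ned : d != e by apply: contraNneq Ncd => ->.
  by have := cols d e dT eT ned k l cd ec; have := max_lab e eT; lia.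
case: d dT max_lab max_col in_sk noR noD => [[[k l] v] a] dT _ _.
rewrite /dcells /lcol /rcol /= => in_sk noR noD.
have := in_sk (k, l) (mem_head _ _); rewrite /in_skew /in_cells /= => /andP[/andP[/andP[k0 l0] _] _].
case: v in_sk noR noD {dT} => in_sk noR noD.
  have := in_sk (k.+1, l); rewrite !inE eqxx orbT => /(_ isT); rewrite /in_skew /in_cells /=.
  have := noR k l; rewrite !inE !xpair_eqE !eqxx /= addn0 (gtn_eqF (ltnSn l)) andbF.
  move=> /(_ isT isT (leqnn l) erefl).
  have := noD k.+1 l; rewrite !inE !xpair_eqE !eqxx /= orbT !(gtn_eqF (ltnSn _)) orbF.
  rewrite (gtn_eqF (_ : k < k.+2)) // => /(_ isT isT); rewrite /in_cells /= => h1 h2 h3.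
  have le := part_nth_le pl (leq_pred k).
  have [||lam' st] := @unstepV_exists lam k.-1 pl; rewrite ?prednK //; try lia.
  exists lam', (posV lam' k.-1); split; first exact: stepV_step.
  have [_ _ _ [e _] _] := st.
  by rewrite (domino_of_V st) prednK // -e; congr (_, _, _); lia.
have := in_sk (k, l.+1); rewrite !inE eqxx orbT => /(_ isT); rewrite /in_skew /in_cells /=.
have := noR k l.+1; rewrite !inE !xpair_eqE !eqxx /= orbT addn1.
rewrite (gtn_eqF (ltnSn _)) (gtn_eqF (_ : l < l.+2)) // => /(_ isT isT (leqnSn l) erefl).
have := noD k l; rewrite !inE !xpair_eqE !eqxx /= (gtn_eqF (ltnSn _)).
move=> /(_ isT isT); rewrite /in_cells /= => h1 h2 h3.
have [|lam' st] := @unstepH_exists lam k.-1 pl; rewrite ?prednK //; try lia.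
exists lam', (posH lam' k.-1); split; first exact: stepH_step.
have [_ _ e _] := st.
by rewrite (domino_of_H st) prednK //; congr (_, _, _); lia.
Qed.

Lemma ssdt_remove r lam lam' p T d : ssdt r lam T -> d \in T -> step lam' p lam ->
  domino_of lam lam' = d.1 -> ssdt r lam' (T `\ d)%fset.
Proof.
move=> [_ [pos cells disj rows cols]] dT st ed.
have dP c : (c \in dcells d) = in_skew lam lam' c.
  by rewrite -(mem_dcells_step d.2 _ st) ed -surjective_pairing.
have inT e : e \in (T `\ d)%fset -> e \in T /\ e != d by rewrite !inE => /andP[].
split; first by case: st.
split=> [e /inT[eT _]|c|e f /inT[eT _] /inT[fT _]|e f /inT[eT _] /inT[fT _]|e f /inT[eT _] /inT[fT _]].
- exact: pos.
- split=> [|[e /inT[eT ned] ce]].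
    rewrite /in_skew => /andP[c' Nc]; have cl := step_in_cells st c'.
    have /cells[e eT ce] : in_skew lam (delta r) c by rewrite /in_skew cl.
    exists e => //; rewrite !inE eT andbT; apply: contraTneq ce => ->.
    by rewrite dP /in_skew c' andbF.
  have : in_skew lam (delta r) c by apply/cells; exists e.
  rewrite /in_skew => /andP[cl ->]; rewrite andbT.
  have := disj e d eT dT ned c ce; rewrite dP /in_skew cl /=.
  by rewrite negbK.
- exact: disj.
- exact: rows.
- exact: cols.
Qed.

(** Containment of [delta r] is a separate hypothesis because [ssdt] describes the cells of [lam]
    outside [delta r] only; it comes from the 2-core via [rem_star_sub]. *)
Lemma ssdt_chain r lam T : ssdt r lam T -> (forall i, nth 0%N (delta r) i <= nth 0%N lam i) ->
  exists C s, [/\ chain r #|` T| C, C #|` T| = lam, labelling C #|` T| s &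
                  T = chain_label C s #|` T|].
Proof.
move: {2}#|` T| (erefl #|` T|) => m; elim: m lam T => [|m IH] lam T cT tT sub.
  have T0 : T = fset0 by apply: cardfs0_eq.
  exists (fun _ => delta r), [::]; rewrite cT; split=> //.
    have [pl [_ cells _ _ _]] := tT; apply: part_eq => // [|i]; first exact: delta_part.
    apply/eqP; rewrite eqn_leq sub leqNgt; apply/negP => lt.
    have /cells[d] : in_skew lam (delta r) (i.+1, nth 0%N lam i) by rewrite /in_skew /in_cells /=; lia.
    by rewrite T0 inE.
  apply/fsetP => d; rewrite T0 in_fset0; apply/esym/chain_labelP => -[] //.
have hasT : has predT (enum_fset T) by rewrite has_predT -/(#|` T|) cT.
have [d1 d1T [_ max1]] := exists_max (fun d : ldom => d.2) hasT.
have hasT2 : has (fun d : ldom => d.2 == d1.2) (enum_fset T) by apply/hasP; exists d1.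
have [d dT [/eqP d12 max2]] := exists_max (fun d : ldom => lcol d.1) hasT2.
have max_lab e : e \in T -> e.2 <= d.2 by move=> eT; rewrite d12; apply: max1.
have max_col e : e \in T -> e.2 = d.2 -> lcol e.1 <= lcol d.1.
  by move=> eT e2; apply: max2; rewrite ?e2 ?d12.
have [lam' [p [st ed]]] := ssdt_remove_max tT dT max_lab max_col.
have tT' := ssdt_remove tT dT st ed.
have cT' : #|` (T `\ d)%fset| = m by have := cardfsD1 d T; rewrite dT cT; lia.
(* Containment survives the removal, since the removed cells lie outside [delta r]. *)
have [i|C [s [ch Cm lab eT]]] := IH lam' (T `\ d)%fset cT' tT'.
  have [//|lt] := leqP (nth 0%N (delta r) i) (nth 0%N lam' i).
  have : in_skew lam lam' (i.+1, nth 0%N (delta r) i).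
    by rewrite /in_skew /in_cells /= sub; lia.
  rewrite -(mem_dcells_step d.2 _ st) ed -surjective_pairing => cd.
  have [_ [_ cells _ _ _]] := tT.
  have : in_skew lam (delta r) (i.+1, nth 0%N (delta r) i) by apply/cells; exists d.
  by rewrite /in_skew /in_cells /=; lia.
rewrite cT' in ch Cm lab eT; have [C0 sts] := ch; have [sz srt pos asc] := lab.
pose C' k := if k == m.+1 then lam else C k; pose s' := rcons s d.2.
have C'E k : k <= m -> C' k = C k by move=> le; rewrite /C' ltn_eqF.
have C'm : C' m.+1 = lam by rewrite /C' eqxx.
have domE k : k < m -> chain_dom C' k = chain_dom C k.
  by move=> lt; rewrite /chain_dom !C'E // ltnW.
have domm : chain_dom C' m = d.1 by rewrite /chain_dom C'm C'E // Cm.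
have s'E k : k < m -> nth 0%N s' k = nth 0%N s k by move=> lt; rewrite nth_rcons sz lt.
have s'm : nth 0%N s' m = d.2 by rewrite nth_rcons sz ltnn eqxx.
have inT' k : k < m -> (chain_dom C k, nth 0%N s k) \in (T `\ d)%fset.
  by move=> lt; rewrite eT; apply/chain_labelP; exists k.
have inT k : k < m -> (chain_dom C k, nth 0%N s k) \in T.
  by move=> /inT'; rewrite inE => /andP[].
exists C', s'; rewrite cT; split=> //.
- split=> [|k]; first by rewrite C'E.
  rewrite ltnS leq_eqVlt => /orP[/eqP ->|lt_k]; last by rewrite !C'E //; [apply: sts | apply: ltnW].
  by exists p; rewrite C'm C'E // Cm.
- split.
  + by rewrite size_rcons sz.
  + apply/(sortedP 0%N) => k; rewrite size_rcons sz ltnS => le_k; rewrite s'E //.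
    move: le_k; rewrite leq_eqVlt => /orP[/eqP ek|lt_k].
      by rewrite ek s'm; apply: (max_lab (_, _) (inT k _)); rewrite -ek.
    by rewrite s'E //; apply: (elimT (sortedP 0%N) srt); rewrite sz.
  + rewrite all_rcons pos andbT.
    by have [_ [posT _ _ _ _]] := tT; apply: posT.
  + move=> k; rewrite ltnS leq_eqVlt => /orP[/eqP ek|lt_k].
      have lt_k : k < m by rewrite -ek.
      rewrite ek s'E // s'm domm domE // => es.
      have kT := inT' k lt_k; have kT2 := inT k lt_k.
      have ned : (chain_dom C k, nth 0%N s k) != d by move: kT; rewrite inE => /andP[]; rewrite inE.
      exact: (ssdt_same_label tT kT2 dT ned es (max_col _ kT2 es)).
    rewrite !s'E ?domE //; try exact: ltnW.
    exact: asc.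
apply/fsetP => e; rewrite -(fsetD1K dT) in_fset1U eT.
apply/orP/chain_labelP => [[/eqP ->|/chain_labelP[k lt_k ->]]|[k]].
- by exists m => //; rewrite domm s'm -surjective_pairing.
- by exists k; rewrite ?domE ?s'E // ltnW.
rewrite ltnS leq_eqVlt => /orP[/eqP ->|lt_k] ->.
  by left; rewrite domm s'm -surjective_pairing.
by right; apply/chain_labelP; exists k; rewrite // domE // s'E.
Qed.

(** * Biwords *)

(** [canon_le] is total only on positive lower letters: 0 and barred 0 have the same [lneg]. *)
Definition pos_biletter (b : biletter) : bool := (0 < b.1.1) && (0 < b.2.1).

Lemma canon_lt_trans : transitive canon_lt.
Proof.
move=> [[k kb] [l lb]] [[x xb] [y yb]] [[u ub] [v vb]].
rewrite /canon_lt /lneg /= !xpair_eqE.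
by case: kb; case: xb; case: ub; rewrite /= ?andbF ?andbT ?orbF;
   (try (case: lb; case: yb; case: vb)); rewrite /=; lia.
Qed.

Lemma canon_lt_irr b : canon_lt b b = false.
Proof.
by case: b => [[x xb] [y yb]]; rewrite /canon_lt !ltxx ltnn !eqxx /=; case: xb.
Qed.

Lemma canon_le_trans : transitive canon_le.
Proof.
rewrite /canon_le => b a c /orP[/eqP -> //|ab] /orP[/eqP <-|bc]; first by rewrite ab orbT.
by rewrite (canon_lt_trans ab bc) orbT.
Qed.

Lemma canon_le_anti : antisymmetric canon_le.
Proof.
move=> a b; rewrite /canon_le => /andP[/orP[/eqP //|ab] /orP[/eqP //|ba]].
by have := canon_lt_trans ab ba; rewrite canon_lt_irr.
Qed.

Lemma lneg_inj (y z : letter) : 0 < y.1 -> 0 < z.1 -> lneg y = lneg z -> y = z.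
Proof.
case: y z => [y []] [z []]; rewrite /lneg /= => y0 z0 e; congr pair; lia.
Qed.

Lemma canon_le_total a b : pos_biletter a -> pos_biletter b -> canon_le a b || canon_le b a.
Proof.
case: a b => [[x xb] y] [[k kb] l] /andP[/= _ y0] /andP[/= _ l0].
rewrite /canon_le /canon_lt /= !xpair_eqE.
have [xk|xk|_] := ltngtP x k; rewrite ?orbT //.
have := @lneg_inj y l y0 l0; case: (ltgtP (lneg y) (lneg l)) => [_ _|_ _|e /(_ e) ->];
  by case: xb; case: kb; rewrite /= ?eqxx ?orbT.
Qed.

Lemma sort_canon_eq u v : perm_eq u v -> all pos_biletter u -> sorted canon_le v ->
  sort canon_le u = v.
Proof.
move=> uv pu sv; apply: (sorted_eq canon_le_trans canon_le_anti) => //.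
  apply: (sort_sorted_in (P := pos_biletter)) pu => a b pa pb; exact: canon_le_total.
by rewrite perm_sort.
Qed.

(** The inverse of the permutation underlying [pi], zero-based. *)
Definition place (pi : seq letter) (k : nat) : nat := index k.+1 [seq y.1 | y <- pi].

Lemma place_lt n pi k : signed_perm n pi -> k < n -> place pi k < n.
Proof.
move=> [sz pe] lt_k; rewrite -[X in _ < X]sz -(size_map fst pi) index_mem (perm_mem pe) mem_iota.
lia.
Qed.

Lemma nth_place n pi k : signed_perm n pi -> k < n ->
  nth (0, false) pi (place pi k) = (k.+1, (nth (0, false) pi (place pi k)).2).
Proof.
move=> sp lt_k; have [sz pe] := sp; have lt := place_lt sp lt_k.
rewrite [LHS]surjective_pairing -(nth_map (0, false) 0 fst) ?sz // nth_index //.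
by rewrite (perm_mem pe) mem_iota; lia.
Qed.

Lemma place_perm n pi : signed_perm n pi -> perm_eq [seq place pi k | k <- iota 0 n] (iota 0 n).
Proof.
move=> sp; have inj : {in iota 0 n &, injective (place pi)}.
  move=> k l; rewrite !mem_iota => lt_k lt_l e.
  by have := nth_place sp lt_k; rewrite e (nth_place sp lt_l) => -[].
apply: uniq_perm; rewrite ?map_inj_in_uniq ?iota_uniq // => i.
have sub : {subset [seq place pi k | k <- iota 0 n] <= iota 0 n}.
  by move=> _ /mapP[k + ->]; rewrite !mem_iota => lt_k; have := place_lt sp lt_k; lia.
have un : uniq [seq place pi k | k <- iota 0 n] by rewrite map_inj_in_uniq ?iota_uniq.
have [|_ ->//] := uniq_min_size un sub.
by rewrite size_map.
Qed.

Lemma map_place n pi (T : eqType) (F : nat -> T) : signed_perm n pi ->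
  perm_eq [seq F (place pi k) | k <- iota 0 n] [seq F i | i <- iota 0 n].
Proof.
move=> sp; have := perm_map F (place_perm sp).
by rewrite -map_comp.
Qed.

Lemma ost_nth b0 w : ost w = [seq ((i.+1, (nth b0 w i).1.2), (nth b0 w i).2) | i <- iota 0 (size w)].
Proof.
apply: (eq_from_nth (x0 := b0)); first by rewrite !size_map size_zip size_iota minnn.
move=> i; rewrite size_map size_zip size_iota minnn => lt_i.
rewrite (nth_map (0, b0)) ?size_zip ?size_iota ?minnn // nth_zip ?size_iota //=.
by rewrite (nth_map 0) ?size_iota // nth_iota.
Qed.

(** The halfway stage of [bst], after its first [binv], for a biword standardising to [pi] with
    sorted lower values [s]. *)
Definition inverse_biword (n : nat) (s : seq nat) (pi : seq letter) : biword :=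
  [seq ((nth 0 s k, (nth (0, false) pi (place pi k)).2), ((place pi k).+1, false)) | k <- iota 0 n].

(** The second [ost] overwrites [s] by 1, 2, ..., so the halfway stage determines the result, and
    the last sort only reorders distinct top letters. *)
Lemma bst_bottom n s pi w : signed_perm n pi -> binv (ost w) = inverse_biword n s pi ->
  bottom (bst w) = pi.
Proof.
move=> sp e; have [sz _] := sp; rewrite /bst e.
pose F i : biletter := ((i.+1, false), nth (0, false) pi i).
have -> : binv (ost (inverse_biword n s pi)) = [seq F i | i <- iota 0 n].
  rewrite /binv (ost_nth ((0, false), (0, false))) size_map size_iota -map_comp.
  rewrite [X in sort _ X](_ : _ = [seq F (place pi k) | k <- iota 0 n]); last first.
    apply/eq_in_map => k; rewrite mem_iota => lt_k.
    by rewrite /= /inverse_biword (nth_map 0) ?size_iota // nth_iota //= /F [in RHS](nth_place sp).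
  apply: sort_canon_eq; first exact: map_place.
    apply/allP => _ /mapP[k + ->]; rewrite mem_iota => lt_k.
    by rewrite /pos_biletter /F /= (nth_place sp).
  apply/(sortedP ((0, false), (0, false))) => i; rewrite size_map size_iota => lt_i.
  rewrite !(nth_map 0) ?size_iota ?(ltnW lt_i) // !nth_iota ?(ltnW lt_i) // /F /canon_le /canon_lt /=.
  by rewrite !add0n ltnSn orbT.
rewrite /bottom -map_comp -[RHS](mkseq_nth (0, false)) sz; apply: eq_map => i //.
Qed.

(** Inverse of standardisation: a letter of absolute value [k.+1] becomes the [k]-th entry of the
    sorted lower row [s], keeping its bar. *)
Definition biword_of (n : nat) (t s : seq nat) (pi : seq letter) : biword :=
  [seq ((nth 0 t i, false), (nth 0 s (nth (0, false) pi i).1.-1, (nth (0, false) pi i).2))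
     | i <- iota 0 n].

(* (i.+1, b) and (i'.+1, b') are consecutive letters of the inverse of pi. *)
Definition inverse_asc (s : seq nat) (pi : seq letter) : Prop :=
  forall k i i' b b', k.+1 < size s -> nth 0 s k = nth 0 s k.+1 ->
    entry pi i k = Some b -> entry pi i' k.+1 = Some b' -> (lneg (i.+1, b) < lneg (i'.+1, b'))%R.

Lemma entry_place n pi k : signed_perm n pi -> k < n ->
  entry pi (place pi k) k = Some (nth (0, false) pi (place pi k)).2.
Proof. by move=> sp lt_k; apply/entryP; apply: nth_place sp lt_k. Qed.

(** Among biletters with equal top integer, the canonical order lists barred ones first, by
    decreasing position, then unbarred ones by increasing position. This is the order of signed
    positions used in [inverse_asc]. *)
Lemma bst_biword_of n t s pi : signed_perm n pi -> size s = n -> sorted leq s ->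
  all (fun x => 0 < x) s -> inverse_asc s pi -> bottom (bst (biword_of n t s pi)) = pi.
Proof.
move=> sp sz srt pos asc; apply: (bst_bottom (s := s) sp).
pose F i : biletter :=
  ((nth 0 s (nth (0, false) pi i).1.-1, (nth (0, false) pi i).2), (i.+1, false)).
have -> : inverse_biword n s pi = [seq F (place pi k) | k <- iota 0 n].
  by apply/eq_in_map => k; rewrite mem_iota => lt_k; rewrite /F (nth_place sp).
rewrite /binv (ost_nth ((0, false), (0, false))) size_map size_iota -map_comp.
rewrite [X in sort _ X](_ : _ = [seq F k | k <- iota 0 n]); last first.
  by apply/eq_in_map => k; rewrite mem_iota => lt_k; rewrite /= /biword_of (nth_map 0) ?size_iota // nth_iota.
apply: sort_canon_eq; first by rewrite perm_sym map_place.
  rewrite -(perm_all _ (map_place F sp)).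
  apply/allP => _ /mapP[k + ->]; rewrite mem_iota => lt_k.
  rewrite /pos_biletter /F /= (nth_place sp) //= andbT.
  by apply: (allP pos); rewrite mem_nth ?sz.
apply/(sortedP ((0, false), (0, false))) => k; rewrite size_map size_iota => lt_k.
rewrite !(nth_map 0) ?size_iota ?(ltnW lt_k) // !nth_iota ?(ltnW lt_k) // !add0n /F.
have := nth_place sp (ltnW lt_k); have := entry_place sp (ltnW lt_k).
case: (nth _ pi (place pi k)) => [y1 b1] /= en1 [->].
have := nth_place sp lt_k; have := entry_place sp lt_k.
case: (nth _ pi (place pi k.+1)) => [y2 b2] /= en2 [->] /=.
have := elimT (sortedP 0) srt k; rewrite sz => /(_ lt_k); rewrite leq_eqVlt => /orP[/eqP e|lt].
  have := asc k _ _ _ _ _ e en1 en2.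
  rewrite sz => /(_ lt_k); rewrite /canon_le /canon_lt /lneg /= e !xpair_eqE !eqxx ltnn.
  by case: b1 {en1}; case: b2 {en2} => //=; lia.
by rewrite /canon_le /canon_lt /= lt orbT.
Qed.

Lemma canon_le_top a b : canon_le a b -> a.1.1 <= b.1.1.
Proof.
case: a b => [[x xb] y] [[k kb] l] /orP[/eqP[-> //]|] /=.
by rewrite !xpair_eqE => /or4P[/ltnW|/andP[/eqP ->]|/andP[/andP[/eqP ->]]|/andP[/andP[/eqP ->]]].
Qed.

Lemma biword_of_exists n w : size w = n -> all pos_biletter w -> all (fun b => ~~ b.1.2) w ->
  exists pi, let s := sort leq [seq b.2.1 | b <- w] in
    [/\ signed_perm n pi, w = biword_of n [seq b.1.1 | b <- w] s pi & inverse_asc s pi].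
Proof.
move=> sz pw unb; pose b0 : biletter := ((0, false), (0, false)).
pose F i : biletter := ((nth b0 w i).2, (i.+1, false)).
pose L := [seq F i | i <- iota 0 n]; pose v := sort canon_le L.
(* The positions of [w] in the order of the sorted inverse biletters; the rank of a position in [sg]
   is the absolute value of the standardised letter there. *)
pose sg := [seq c.2.1.-1 | c <- v].
have sg_perm : perm_eq sg (iota 0 n).
  have : perm_eq sg [seq c.2.1.-1 | c <- L] by apply: perm_map; rewrite perm_sort.
  by rewrite -[in X in perm_eq _ X -> _]map_comp map_id_in.
have sg_size : size sg = n by rewrite (perm_size sg_perm) size_iota.
have sg_uniq : uniq sg by rewrite (perm_uniq sg_perm) iota_uniq.
have vE : v = [seq F i | i <- sg].
  rewrite -map_comp -[LHS]map_id; apply/eq_in_map => c; rewrite mem_sort => /mapP[i _ ->] //.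
have v_sorted : sorted canon_le v.
  apply: (sort_sorted_in (P := pos_biletter)) => [a b|]; first exact: canon_le_total.
  apply/allP => _ /mapP[i + ->]; rewrite mem_iota => lt_i.
  have : nth b0 w i \in w by rewrite mem_nth ?sz.
  by move/(allP pw) => /andP[_ h]; rewrite /pos_biletter h.
have vL : perm_eq v L by rewrite perm_sort.
clearbody sg v; set s := sort leq _.
have sE : s = [seq (nth b0 w i).2.1 | i <- sg].
  have -> : [seq (nth b0 w i).2.1 | i <- sg] = [seq c.1.1 | c <- v] by rewrite vE -map_comp.
  apply: (sorted_eq leq_trans anti_leq); first exact: (sort_sorted leq_total).
    by apply: homo_sorted v_sorted => a b; apply: canon_le_top.
  have h : perm_eq [seq c.1.1 | c <- v] [seq c.1.1 | c <- L] by apply: perm_map.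
  rewrite perm_sort perm_sym; apply: perm_trans h _; rewrite -map_comp.
  rewrite (_ : [seq b.2.1 | b <- w] = [seq (nth b0 w i).2.1 | i <- iota 0 n]) //.
  by rewrite -{1}(mkseq_nth b0 w) sz -map_comp.
pose pi : seq letter := [seq ((index i sg).+1, (nth b0 w i).2.2) | i <- iota 0 n].
have pi_nth i : i < n -> nth (0%N, false) pi i = ((index i sg).+1, (nth b0 w i).2.2).
  by move=> lt_i; rewrite (nth_map 0) ?size_iota // nth_iota.
have in_sg i : i < n -> i \in sg by move=> lt_i; rewrite (perm_mem sg_perm) mem_iota.
have sp : signed_perm n pi.
  split; first by rewrite size_map size_iota.
  rewrite -map_comp (iotaDl 1 0) perm_sym; have := perm_map (fun i => (index i sg).+1) sg_perm.
  rewrite perm_sym => h; rewrite perm_sym; apply: perm_trans h _.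
  rewrite (_ : [seq (index i sg).+1 | i <- sg] = [seq 1 + i | i <- iota 0 n]) //.
  apply: (eq_from_nth (x0 := 0)); first by rewrite !size_map size_iota.
  move=> i; rewrite size_map sg_size => lt_i.
  by rewrite !(nth_map 0) ?size_iota ?sg_size // nth_iota // index_uniq ?sg_size.
exists pi; split=> //.
  apply: (eq_from_nth (x0 := b0)); first by rewrite size_map size_iota.
  move=> i; rewrite sz => lt_i; rewrite (nth_map 0) ?size_iota // nth_iota // add0n.
  rewrite pi_nth //= sE (nth_map 0) ?index_mem ?in_sg // nth_index ?in_sg //.
  rewrite (nth_map b0) ?sz //; have : ~~ (nth b0 w i).1.2 by apply: (allP unb); rewrite mem_nth ?sz.
  by case: (nth b0 w i) => [[x []] [y z]].
move=> k i i' b b'; rewrite size_sort size_map sz => lt_k es.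
have lt_n j l c : entry pi j l = Some c -> j < n.
  by move=> /entryP e; rewrite ltnNge; apply/negP => ge; rewrite nth_default ?size_map ?size_iota in e.
move=> ei ei'; have lt_i := lt_n _ _ _ ei; have lt_i' := lt_n _ _ _ ei'.
move/entryP: ei; rewrite pi_nth // => -[ik eb]; move/entryP: ei'; rewrite pi_nth // => -[ik' eb'].
have sgk : nth 0%N sg k = i by rewrite -ik nth_index ?in_sg.
have sgk' : nth 0%N sg k.+1 = i' by rewrite -ik' nth_index ?in_sg.
have : canon_le (F i) (F i').
  have := elimT (sortedP b0) v_sorted k; rewrite vE size_map sg_size => /(_ lt_k).
  by rewrite !(nth_map 0) ?sg_size ?(ltnW lt_k) // sgk sgk'.
move: es; rewrite sE !(nth_map 0) ?sg_size ?(ltnW lt_k) // sgk sgk'.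
have nii : i != i' by apply/eqP => e; move: ik'; rewrite -e ik; lia.
rewrite /F; move: eb eb'; case: (nth b0 w i) => [? [y1 y2]]; case: (nth b0 w i') => [? [z1 z2]] /=.
move=> -> -> e1; rewrite /canon_le /canon_lt /lneg /= e1 !xpair_eqE !eqxx ltnn !eqSS (negPf nii).
by case: b; case: b' => //=; lia.
Qed.

Lemma inverse_asc_block n s pi k l i i' b b' : signed_perm n pi -> size s = n -> sorted leq s ->
  inverse_asc s pi -> k < l -> l < n -> nth 0%N s k = nth 0%N s l ->
  entry pi i k = Some b -> entry pi i' l = Some b' -> (lneg (i.+1, b) < lneg (i'.+1, b'))%R.
Proof.
move=> sp sz srt asc; have s_le k1 k2 : k1 <= k2 -> k2 < n -> nth 0%N s k1 <= nth 0%N s k2.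
  by rewrite -sz; apply: sorted_nth_le.
elim: l i' b' => // l IH i' b'; rewrite ltnS leq_eqVlt => /orP[/eqP <-|kl] lt_l es ei ei'.
  by apply: asc es ei ei'; rewrite sz.
have e1 : nth 0%N s k = nth 0%N s l by have := s_le k l; have := s_le l l.+1; lia.
have el := entry_place sp (ltnW lt_l).
apply: lt_trans (IH _ _ kl (ltnW lt_l) e1 ei el) _.
by apply: asc el ei'; rewrite ?sz // -e1 es.
Qed.

Lemma canon_le_unbarred t u (y z : letter) : 0 < y.1 -> 0 < z.1 ->
  canon_le ((t, false), y) ((u, false), z) = (t < u) || (t == u) && (lneg y <= lneg z)%R.
Proof.
move=> y0 z0; rewrite /canon_le /canon_lt /= !xpair_eqE !andbF !andbT /= orbF.
have [tu|tu|_] := ltngtP t u; rewrite ?orbT //= le_eqVlt.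
congr (_ || _); apply/eqP/eqP => [->//|]; exact: lneg_inj.
Qed.

(** Standardisation turns weak comparison of neighbouring lower letters into strict comparison:
    different values keep their order, and ties are settled by [inverse_asc_block]. *)
Lemma biword_of_step n s pi i : signed_perm n pi -> size s = n -> sorted leq s ->
  all (fun x => 0 < x) s -> inverse_asc s pi -> i.+1 < n ->
  let y j := nth (0%N, false) pi j in
  (lneg (nth 0%N s (y i).1.-1, (y i).2) <= lneg (nth 0%N s (y i.+1).1.-1, (y i.+1).2))%R =
  (lneg (y i) < lneg (y i.+1))%R.
Proof.
move=> sp sz srt pos asc lt_i /=.
have s_le k1 k2 : k1 <= k2 -> k2 < n -> nth 0%N s k1 <= nth 0%N s k2.
  by rewrite -sz; apply: sorted_nth_le.
have s_pos k : k < n -> 0 < nth 0%N s k by move=> lt_k; apply: (allP pos); rewrite mem_nth ?sz.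
have [rowE _ _ colM] := perm_entries_signed sp.
have [j lt_j Mj] := rowE _ (ltnW lt_i); have [j' lt_j' Mj'] := rowE _ lt_i.
case e: (entry pi i j) Mj => [b|] // _; case e': (entry pi i.+1 j') Mj' => [b'|] // _.
have njj : j <> j'.
  by move=> ejj; subst j'; have := colM i i.+1 j; rewrite e e' => /(_ isT isT); lia.
rewrite ((entryP _ _ _ _).1 e) ((entryP _ _ _ _).1 e') /=.
have blk := inverse_asc_block sp sz srt asc.
have sj := s_pos j lt_j; have sj' := s_pos j' lt_j'.
have [lt|lt|ejj] := ltngtP j j'; last by case: njj.
  have le := s_le _ _ (ltnW lt) lt_j'.
  have [es|ne] := eqVneq (nth 0%N s j) (nth 0%N s j').
    by have := blk _ _ _ _ _ _ lt lt_j' es e e'; rewrite /lneg /= es; case: b {e}; case: b' {e'} => /=; lia.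
  by rewrite /lneg /=; case: b {e}; case: b' {e'} => /=; lia.
have le := s_le _ _ (ltnW lt) lt_j.
have [es|ne] := eqVneq (nth 0%N s j') (nth 0%N s j).
  by have := blk _ _ _ _ _ _ lt lt_j es e' e; rewrite /lneg /= es; case: b {e}; case: b' {e'} => /=; lia.
by rewrite /lneg /=; case: b {e}; case: b' {e'} => /=; lia.
Qed.

Lemma biword_of_sorted n t s pi : signed_perm n pi -> size s = n -> sorted leq s ->
  all (fun x => 0 < x) s -> inverse_asc s pi -> size t = n ->
  sorted canon_le (biword_of n t s pi) <-> (sorted leq t /\ forall i, i.+1 < n ->
     nth 0%N t i = nth 0%N t i.+1 -> (lneg (nth (0%N, false) pi i) < lneg (nth (0%N, false) pi i.+1))%R).
Proof.
move=> sp sz srt pos asc szt.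
pose b0 : biletter := ((0, false), (0, false)).
have s_pos k : k < n -> 0 < nth 0%N s k by move=> lt_k; apply: (allP pos); rewrite mem_nth ?sz.
have pi_pos i : i < n -> 0 < nth 0%N s (nth (0%N, false) pi i).1.-1.
  move=> lt_i; have [rowE _ _ _] := perm_entries_signed sp.
  have [j lt_j] := rowE _ lt_i; case e: (entry pi i j) => [b|] // _.
  by rewrite ((entryP _ _ _ _).1 e) /=; apply: s_pos.
have stepE i : i.+1 < n ->
    canon_le (nth b0 (biword_of n t s pi) i) (nth b0 (biword_of n t s pi) i.+1) =
    (nth 0%N t i < nth 0%N t i.+1) || (nth 0%N t i == nth 0%N t i.+1) &&
       (lneg (nth (0%N, false) pi i) < lneg (nth (0%N, false) pi i.+1))%R.
  move=> lt_i; rewrite !(nth_map 0) ?size_iota ?(ltnW lt_i) // !nth_iota ?(ltnW lt_i) // !add0n.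
  rewrite canon_le_unbarred /= ?pi_pos // ?(ltnW lt_i) //.
  by rewrite (biword_of_step sp sz srt pos asc lt_i).
have szb : size (biword_of n t s pi) = n by rewrite size_map size_iota.
split=> [/(sortedP b0)|[/(sortedP 0) ts h]].
  rewrite szb => hs; split=> [|i lt_i e].
    by apply/(sortedP 0) => i; rewrite szt => lt_i; have := hs i lt_i; rewrite stepE //; lia.
  by have := hs i lt_i; rewrite stepE // e ltnn eqxx.
apply/(sortedP b0) => i; rewrite szb => lt_i; rewrite stepE //.
have := ts i; rewrite szt => /(_ lt_i); rewrite leq_eqVlt => /orP[/eqP e|-> //].
by rewrite e ltnn eqxx /= h.
Qed.

(** * The bijection *)

Definition is_vert (lam mu : part) : nat := (domino_of mu lam).2.

Lemma square_is_vert lam mu nu rho m : square lam mu nu rho m ->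
  is_vert mu rho + is_vert nu rho = is_vert lam nu + is_vert lam mu + (m == Some true).*2.
Proof.
move=> [a [b [a' [b' [la lb ma nb L]]]]]; have := square_vert la lb ma nb L.
by rewrite (wstep_vert la) (wstep_vert lb) (wstep_vert ma) (wstep_vert nb).
Qed.

Lemma is_vert_refl lam : is_part lam -> is_vert lam lam = 0.
Proof. by move=> pl; rewrite /is_vert -(@wstep_vert lam None). Qed.

Lemma grid_spin r n G M : grid r n G M ->
  \sum_(i < n) is_vert (G i n) (G i.+1 n) + \sum_(j < n) is_vert (G n j) (G n j.+1) =
  (\sum_(i < n) \sum_(j < n) (M i j == Some true)).*2.
Proof.
move=> [G0 G0' sq]; have pd := is_vert_refl (delta_part r).
have row i m : i < n -> m <= n ->
    \sum_(j < m) is_vert (G i.+1 j) (G i.+1 j.+1) + is_vert (G i m) (G i.+1 m) =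
    \sum_(j < m) is_vert (G i j) (G i j.+1) + (\sum_(j < m) (M i j == Some true)).*2.
  move=> lt_i; elim: m => [_|m IH lt_m]; first by rewrite !big_ord0 !G0 ?pd // ltnW.
  have := IH (ltnW lt_m); have := square_is_vert (sq i m lt_i lt_m).
  by rewrite !big_ord_recr /= doubleD; lia.
have rows k : k <= n ->
    \sum_(i < k) is_vert (G i n) (G i.+1 n) + \sum_(j < n) is_vert (G k j) (G k j.+1) =
    (\sum_(i < k) \sum_(j < n) (M i j == Some true)).*2.
  elim: k => [_|k IH lt_k].
    by rewrite !big_ord0 big1 // => j _; rewrite !G0' ?pd // ltnW.
  have := IH (ltnW lt_k); have := row k n lt_k (leqnn n).
  by rewrite !big_ord_recr /= doubleD; lia.
exact: rows.
Qed.

Lemma bars_entry n pi : signed_perm n pi ->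
  \sum_(i < n) \sum_(j < n) (entry pi i j == Some true) = count (fun y => y.2) pi.
Proof.
move=> sp; have [sz _] := sp; have [rowE _ rowM _] := perm_entries_signed sp.
rewrite -[in RHS](mkseq_nth (0, false) pi) sz count_map -sum1_count [RHS]big_mkcond /=.
have -> : iota 0 n = index_iota 0 n by rewrite /index_iota subn0.
rewrite big_mkord; apply: eq_bigr => i _.
have [j lt_j Mj] := rowE i (ltn_ord i).
rewrite (bigD1 (Ordinal lt_j)) //= big1 => [|k nk]; last first.
  case e: (entry pi i k) => [b|] //; case/eqP: nk; apply: val_inj => /=.
  by apply: rowM _ Mj; rewrite e.
case e: (entry pi i j) Mj => [b|] // _.
by rewrite ((entryP _ _ _ _).1 e) addn0 /=; case: (b).
Qed.

Lemma chain_bottom r n pi : signed_perm n pi -> chain r n (growth_at r pi n).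
Proof.
move=> sp; have gG := growth_grid r sp; have [sz _] := sp.
split=> [|j lt_j]; first by rewrite growth_at0 ?sz.
exact: (grid_right_step (grid_sym gG) (perm_entries_sym (perm_entries_signed sp)) lt_j).
Qed.

Lemma chain_right r n pi : signed_perm n pi -> chain r n (fun i => growth_at r pi i n).
Proof.
move=> sp; have gG := growth_grid r sp; have [sz _] := sp.
split=> [|j lt_j]; first by rewrite growth_at0l ?sz.
exact: (grid_right_step gG (perm_entries_signed sp) lt_j).
Qed.

Lemma right_asc r n pi i : signed_perm n pi -> i.+1 < n ->
  (rcol (chain_dom (fun k => growth_at r pi k n) i) <
   lcol (chain_dom (fun k => growth_at r pi k n) i.+1)) =
  (lneg (nth (0%N, false) pi i) < lneg (nth (0%N, false) pi i.+1))%R.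
Proof.
move=> sp lt_i; have pe := perm_entries_signed sp; have [rowE _ _ _] := pe.
have [j lt_j Mj] := rowE _ (ltnW lt_i); have [j' lt_j' Mj'] := rowE _ lt_i.
case e: (entry pi i j) Mj => [b|] // _; case e': (entry pi i.+1 j') Mj' => [b'|] // _.
rewrite ((entryP _ _ _ _).1 e) ((entryP _ _ _ _).1 e').
have [p [q [s1 s2 <-]]] := grid_asc (growth_grid r sp) pe lt_i lt_j lt_j' e e'.
by rewrite (step_asc s1 s2).
Qed.

Lemma bottom_asc r n pi k i i' b b' : signed_perm n pi -> k.+1 < n ->
  entry pi i k = Some b -> entry pi i' k.+1 = Some b' ->
  (rcol (chain_dom (growth_at r pi n) k) < lcol (chain_dom (growth_at r pi n) k.+1)) =
  (lneg (i.+1, b) < lneg (i'.+1, b'))%R.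
Proof.
move=> sp lt_k e e'; have pe := perm_entries_sym (perm_entries_signed sp).
have lt_n l m c : entry pi l m = Some c -> l < n.
  move=> /entryP h; have [<- _] := sp.
  by rewrite ltnNge; apply/negP => ge; rewrite nth_default in h.
have [p [q [s1 s2 <-]]] :=
  grid_asc (grid_sym (growth_grid r sp)) pe lt_k (lt_n _ _ _ e) (lt_n _ _ _ e') e e'.
by rewrite (step_asc s1 s2).
Qed.

(** One ascent condition seen from two sides: canonical order of the inverse biword, and repeated
    labels in the insertion tableau. *)
Lemma labelling_bottom r n pi s : signed_perm n pi -> size s = n -> sorted leq s ->
  all (fun x => 0 < x) s -> inverse_asc s pi <-> labelling (growth_at r pi n) n s.
Proof.
move=> sp sz srt pos; split=> [asc|[_ _ _ asc] k i i' b b'].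
  split=> // k lt_k es; rewrite (bottom_asc r sp lt_k (entry_place sp (ltnW lt_k)) (entry_place sp lt_k)).
  by apply: asc es (entry_place sp (ltnW lt_k)) (entry_place sp lt_k); rewrite sz.
by rewrite sz => lt_k es e e'; rewrite -(bottom_asc r sp lt_k e e') asc.
Qed.

Lemma labelling_right r n pi t : signed_perm n pi -> size t = n -> sorted leq t ->
  all (fun x => 0 < x) t ->
  (forall i, i.+1 < n -> nth 0 t i = nth 0 t i.+1 ->
     (lneg (nth (0%N, false) pi i) < lneg (nth (0%N, false) pi i.+1))%R) <->
  labelling (fun i => growth_at r pi i n) n t.
Proof.
move=> sp sz srt pos; split=> [asc|[_ _ _ asc] i lt_i et].
  by split=> // i lt_i et; rewrite (right_asc r sp lt_i) asc.
by rewrite -(right_asc r sp lt_i) asc.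
Qed.

Lemma Pd_chain r n pi : signed_perm n pi ->
  Pd r pi = chain_label (growth_at r pi n) (iota 1 n) n.
Proof.
move=> [sz _]; rewrite /Pd -nth_last /growth size_rows_from -/(growth r pi) /= sz.
by rewrite (@chain_tab_label _ n) ?size_growth_row ?sz // -sz.
Qed.

Lemma Qd_chain r n pi : signed_perm n pi ->
  Qd r pi = chain_label (fun i => growth_at r pi i n) (iota 1 n) n.
Proof.
move=> [sz _]; have szg : size (growth r pi) = n.+1 by rewrite size_rows_from sz.
rewrite /Qd (@chain_tab_label _ n) ?size_map //; apply: eq_chain_label => k le_k.
by rewrite (nth_map [::]) ?szg // -nth_last size_growth_row ?sz.
Qed.

Definition upper_labels (w : biword) : seq nat := [seq b.1.1 | b <- w].
Definition lower_labels (w : biword) : seq nat := sort leq [seq b.2.1 | b <- w].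

Definition biword_tableaux (r n : nat) (w : biword) : tableau * tableau :=
  let pi := bottom (bst w) in
  (chain_label (growth_at r pi n) (lower_labels w) n,
   chain_label (fun i => growth_at r pi i n) (upper_labels w) n).

Lemma colored_biwordP r n w : colored_biword n w ->
  [/\ signed_perm n (bottom (bst w)),
      w = biword_of n (upper_labels w) (lower_labels w) (bottom (bst w)),
      labelling (growth_at r (bottom (bst w)) n) n (lower_labels w) &
      labelling (fun i => growth_at r (bottom (bst w)) i n) n (upper_labels w)].
Proof.
move=> /and3P[/eqP sz /andP[pw srt] unb].
have [pi [sp ew asc]] := biword_of_exists sz pw unb.
have szs : size (lower_labels w) = n by rewrite size_sort size_map.
have szt : size (upper_labels w) = n by rewrite size_map.
have ss : sorted leq (lower_labels w) by apply: (sort_sorted leq_total).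
have ps : all (fun x => 0 < x) (lower_labels w).
  by rewrite all_sort all_map; apply: sub_all pw => b /andP[].
have pt : all (fun x => 0 < x) (upper_labels w).
  by rewrite all_map; apply: sub_all pw => b /andP[].
have epi : bottom (bst w) = pi by rewrite {1}ew; apply: bst_biword_of.
rewrite epi; have := (biword_of_sorted sp szs ss ps asc szt).1.
rewrite -ew => /(_ srt)[st hasc]; split=> //.
  exact: (labelling_bottom r sp szs ss ps).1.
exact: (labelling_right r sp szt st pt).1.
Qed.

Lemma eq_count_sorted (s t : seq nat) : sorted leq s -> sorted leq t ->
  (forall i, count_mem i s = count_mem i t) -> s = t.
Proof.
move=> ss st e; apply: (sorted_eq leq_trans anti_leq) => //.
by apply/allP => i _ /=; rewrite e.
Qed.

Theorem theorem2p3 (r n : nat) :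
  exists Phi : biword -> tableau * tableau,
  [/\ (forall w, colored_biword n w ->
         exists lam, [/\ in_Pr r n lam, ssdt r lam (Phi w).1 & ssdt r lam (Phi w).2]),
      (forall w w', colored_biword n w -> colored_biword n w' -> Phi w = Phi w' -> w = w'),
      (forall lam P Q, in_Pr r n lam -> ssdt r lam P -> ssdt r lam Q ->
         exists2 w, colored_biword n w & Phi w = (P, Q)) &
      (forall w, colored_biword n w ->
         [/\ ((tc w)%:R = sp (Phi w).1 + sp (Phi w).2 :> rat)%R,
             (forall i, wt (Phi w).1 i = lower_wt w i),
             (forall i, wt (Phi w).2 i = upper_wt w i),
             std_tab (Phi w).1 = Pd r (bottom (bst w)) &
             std_tab (Phi w).2 = Qd r (bottom (bst w))])].
Proof.
have low_wt w i : count_mem i (lower_labels w) = lower_wt w i.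
  by rewrite (permP (permEl (perm_sort _ _))) count_map.
have up_wt w i : count_mem i (upper_labels w) = upper_wt w i by rewrite count_map.
exists (biword_tableaux r n); split.
- move=> w /(colored_biwordP r)[sp _ labP labQ].
  exists (growth_at r (bottom (bst w)) n n); split.
  + exact: in_Pr_chain (chain_bottom r sp).
  + exact: (ssdt_chain_label (chain_bottom r sp) labP).
  + exact: (ssdt_chain_label (chain_right r sp) labQ).
- move=> w w' /(colored_biwordP r)[sp ew labP labQ] /(colored_biwordP r)[sp' ew' labP' labQ'] [eP eQ].
  have chP := chain_bottom r sp; have chP' := chain_bottom r sp'.
  have chQ := chain_right r sp; have chQ' := chain_right r sp'.
  (* Standardising the tableaux recovers both chains, hence the signed permutation; the weights then
     recover the two sorted label sequences. *)
  have epi : bottom (bst w) = bottom (bst w').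
    apply: (growth_inj sp sp' (r := r)).
      apply: (chain_label_inj chP chP').
      by rewrite -(std_tab_chain chP labP) -(std_tab_chain chP' labP') eP.
    apply: (chain_label_inj chQ chQ').
    by rewrite -(std_tab_chain chQ labQ) -(std_tab_chain chQ' labQ') eQ.
  have [szs ss _ _] := labP; have [szs' ss' _ _] := labP'.
  have [szt st _ _] := labQ; have [szt' st' _ _] := labQ'.
  have es : lower_labels w = lower_labels w'.
    by apply: eq_count_sorted => // i; rewrite -(wt_chain i chP szs) eP (wt_chain i chP' szs').
  have et : upper_labels w = upper_labels w'.
    by apply: eq_count_sorted => // i; rewrite -(wt_chain i chQ szt) eQ (wt_chain i chQ' szt').
  by rewrite ew ew' es et epi.
- move=> lam P Q [pl [star _] szl] tP tQ.
  have sub i := rem_star_sub i star.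
  (* The number of dominoes is forced by the size of [lam]. *)
  have card_n C m : chain r m C -> C m = lam -> m = n.
    by move=> /in_Pr_chain[_ _ +] eC; rewrite eC szl; lia.
  have [C [s [chC Cn labP eP]]] := ssdt_chain tP sub.
  have [D [t [chD Dn labQ eQ]]] := ssdt_chain tQ sub.
  have cP := card_n _ _ chC Cn; have cQ := card_n _ _ chD Dn.
  rewrite cP in chC Cn labP eP; rewrite cQ in chD Dn labQ eQ.
  have [C0 stC] := chC; have [D0 stD] := chD.
  have [pi sp [eC eD]] := growth_surj C0 D0 (etrans Cn (esym Dn)) stC stD.
  have [szs ss ps ascs] := labP; have [szt st pt asct] := labQ.
  have domC k : k < n -> chain_dom (growth_at r pi n) k = chain_dom C k.
    by move=> lt; rewrite /chain_dom !eC // ltnW.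
  have domD k : k < n -> chain_dom (fun i => growth_at r pi i n) k = chain_dom D k.
    by move=> lt; rewrite /chain_dom !eD // ltnW.
  have asc : inverse_asc s pi.
    apply/(labelling_bottom r sp szs ss ps); split=> // k lt_k ek.
    by rewrite !domC ?(ltnW lt_k) // ascs.
  have asc' : labelling (fun i => growth_at r pi i n) n t.
    by split=> // k lt_k ek; rewrite !domD ?(ltnW lt_k) // asct.
  pose w := biword_of n t s pi.
  have epi : bottom (bst w) = pi by apply: bst_biword_of.
  have ut : upper_labels w = t.
    by rewrite /upper_labels -map_comp -[RHS](mkseq_nth 0) szt.
  have ls : lower_labels w = s.
    apply: (sorted_eq leq_trans anti_leq) => //; first exact: (sort_sorted leq_total).
    rewrite perm_sort -map_comp /=.
    have := map_place (fun i => nth 0 s (nth (0, false) pi i).1.-1) sp.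
    rewrite perm_sym => h; apply: perm_trans h _.
    rewrite (_ : map _ _ = s) // -[RHS](mkseq_nth 0) szs; apply/eq_in_map => k.
    by rewrite mem_iota => lt_k; rewrite (nth_place sp).
  exists w; last first.
    rewrite /biword_tableaux epi ut ls eP eQ; congr pair; apply: eq_chain_label => k le_k.
      exact: eC.
    exact: eD.
  have s_pos k : k < n -> 0 < nth 0 s k by move=> lt_k; apply: (allP ps); rewrite mem_nth ?szs.
  apply/and3P; split; first by rewrite size_map size_iota.
    apply/andP; split; last first.
      by apply/(biword_of_sorted sp szs ss ps asc szt); split=> //; apply/(labelling_right r sp szt st pt).
    apply/allP => _ /mapP[i + ->]; rewrite mem_iota => lt_i /=.
    rewrite (allP pt) ?mem_nth ?szt //=.
    have [rowE _ _ _] := perm_entries_signed sp; have [j lt_j Mj] := rowE i lt_i.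
    case e: (entry pi i j) Mj => [b|] // _.
    by rewrite ((entryP _ _ _ _).1 e) /=; apply: s_pos.
  by apply/allP => _ /mapP[i _ ->].
move=> w cw; have [sp ew labP labQ] := colored_biwordP r cw.
have chP := chain_bottom r sp; have chQ := chain_right r sp.
have [szs _ _ _] := labP; have [szt _ _ _] := labQ.
rewrite /biword_tableaux; split=> [|i|i||] /=.
- rewrite !(sp_chain _ chP) !(sp_chain _ chQ) -mulrDl -natrD.
  (* The doubled count of bars cancels the denominator 2 of [sp]; the upper row has no bars, so the
     count of barred lower letters is all of [tc]. *)
  have := grid_spin (growth_grid r sp); rewrite (bars_entry sp) addnC => ->.
  rewrite -muln2 natrM mulfK //; congr (_%:R)%R.
  rewrite /tc; have /and3P[_ _ /allP unb] := cw.
  rewrite (eq_in_count (a2 := pred0)) ?count_pred0; last by move=> b /unb /negPf.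
  have [sz _] := sp.
  by rewrite add0n {1}ew count_map -[in RHS](mkseq_nth (0, false) (bottom _)) sz count_map.
- by rewrite (wt_chain i chP szs).
- by rewrite (wt_chain i chQ szt).
- by rewrite (std_tab_chain chP labP) (Pd_chain r sp).
- by rewrite (std_tab_chain chQ labQ) (Qd_chain r sp).
Qed.
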